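(* Let $\rho\in\mathcal S(\mathbb R^{2n+1})$ satisfy $\int\rho(x)\,dx=1$ and $\int x^\alpha\rho(x)\,dx=0$ for every nonzero multi-index $\alpha\in\mathbb N^{2n+1}$, and let $\rho_\varepsilon(x)=\varepsilon^{-(2n+1)}\rho(x/\varepsilon)$ for $\varepsilon\in(0,1)$. Then the net of operators $\hat\pi(\rho_\varepsilon)$ is a rapidly converging approximation (rapidly converging approximate unit) on $\mathbb R^n$.
   Context: For $x,\xi\in\mathbb R^n$ let $T_xf(t)=f(t-x)$ and $M_\xi f(t)=e^{2\pi i\xi\cdot t}f(t)$. For $(x,\xi,\tau)\in H_n=\mathbb R^{2n+1}$ (Heisenberg group, with inverse $(x,\xi,\tau)^{-1}=(-x,-\xi,-\tau)$), the Schrödinger representation is given by the unitary operators $\pi(x,\xi,\tau)=e^{2\pi i\tau}e^{\pi i x\cdot\xi}T_xM_\xi$ on $L^2(\mathbb R^n)$. For $F\in\mathcal S(\mathbb R^{2n+1})$, $\hat\pi(F)=\int_{H_n}F(\alpha)\pi(\alpha^{-1})\,d\alpha$ (Lebesgue measure); its integral kernel lies in $\mathcal S(\mathbb R^n\times\mathbb R^n)$, so it acts on compactly supported distributions. $\mathcal E'(\mathbb R^n)$ denotes compactly supported distributions. A smooth net $(0,1)\ni\varepsilon\mapsto f_\varepsilon\in C^\infty(\mathbb R^n)$ is moderate if for every continuous seminorm $p$ on $C^\infty(\mathbb R^n)$ there is $N\in\mathbb Z$ with $p(f_\varepsilon)=O(\varepsilon^N)$ as $\varepsilon\to0$, and negligible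 if for every $p$ this holds for all $N\in\mathbb Z$. $\mathcal G^s(\mathbb R^n)$ is the quotient of moderate nets by negligible nets, with classes $\langle f_\varepsilon\rangle$. Replacing $\mathbb R^n$ by open subsets gives a sheaf, and the support $\operatorname{supp}_g$ of an element is the complement of the largest open set on which it restricts to $0$. A rapidly converging approximate unit on $\mathbb R^n$ is a net of operators $T_\varepsilon$ with integral kernels in $\mathcal S(\mathbb R^n\times\mathbb R^n)$ such that: (a) for every $u\in\mathcal E'(\mathbb R^n)$ the net $T_\varepsilon(u)$ is a moderate net in $C^\infty(\mathbb R^n)$ and $\lim_{\varepsilon\to0}T_\varepsilon(u)=u$, so that $T_\varepsilon:\mathcal E'(\mathbb R^n)\to\mathcal G^s(\mathbb R^n)$ is a well-defined injective map; (b) for every $f\in C_c^\infty(\mathbb R^n)$, $T_\varepsilon(f)-f$ is a negligible net; (c) for every $u\in\mathcal E'(\mathbb R^n)$, $\operatorname{supp}u=\operatorname{supp}_g\langle T_\varepsilon(u)\rangle$. *)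

(* Defs.v *)
From HB Require Import structures.
From mathcomp Require Import all_boot all_order all_algebra.
From mathcomp Require Import all_classical all_reals all_analysis.
From mathcomp Require Import complex.

Set Implicit Arguments.
Unset Strict Implicit.
Unset Printing Implicit Defensive.

Import Order.TTheory GRing.Theory Num.Theory.
Import numFieldNormedType.Exports.

Local Open Scope classical_set_scope.
Local Open Scope ring_scope.
Local Open Scope complex_scope.
Local Notation normc := Normc.normc.

Section lebesgue_measure_tuple.
Variable R : realType.

Let leb1 : {sigma_finite_measure set _ -> \bar R} := @lebesgue_measure R.

Definition tcons n (p : measurableTypeR R * n.-tuple (measurableTypeR R)) :
  n.+1.-tuple (measurableTypeR R) := [tuple of p.1 :: p.2].

Lemma measurable_tcons n : measurable_fun setT (@tcons n).
Proof. exact: measurable_cons. Qed.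

HB.instance Definition _ n :=
  isMeasurableFun.Build _ _ _ _ (@tcons n) (@measurable_tcons n).

Section cons_measure.
Variable n : nat.
Variable mu : {sigma_finite_measure set (n.-tuple (measurableTypeR R)) -> \bar R}.

Definition cons_measure : set (n.+1.-tuple (measurableTypeR R)) -> \bar R :=
  pushforward (leb1 \x mu)%E (@tcons n).

Let cons_measure0 : cons_measure set0 = 0%E.
Proof. exact: measure0. Qed.

Let cons_measure_ge0 A : (0 <= cons_measure A)%E.
Proof. exact: measure_ge0. Qed.

Let cons_measure_sigma_additive : semi_sigma_additive cons_measure.
Proof. exact: measure_semi_sigma_additive. Qed.

HB.instance Definition _ := isMeasure.Build _ _ _ cons_measure
  cons_measure0 cons_measure_ge0 cons_measure_sigma_additive.

Let cons_measure_sigma_finite : sigma_finite setT cons_measure.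
Proof.
have /sigma_finiteP[F [FT Fnd Foo]] := sigma_finiteT leb1.
have /sigma_finiteP[G [GT Gnd Goo]] := sigma_finiteT mu.
exists (fun k => [set t : n.+1.-tuple (measurableTypeR R) |
    F k (thead t) /\ G k [tuple of behead t]]).
  apply/esym; rewrite -subTset => t _.
  have [i _ Fi] : (\bigcup_i F i) (thead t) by rewrite -FT.
  have [j _ Gj] : (\bigcup_i G i) [tuple of behead t] by rewrite -GT.
  exists (maxn i j) => //; split.
    by move: Fi; apply/subsetPset/Fnd; rewrite leq_maxl.
  by move: Gj; apply/subsetPset/Gnd; rewrite leq_maxr.
move=> k; have [mFk Fkoo] := Foo k; have [mGk Gkoo] := Goo k; split.
  apply: measurableI; rewrite -[X in measurable X]setTI.
    exact: (@measurable_tnth _ (measurableTypeR R) _ ord0).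
  exact: measurable_behead.
rewrite /cons_measure /pushforward (_ : _ @^-1` _ = F k `*` G k).
  by rewrite product_measure1E// lte_mul_pinfty// ge0_fin_numE.
apply/seteqP; split => -[x t]/=; rewrite theadE (_ : [tuple of _] = t)//;
  exact/val_inj.
Qed.

HB.instance Definition _ := Measure_isSigmaFinite.Build _ _ _ cons_measure
  cons_measure_sigma_finite.

End cons_measure.

Fixpoint lebesgue_tuple n :
    {sigma_finite_measure set (n.-tuple (measurableTypeR R)) -> \bar R} :=
  if n is m.+1 then cons_measure (lebesgue_tuple m) else \d_([tuple]).

End lebesgue_measure_tuple.

Section functions.
Variables (R : realType) (m : nat).
Local Notation C := R[i].
Local Notation V := 'rV[R]_m.
Implicit Types (f : V -> C) (g : V -> R) (U : set V).

(* MathComp-Analysis has a sigma-algebra on tuples but none on row vectors. *)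
Definition rvec (t : m.-tuple (measurableTypeR R)) : V := \row_i tnth t i.

Definition cintegral f : C :=
  (\int[lebesgue_tuple R m]_t complex.Re (f (rvec t)))%R +i*
  (\int[lebesgue_tuple R m]_t complex.Im (f (rvec t)))%R.

Definition L2 f : Prop :=
  [/\ measurable_fun setT (fun t => complex.Re (f (rvec t))),
      measurable_fun setT (fun t => complex.Im (f (rvec t))) &
      (\int[lebesgue_tuple R m]_t ((normc (f (rvec t)) ^+ 2)%:E) < +oo)%E].

Definition mindex := {ffun 'I_m -> nat}.
Definition mdeg (a : mindex) : nat := (\sum_i a i)%N.
Definition mpow (x : V) (a : mindex) : R := \prod_i x 0 i ^+ a i.

Definition ipartial (s : seq 'I_m) g : V -> R :=
  foldr (fun i h x => 'D_(delta_mx 0 i) h x) g s.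

Definition smooth_real U g : Prop := forall (s : seq 'I_m) (x : V), U x ->
  {for x, continuous (ipartial s g)} /\
  (forall i, derivable (ipartial s g) x (delta_mx 0 i)).

(* For U open this is f|_U \in C^oo(U); the values of f outside U play no role. *)
Definition smooth U f : Prop :=
  smooth_real U (fun x => complex.Re (f x)) /\
  smooth_real U (fun x => complex.Im (f x)).

Definition mindex_seq (b : mindex) : seq 'I_m :=
  flatten [seq nseq (b i) i | i <- enum 'I_m].

Definition mderiv (b : mindex) f : V -> C := fun x =>
  ipartial (mindex_seq b) (fun y => complex.Re (f y)) x +i*
  ipartial (mindex_seq b) (fun y => complex.Im (f y)) x.

Definition schwartz f : Prop := smooth setT f /\
  forall a b : mindex, exists M : R, forall x,
    `|mpow x a| * normc (mderiv b f x) <= M.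

Definition test_function f : Prop :=
  smooth setT f /\ compact (closure [set x | f x != 0]).

(* The seminorms sup_{x in A, |b| <= k} |d^b f(x)|, for A compact in U,
   generate the topology of C^oo(U). *)
Definition sup_seminorm (A : set V) (k : nat) f : R :=
  sup [set r | exists x b,
    [/\ A x, (mdeg b <= k)%N & r = normc (mderiv b f x)]].

Definition continuous_seminorm U (p : (V -> C) -> R) : Prop :=
  [/\ forall f h, smooth U f -> smooth U h ->
        p (fun x => f x + h x) <= p f + p h,
      forall (c : C) f, smooth U f -> p (fun x => c * f x) = normc c * p f &
      exists (A : set V) (k : nat) (c : R), [/\ compact A, A `<=` U &
        forall f, smooth U f -> p f <= c * sup_seminorm A k f]].

(* Elements of E'(R^m), as continuous linear functionals on C^oo(R^m); only the
   values on smooth functions are meaningful. *)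
Definition compact_distribution (u : (V -> C) -> C) : Prop :=
  (forall (c : C) f h, smooth setT f -> smooth setT h ->
     u (fun x => c * f x + h x) = c * u f + u h) /\
  continuous_seminorm setT (fun f => normc (u f)).

Definition distribution_eq (u v : (V -> C) -> C) : Prop :=
  forall f, smooth setT f -> u f = v f.

Definition distribution_support (u : (V -> C) -> C) : set V :=
  ~` \bigcup_(U in [set U : set V | open U /\
      forall f, test_function f -> closure [set x | f x != 0] `<=` U ->
        u f = 0]) U.

End functions.

Section generalized_functions.
Variables (R : realType) (n : nat).
Local Notation C := R[i].
Local Notation V := 'rV[R]_n.
Local Notation net := (R -> V -> C).
Implicit Types (f : net) (U W : set V) (X : set net).

(* Only the indices in (0,1) are meaningful. Smoothness is that of a curve in the
   locally convex space C^oo(U): d k is the k-th derivative of f. *)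
Definition smooth_net U f : Prop := exists d : nat -> net, d 0%N = f /\
  forall k e, 0 < e < 1 -> smooth U (d k e) /\
    forall p, continuous_seminorm U p ->
      p (fun x => (h^-1)%:C * (d k (e + h) x - d k e x) - d k.+1 e x)
        @[h --> 0^'] --> (0 : R).

Definition moderate U f : Prop := smooth_net U f /\
  forall p, continuous_seminorm U p -> exists N : int,
    (fun e => p (f e) : R^o) =O_ (0^'+) (fun e => e ^ N : R^o).

Definition negligible U f : Prop := smooth_net U f /\
  forall p, continuous_seminorm U p -> forall N : int,
    (fun e => p (f e) : R^o) =O_ (0^'+) (fun e => e ^ N : R^o).

(* The class of a moderate net f in G^s(U), as its set of representatives. *)
Definition gclass U f : set net := [set g | moderate U g /\
  negligible U (fun e x => g e x - f e x)].

(* The restriction to W of a class X in G^s(U), for W contained in U. *)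
Definition grestrict W X : set net := \bigcup_(f in X) gclass W f.

Definition gsupport X : set V :=
  ~` \bigcup_(W in [set W : set V | open W /\
      grestrict W X = gclass W (fun _ _ => 0)]) W.

End generalized_functions.

Section operators.
Variables (R : realType) (n : nat).
Local Notation C := R[i].
Local Notation V := 'rV[R]_n.
Implicit Types (K : V -> V -> C) (T : (V -> C) -> (V -> C)).

Definition kernel_fun K (f : V -> C) : V -> C :=
  fun x => cintegral (fun y => K x y * f y).

Definition kernel_distribution K (u : (V -> C) -> C) : V -> C :=
  fun x => u (K x).

Definition schwartz_kernel K : Prop :=
  schwartz (fun z : 'rV[R]_(n + n) => K (lsubmx z) (rsubmx z)).

(* T is the operator on L^2(R^n) with integral kernel K. *)
Definition has_kernel T K : Prop := forall f, L2 f ->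
  {ae lebesgue_tuple R n, forall t, T f (rvec t) = kernel_fun K f (rvec t)}.

(* The kernels K e are determined by the operators T e, and T e acts on E'(R^n)
   through K e. *)
Definition rapidly_converging_approximate_unit
    (T : R -> (V -> C) -> (V -> C)) : Prop :=
  exists K : R -> V -> V -> C,
  [/\ forall e, 0 < e < 1 -> schwartz_kernel (K e) /\ has_kernel (T e) (K e),
      (forall u, compact_distribution u ->
         moderate setT (fun e => kernel_distribution (K e) u) /\
         forall phi, test_function phi ->
           normc (cintegral (fun x => kernel_distribution (K e) u x * phi x)
                  - u phi) @[e --> 0^'+] --> (0 : R)) /\
      (forall u v, compact_distribution u -> compact_distribution v ->
         gclass setT (fun e => kernel_distribution (K e) u) =
         gclass setT (fun e => kernel_distribution (K e) v) ->
         distribution_eq u v),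
      forall f, test_function f ->
        negligible setT (fun e x => kernel_fun (K e) f x - f x) &
      forall u, compact_distribution u ->
        distribution_support u =
        gsupport (gclass setT (fun e => kernel_distribution (K e) u))].

End operators.

Section heisenberg.
Variables (R : realType) (n : nat).
Local Notation C := R[i].
Local Notation V := 'rV[R]_n.
Local Notation H := 'rV[R]_(n + n + 1).
Implicit Types (f : V -> C) (x xi : V) (a : H).

Definition dot x xi : R := \sum_i x 0 i * xi 0 i.
Definition expi (r : R) : C := cos r +i* sin r.

Definition translation x f : V -> C := fun t => f (t - x).
Definition modulation xi f : V -> C := fun t => expi (2 * pi * dot xi t) * f t.

(* a = (x, xi, tau) *)
Definition hpos a : V := lsubmx (lsubmx a).
Definition hfreq a : V := rsubmx (lsubmx a).
Definition hcenter a : R := rsubmx a 0 0.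
Definition hinv a : H := - a.

Definition schrodinger a f : V -> C := fun t =>
  expi (2 * pi * hcenter a) * expi (pi * dot (hpos a) (hfreq a)) *
  translation (hpos a) (modulation (hfreq a) f) t.

(* For F Schwartz and f in L^2(R^n) the integral converges absolutely for every
   t, and defines the value at t of \hat\pi(F) f. *)
Definition integrated_rep (F : H -> C) f : V -> C := fun t =>
  cintegral (fun a => F a * schrodinger (hinv a) f t).

End heisenberg.

Definition rescale (R : realType) (m : nat) (rho : 'rV[R]_m -> R[i]) (e : R) :
  'rV[R]_m -> R[i] := fun x => (e ^- m)%:C * rho (e^-1 *: x).

(* Main.v *)
Require Import Defs.
From HB Require Import structures.
From mathcomp Require Import all_boot all_order all_algebra.
From mathcomp Require Import all_classical all_reals all_analysis.
From mathcomp Require Import measurable_realfun complex ring lra zify.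

(** Write rho = rho_1 + i rho_2 and a = (z, xi, tau). Unfolding the
    representation gives, for f square integrable and every x,

      hatpi(F) f (x) = int F(a) exp(-2 i pi (tau + xi.(x + z/2))) f(x + z) da,

    so hatpi(rho_e) has the integral kernel

      K_e(x, y) = int rho_e(y - x, xi, tau) exp(-2 i pi (tau + xi.(x + y)/2)),

    the integral being over (xi, tau). Sines are written as shifted cosines, so
    that every estimate below is about one kind of real integral, with an angle
    th as a parameter.

    The kernels. A derivative of the integral in y - x falls on rho, a
    derivative in (x + y)/2 brings down a factor xi, multiplication by
    (x + y)/2 is an integration by parts in xi, multiplication by y - x is a
    multiplication of rho by e z, and a derivative in e is a dilation field on
    rho divided by e. The real and imaginary parts of K_e therefore lie in a
    space [fam] that is stable under all these operations and whose members
    are O(e^-k). Hence K_e is a Schwartz kernel, and trading powers of y - x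
    for powers of e shows that everything is O(e^M) for every M where
    |y - x| >= d ([fam_offdiag]). A compactly supported distribution acting in
    y can be differentiated under the bracket ([functional_derive]), so that
    x |-> u(K_e(x, .)) is a moderate net ([rnet_functional], [cnet_moderate]).

    Test functions. After the substitution a -> e a,

      hatpi(rho_e) f (x) =
        int rho(a) exp(-2 i pi e (tau + xi.(x + e z/2))) f(x + e z) da.

    Differentiating the integrand in e or x multiplies rho by coordinates of a
    and differentiates f ([wspan]); at e = 0 the integral is a moment of rho
    times f(x). If all moments of rho vanish, so do those of its multiples by
    coordinates, and the mean value theorem in e gives O(e^M) by induction on
    M ([wspan_small]). Under the hypotheses on rho this applies to the
    derivative in e, whence hatpi(rho_e) f - f and all its derivatives are
    O(e^M), locally uniformly ([dfam_ipartial_small]): the convergence on test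
    functions is rapid ([test_negligible]).

    Distributions. A distribution commutes with the integration of a smooth
    family against a test function ([exchange]), and the transpose of K_e is
    the kernel attached to rho reflected in z, which satisfies the same
    hypotheses ([opK_refl], [mass_zrefl]). So the pairing of u(K_e(x, .)) with
    phi is u applied to an approximation of phi of the same kind, and tends to
    u(phi) ([pairing_limit]). This is the convergence to u; it also gives
    injectivity, since a negligible net pairs to something that tends to 0
    ([dnet_injective]). As for supports, if u vanishes near x0 then only the
    part of K_e(x, .) away from the diagonal contributes to u(K_e(x, .)) for x
    near x0, which is negligible ([dnet_negligible]); conversely, if the net is
    negligible on W, the limit forces u to vanish on W ([dnet_support]). *)

Set Implicit Arguments.
Unset Strict Implicit.
Unset Printing Implicit Defensive.

Import Order.TTheory GRing.Theory Num.Theory.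
Import numFieldNormedType.Exports.

Local Open Scope classical_set_scope.
Local Open Scope ring_scope.
Local Open Scope complex_scope.

Local Notation normc := Normc.normc.
Local Notation negligible := Defs.negligible.

(** * Differential calculus on row vectors *)

Lemma continuousMl_cst (R : realType) (T : topologicalType) (f : T -> R) (c : R) (x : T) :
  {for x, continuous f} -> {for x, continuous (fun y => c * f y)}.
Proof. by move=> cf; exact: cvgMl_tmp. Qed.

Lemma near_eq_continuous (R : realType) (T : topologicalType) (f g : T -> R) (x : T) :
  (\forall y \near x, f y = g y) -> {for x, continuous g} -> {for x, continuous f}.
Proof.
move=> fg cg; rewrite /prop_for /continuous_at (nbhs_singleton fg).
by apply: cvg_trans cg; apply: near_eq_cvg; apply: filterS fg => y ->.
Qed.

Lemma continuous_epsP (R : realType) (V : normedModType R) (f : V -> R) (x : V) :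
  {for x, continuous f} <->
  forall e : R, 0 < e -> exists2 d : R, 0 < d & forall y, `|y - x| < d -> `|f y - f x| <= e.
Proof.
split=> [cf e e0|cf].
  move/cvgrPdist_le : cf => /(_ _ e0); rewrite -nbhs_nearE => /nbhs_ballP[d /= d0 dP].
  by exists d => // y yd; rewrite distrC; apply: dP; rewrite -ball_normE /= distrC.
apply/cvgrPdist_le => e e0; have [d d0 dP] := cf _ e0.
rewrite -nbhs_nearE; apply/nbhs_ballP; exists d => // y.
by rewrite -ball_normE /= distrC => yd; rewrite distrC dP.
Qed.

Lemma is_derive_mul (R : realType) (W : normedModType R) (f g : W -> R) x v (df dg : R) :
  is_derive x v f df -> is_derive x v g dg ->
  is_derive x v (fun y => f y * g y) (df * g x + f x * dg).
Proof.
move=> hf hg; have := is_deriveM hf hg; congr is_derive.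
by rewrite addrC mulrC; congr (_ + _); rewrite mulrC.
Qed.

Lemma is_derive_pow (R : realType) (W : normedModType R) (f : W -> R) x v (df : R) n :
  is_derive x v f df -> is_derive x v (fun y => f y ^+ n) (n%:R * f x ^+ n.-1 * df).
Proof.
move=> hf; elim: n => [|n IH].
  by rewrite !mul0r; under eq_fun do rewrite expr0; exact: is_derive_cst.
under eq_fun do rewrite exprS.
have := is_derive_mul hf IH; congr is_derive; rewrite /= -natr1.
by case: n {IH} => [|n]; rewrite ?mul0r ?add0r ?mulr0 ?addr0 ?expr0 ?mul1r ?mulr1// exprS; ring.
Qed.

Section line.
Variables (R : realType) (V : normedModType R).
Implicit Types (f g : V -> R) (x v w : V).

Lemma is_derive_lineG f x v (d : R) t :
  is_derive (t *: v + x) v f d <-> is_derive t 1 (fun h : R => f (h *: v + x)) d.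
Proof.
have E : (fun h : R => h^-1 *: ((f \o shift (t *: v + x)) (h *: v) - f (t *: v + x))) =
  (fun h : R => h^-1 *: (((fun h : R => f (h *: v + x)) \o shift t) (h *: 1) - f (t *: v + x))).
  by apply/funext => h /=; rewrite /= [h *: 1]mulr1 scalerDl addrA.
split => -[fd fe]; split.
- by rewrite /derivable -E.
- by rewrite /derive -E.
- by rewrite /derivable E.
- by rewrite /derive E.
Qed.

Lemma is_derive_lineG0 f x v (d : R) :
  is_derive x v f d <-> is_derive (0 : R) 1 (fun h : R => f (h *: v + x)) d.
Proof. by have := is_derive_lineG f x v d 0; rewrite scale0r add0r. Qed.

Lemma derive_cont1 (g : R -> R) (t d : R) : is_derive t 1 g d -> {for t, continuous g}.
Proof.
by move=> [gd _]; apply: differentiable_continuous; apply/derivable1_diffP.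
Qed.

Lemma MVT1 (g dg : R -> R) (h : R) :
  (forall t : R, `|t| <= `|h| -> is_derive t 1 g (dg t)) ->
  exists s, `|s| <= `|h| /\ g h - g 0 = h * dg s.
Proof.
move=> gd.
have cg a b : (forall t, a <= t <= b -> `|t| <= `|h|) -> {within `[a, b], continuous g}.
  move=> ab; apply: derivable_within_continuous => t; rewrite in_itv/= => /ab th.
  by case: (gd t th).
have [h0|h0] := leP 0 h.
  have th t : 0 <= t <= h -> `|t| <= `|h|.
    by move=> /andP[t0 th]; rewrite !ger0_norm.
  have gd' t : t \in `]0, h[ -> is_derive t 1 g (dg t).
    by rewrite in_itv/= => /andP[t0 t1]; apply: gd; apply: th; rewrite !ltW.
  have [c] := MVT_segment h0 gd' (cg _ _ th).
  rewrite in_itv/= => ch E; exists c; split; first exact: th.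
  by rewrite E subr0 mulrC.
have th t : h <= t <= 0 -> `|t| <= `|h|.
  by move=> /andP[t0 th]; rewrite !ler0_norm ?lerN2// ltW.
have gd' t : t \in `]h, 0[ -> is_derive t 1 g (dg t).
  by rewrite in_itv/= => /andP[t0 t1]; apply: gd; apply: th; rewrite !ltW.
have [c] := MVT_segment (ltW h0) gd' (cg _ _ th).
rewrite in_itv/= => ch E; exists c; split; first exact: th.
by apply/oppr_inj; rewrite opprB E sub0r mulrN mulrC.
Qed.

Lemma MVT_line f (df : V -> R) x v (h : R) :
  (forall s, `|s| <= `|h| -> is_derive (s *: v + x) v f (df (s *: v + x))) ->
  exists s, `|s| <= `|h| /\ f (h *: v + x) - f x = h * df (s *: v + x).
Proof.
move=> fd.
have [|s [sh E]] := @MVT1 (fun t => f (t *: v + x)) (fun t => df (t *: v + x)) h.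
  by move=> t th; apply/is_derive_lineG; exact: fd.
by exists s; split => //; rewrite -E scale0r add0r.
Qed.

Lemma taylor1 (f df ddf : R -> R) (t h B : R) :
  (forall s, `|s - t| <= `|h| -> is_derive s 1 f (df s)) ->
  (forall s, `|s - t| <= `|h| -> is_derive s 1 df (ddf s)) ->
  (forall s, `|s - t| <= `|h| -> `|ddf s| <= B) ->
  `|f (h + t) - f t - h * df t| <= B * `|h| ^+ 2.
Proof.
move=> fd dfd ddB.
have shift (g dg : R -> R) (h' : R) : `|h'| <= `|h| ->
    (forall s, `|s - t| <= `|h| -> is_derive s 1 g (dg s)) ->
    exists s, `|s| <= `|h'| /\ g (h' + t) - g t = h' * dg (s + t).
  move=> hh gd; have [|s [sh E]] := @MVT1 (fun s => g (s + t)) (fun s => dg (s + t)) h'.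
    move=> s sh; rewrite -[dg _]mulr1; apply: (is_derive1_comp (f := g)).
      by apply: gd; rewrite addrK (le_trans sh).
    by have := is_deriveD (is_derive_id s (1 : R)) (@is_derive_cst R R R t s 1); rewrite addr0.
  by exists s; split => //; rewrite -E add0r.
have [s [sh ->]] := shift f df h (lexx _) fd.
have [s' [sh' E]] := shift df ddf s sh dfd.
rewrite -mulrBr E !normrM mulrA [leRHS]mulrC expr2.
apply: ler_pM => //; first by rewrite ler_wpM2l.
by apply: ddB; rewrite addrK (le_trans sh').
Qed.

(** A derivative in the direction v + w needs more than derivatives in the
    directions v and w at x: the increment along w is taken at h v + x, so the
    derivative along w has to be continuous at x. *)
Lemma derive_add_dir f (df : V -> R) x v w (d : R) :
  is_derive x v f d -> (forall y, is_derive y w f (df y)) -> {for x, continuous df} ->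
  is_derive x (v + w) f (d + df x).
Proof.
move=> fv fw cdf.
have key : (fun h : R => h^-1 *: ((f \o shift x) (h *: (v + w)) - f x)) @ 0^' --> d + df x.
  have fvc : (fun h : R => h^-1 *: ((f \o shift x) (h *: v) - f x)) @ 0^' --> d.
    by case: fv => fd <-; exact: fd.
  have : (fun h : R => h^-1 *: ((f \o shift x) (h *: (v + w)) - (f \o shift x) (h *: v)))
      @ 0^' --> df x.
    apply/cvgrPdist_le => e e0; move/cvgrPdist_le : cdf => /(_ _ e0).
    rewrite -nbhs_nearE => /nbhs_ballP[r /= r0 rP].
    near=> h.
    rewrite /= (_ : h *: (v + w) + x = h *: w + (h *: v + x)); last first.
      by rewrite scalerDr addrA (addrC (h *: w)).
    have [s [sh ->]] := @MVT_line f df (h *: v + x) w h (fun s _ => fw _).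
    rewrite [_ *: _]mulrA mulVf ?mul1r; last by near: h; exact: nbhs_dnbhs_neq.
    apply: rP; rewrite -ball_normE /=.
    rewrite addrA opprD addrCA subrr addr0 normrN.
    apply: (@le_lt_trans _ _ (`|h| * (`|v| + `|w|))).
      rewrite (le_trans (ler_normD _ _))// !normrZ mulrDr addrC lerD2l.
      by rewrite ler_wpM2r.
    apply: (@le_lt_trans _ _ (`|h| * (`|v| + `|w| + 1))).
      by rewrite ler_wpM2l// lerDl.
    rewrite -ltr_pdivlMr ?ltr_wpDl ?addr_ge0//; near: h.
    by apply: dnbhs0_lt; rewrite divr_gt0// ltr_wpDl// addr_ge0.
  move=> fwc.
  rewrite (_ : (fun h : R => _) = (fun h : R => h^-1 *: ((f \o shift x) (h *: v) - f x)) +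
    (fun h : R => h^-1 *: ((f \o shift x) (h *: (v + w)) - (f \o shift x) (h *: v)))).
    exact: cvgD.
  apply/funext => h; transitivity (h^-1 *: (f (h *: v + x) - f x) +
    h^-1 *: (f (h *: (v + w) + x) - f (h *: v + x))) => //.
  by rewrite -scalerDr [X in _ = _ *: X]addrC subrKA.
split; first by apply/cvg_ex; eexists; exact: key.
exact/cvg_lim.
Unshelve. all: by end_near. Qed.

Lemma is_deriveZdirG f x v (d c : R) : is_derive x v f d -> is_derive x (c *: v) f (c * d).
Proof.
move=> /is_derive_lineG0 fd; apply/is_derive_lineG0.
have -> : (fun h : R => f (h *: (c *: v) + x)) = (fun h : R => f (h *: v + x)) \o (fun h => c * h).
  by apply/funext => h /=; rewrite scalerA mulrC.
rewrite mulrC; apply: is_derive1_comp; rewrite ?mulr0//.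
by have := @is_deriveZ R R R id c 0 1 1 (is_derive_id _ _); rewrite [c *: 1]mulr1.
Qed.

(** The mean value theorem, applied in the direction u to the increment in the
    direction v and then in the direction v, evaluates the second difference
    by the mixed derivative at a nearby point. The left-hand side is symmetric
    in u and v, which is what gives Clairaut's theorem. *)
Lemma second_difference f (fu fuv : V -> R) x u v (h r : R) :
  `|h| * (`|u| + `|v|) < r ->
  (forall y, `|y - x| < r -> is_derive y u f (fu y)) ->
  (forall y, `|y - x| < r -> is_derive y v fu (fuv y)) ->
  exists2 y, `|y - x| <= `|h| * (`|u| + `|v|) &
    f (h *: u + (h *: v + x)) - f (h *: u + x) - (f (h *: v + x) - f x) = h ^+ 2 * fuv y.
Proof.
move=> hr du dv.
have near s s' : `|s| <= `|h| -> `|s'| <= `|h| ->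
    `|s *: u + (s' *: v + x) - x| <= `|h| * (`|u| + `|v|).
  move=> sh s'h; rewrite addrA addrK (le_trans (ler_normD _ _))// !normrZ mulrDr.
  by rewrite lerD// ler_wpM2r.
have hle : `|0 : R| <= `|h| by rewrite normr0.
have [t th|s [sh]] := @MVT1 (fun t => f (t *: u + (h *: v + x)) - f (t *: u + x))
    (fun t => fu (t *: u + (h *: v + x)) - fu (t *: u + x)) h.
  apply: is_deriveB; apply/is_derive_lineG; apply: du.
    by apply: le_lt_trans hr; exact: near.
  by apply: le_lt_trans hr; have := near t 0 th hle; rewrite scale0r add0r.
rewrite !scale0r !add0r => ->.
have [s' s'h|s' [s'h]] := @MVT_line fu fuv (s *: u + x) v h.
  by apply: dv; apply: le_lt_trans hr; rewrite addrCA; exact: near.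
rewrite addrCA => ->; exists (s' *: v + (s *: u + x)); last by rewrite mulrA expr2.
by rewrite addrCA; exact: near.
Qed.

Lemma clairaut f (fu fv fuv fvu : V -> R) x u v (r : R) : 0 < r ->
  (forall y, `|y - x| < r -> is_derive y u f (fu y)) ->
  (forall y, `|y - x| < r -> is_derive y v f (fv y)) ->
  (forall y, `|y - x| < r -> is_derive y v fu (fuv y)) ->
  (forall y, `|y - x| < r -> is_derive y u fv (fvu y)) ->
  {for x, continuous fuv} -> {for x, continuous fvu} -> fuv x = fvu x.
Proof.
move=> r0 du dv duv dvu /(@continuous_epsP R V) cuv /(@continuous_epsP R V) cvu.
apply/eqP; rewrite -subr_eq0 -normr_le0; apply/ler_addgt0Pl => e e0; rewrite addr0.
have e2 : 0 < e / 2 by rewrite divr_gt0.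
have [d1 d10 d1P] := cuv _ e2; have [d2 d20 d2P] := cvu _ e2.
have c0 : 0 < `|u| + `|v| + 1 by rewrite ltr_wpDl// addr_ge0.
pose d := Num.min r (Num.min d1 d2).
pose h := d / 2 / (`|u| + `|v| + 1).
have m0 : 0 < d by rewrite !lt_min r0 d10.
have h0 : 0 < h by rewrite !divr_gt0.
have hd : `|h| * (`|u| + `|v|) < d.
  rewrite gtr0_norm// (@le_lt_trans _ _ (h * (`|u| + `|v| + 1)))//.
    by rewrite ler_wpM2l ?lerDl// ltW.
  rewrite /h divfK ?gt_eqF//; lra.
have hlt (y : V) : `|y - x| <= `|h| * (`|u| + `|v|) -> [/\ `|y - x| < d1 & `|y - x| < d2].
  by move=> /le_lt_trans/(_ hd); rewrite !lt_min => /andP[_ /andP[]].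
have hr : `|h| * (`|u| + `|v|) < r by move: hd; rewrite lt_min => /andP[].
have [y1 /hlt[y1d _] E1] := second_difference hr du duv.
rewrite (addrC `|u|) in hr; have [y2 H2 E2] := second_difference hr dv dvu.
rewrite (addrC `|v|) in H2; have [_ y2d] := hlt _ H2.
have E : fuv y1 = fvu y2.
  have hh : h ^+ 2 != 0 by rewrite expf_neq0// gt_eqF.
  apply: (mulfI hh); rewrite -E1 -E2 addrCA; ring.
have := d1P _ y1d; have := d2P _ y2d; rewrite E.
by rewrite !ler_norml => /andP[? ?] /andP[? ?]; lra.
Qed.

End line.

Section partials.
Variables (R : realType) (m : nat).
Local Notation V := 'rV[R]_m.
Implicit Types (f g : V -> R) (x v w : V).
Local Notation e_ i := (delta_mx 0 i : V).

Lemma is_derive_line f x v (d t : R) :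
  is_derive (t *: v + x) v f d <-> is_derive t 1 (fun h : R => f (h *: v + x)) d.
Proof. exact: (@is_derive_lineG R V). Qed.

Lemma is_derive_line0 f x v (d : R) :
  is_derive x v f d <-> is_derive (0 : R) 1 (fun h : R => f (h *: v + x)) d.
Proof. exact: (@is_derive_lineG0 R V). Qed.

Lemma is_deriveZdir f x v (d c : R) : is_derive x v f d -> is_derive x (c *: v) f (c * d).
Proof. exact: (@is_deriveZdirG R V). Qed.

Definition has_partials f (df : 'I_m -> V -> R) :=
  forall i x, is_derive x (e_ i) f (df i x).

Lemma row_sum_seq v : v = \sum_(i <- enum 'I_m) v 0 i *: e_ i.
Proof. by rewrite {1}(row_sum_delta v) big_enum. Qed.

(** The coordinates of v are added one at a time by [derive_add_dir]. *)
Lemma gradient f df x v : has_partials f df -> (forall i, continuous (df i)) ->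
  is_derive x v f (\sum_i v 0 i * df i x).
Proof.
move=> fd cf; rewrite [v in is_derive x v](row_sum_seq v) -big_enum /=.
elim/last_ind: (enum _) => [|s i IH].
  by rewrite !big_nil; apply: is_derive0.
rewrite -cats1 !big_cat !big_seq1/=.
apply: (@derive_add_dir R V f (fun y => v 0 i * df i y) x _ (v 0 i *: e_ i) _ IH).
  by move=> y; apply: is_deriveZdir.
apply: (@continuousMl_cst R V); exact: cf.
Qed.

(** The increment from x to v + x is split into steps parallel to the axes,
    with the mean value theorem on each step. *)
Lemma lipschitz_partials f df (B : R) x v : has_partials f df ->
  (forall i y, `|df i y| <= B) -> `|f (v + x) - f x| <= B * \sum_i `|v 0 i|.
Proof.
move=> fd fB; rewrite [v in f (v + x)](row_sum_seq v) -big_enum /=.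
elim/last_ind: (enum _) => [|s i IH].
  by rewrite !big_nil add0r subrr normr0 mulr0.
rewrite -cats1 !big_cat !big_seq1/= mulrDr.
rewrite addrAC [_ + x + _]addrC.
set y := _ + x in IH *.
have [s' [_ E]] := @MVT_line _ _ f _ y _ (v 0 i) (fun s _ => fd i _).
rewrite -[f _](subrK (f y)) -addrA addrC (le_trans (ler_normD _ _))// lerD//.
by rewrite E normrM mulrC ler_wpM2r.
Qed.

Lemma coord_le_norm (x : V) i : `|x 0 i| <= `|x|.
Proof. by rewrite [leRHS]/Num.norm/= mx_normrE (bigmax_sup (0, i)). Qed.

Lemma continuous_partials f df (B : R) : has_partials f df ->
  (forall i y, `|df i y| <= B) -> continuous f.
Proof.
move=> fd fB x; apply/(@continuous_epsP R V) => e e0.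
have p1 : 0 < `|B| * m%:R + 1 by rewrite ltr_wpDl// mulr_ge0.
exists (e / (`|B| * m%:R + 1)) => [|y yx]; first by rewrite divr_gt0.
rewrite -[in f y](subrK x y) (le_trans (lipschitz_partials _ _ fd fB))//.
apply: (@le_trans _ _ (`|B| * (m%:R * `|y - x|))).
  apply: (@le_trans _ _ (`|B| * \sum_i `|(y - x) 0 i|)).
    by rewrite ler_wpM2r ?sumr_ge0// ler_norm.
  rewrite ler_wpM2l// mulr_natl -[m in _ *+ m]card_ord -sumr_const ler_sum// => i _.
  exact: coord_le_norm.
rewrite mulrA.
apply: (@le_trans _ _ ((`|B| * m%:R + 1) * `|y - x|)).
  by rewrite ler_wpM2r// lerDl.
by rewrite -ler_pdivlMl// mulrC ltW.
Qed.

(** A set of continuous functions stable under the partial derivatives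
    consists of smooth functions ([smooth_classP]). Smoothness is proved
    throughout by exhibiting such a set, which avoids any formula for the
    iterated derivatives. *)
Definition smooth_class (C : set (V -> R)) := forall g, C g ->
  continuous g /\ forall i, exists g', C g' /\ forall x, is_derive x (e_ i) g (g' x).

Lemma smooth_class_ipartial C s g : smooth_class C -> C g -> C (ipartial s g).
Proof.
move=> sC Cg; elim: s => [//|i s IH] /=.
have [_ /(_ i)[g' [Cg' dg]]] := sC _ IH.
suff -> : (fun x => 'D_(e_ i) (foldr (fun i h x => 'D_(e_ i) h x) g s) x) = g' by [].
by apply/funext => x; have [_ <-] := dg x.
Qed.

Lemma smooth_classP C g : smooth_class C -> C g -> smooth_real setT g.
Proof.
move=> sC Cg s x _; have [c d] := sC _ (smooth_class_ipartial s sC Cg).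
by split; [exact: c|move=> i; have [g' [_ dg]] := d i; case: (dg x)].
Qed.

Lemma smooth_is_class : smooth_class (smooth_real setT).
Proof.
move=> g gs; split; first by move=> x; have [] := gs [::] x I.
move=> i; exists (ipartial [:: i] g); split.
  move=> s x _; have := gs (rcons s i) x I.
  by rewrite /ipartial -cats1 foldr_cat.
by move=> x /=; have [_ /(_ i) ?] := gs [::] x I; exact: derivableP.
Qed.

Lemma smooth_has_partials g : smooth_real setT g ->
  has_partials g (fun i => ipartial [:: i] g).
Proof. by move=> gs i x; have [_ /(_ i) ?] := gs [::] x I; exact: derivableP. Qed.

Lemma smooth_ipartial s g : smooth_real setT g -> smooth_real setT (ipartial s g).
Proof. exact: (smooth_class_ipartial s smooth_is_class). Qed.

Lemma smooth_continuous g : smooth_real setT g -> continuous g.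
Proof. by move=> /smooth_is_class[]. Qed.

Lemma ipartial_cat s t g : ipartial (s ++ t) g = ipartial s (ipartial t g).
Proof. by rewrite /ipartial foldr_cat. Qed.

Lemma ipartial_eq i g g' : (forall x, is_derive x (e_ i) g (g' x)) -> ipartial [:: i] g = g'.
Proof. by move=> d; apply/funext => x; have [_ <-] := d x. Qed.

Lemma ipartial0 s : ipartial s (fun=> 0) = (fun=> 0) :> (V -> R).
Proof.
elim: s => [//|i s IH]; rewrite -(cat1s i) ipartial_cat IH.
by apply: ipartial_eq => x; exact: is_derive_cst.
Qed.

Lemma ipartial_swap i j t g : smooth_real setT g ->
  ipartial (i :: j :: t) g = ipartial (j :: i :: t) g.
Proof.
move=> gs; apply/funext => x; pose f := ipartial t g.
have P s : has_partials (ipartial s f) (fun i => ipartial (i :: s) f).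
  by apply: smooth_has_partials; do 2 apply: smooth_ipartial.
have C s : continuous (ipartial s f) by apply: smooth_continuous; do 2 apply: smooth_ipartial.
apply: (@clairaut R V f (ipartial [:: j] f) (ipartial [:: i] f) _ _ x (e_ j) (e_ i) 1) => //.
- by move=> y _; exact: (P [::] j).
- by move=> y _; exact: (P [::] i).
- by move=> y _; exact: (P [:: j] i).
- by move=> y _; exact: (P [:: i] j).
- exact: (C [:: i; j]).
- exact: (C [:: j; i]).
Qed.

(** Clairaut's theorem exchanges neighbouring derivatives, and neighbouring
    exchanges generate all permutations. *)
Lemma ipartial_perm s t g : smooth_real setT g -> perm_eq s t -> ipartial s g = ipartial t g.
Proof.
move=> gs; apply: (@catCA_perm_subst _ _ (fun s => ipartial s g)) => {s t} s1 s2 s3.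
have step i s2' s3' : ipartial (i :: s2' ++ s3') g = ipartial (s2' ++ i :: s3') g.
  elim: s2' => [//|j s2' IH].
  by rewrite !cat_cons ipartial_swap// -(cat1s j) ipartial_cat IH -ipartial_cat.
elim: s1 s3 => [//|i s1 IH] s3; rewrite !cat_cons -step.
by rewrite -cat1s ipartial_cat IH -ipartial_cat.
Qed.

Lemma open_near_eq (U : set V) f g x : open U -> U x -> (forall y, U y -> f y = g y) ->
  \forall y \near x, f y = g y.
Proof. by move=> oU Ux fg; apply: filterS (open_nbhs_nbhs (conj oU Ux)) => y /fg. Qed.

Lemma ipartial_eq_on (U : set V) s f g : open U -> (forall y, U y -> f y = g y) ->
  forall x, U x -> ipartial s f x = ipartial s g x.
Proof.
move=> oU fg; elim: s => [//|i s IH] x Ux /=.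
by apply: near_eq_derive; exact: (open_near_eq oU Ux IH).
Qed.

Lemma ipartial_lin (U : set V) (c : R) s f g : open U -> smooth_real U f -> smooth_real U g ->
  forall x, U x -> ipartial s (fun y => c * f y + g y) x = c * ipartial s f x + ipartial s g x.
Proof.
move=> oU fs gs; elim: s => [//|i s IH] x Ux /=.
rewrite (near_eq_derive (e_ i) (open_near_eq oU Ux IH)).
have [_ /(_ i) df] := fs s x Ux; have [_ /(_ i) dg] := gs s x Ux.
have := is_deriveD (is_deriveZ c (derivableP df)) (derivableP dg).
by case=> _ <-.
Qed.

Lemma smooth_lin (U : set V) (c : R) f g : open U -> smooth_real U f -> smooth_real U g ->
  smooth_real U (fun y => c * f y + g y).
Proof.
move=> oU fs gs s x Ux; have N := open_near_eq oU Ux (ipartial_lin c s oU fs gs).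
have [cf df] := fs s x Ux; have [cg dg] := gs s x Ux; split.
  apply: (@near_eq_continuous R V _ _ _ N); apply: (@continuousD R R V) => //.
  exact: (@continuousMl_cst R V).
move=> i; have D := is_deriveD (is_deriveZ c (derivableP (df i))) (derivableP (dg i)).
have N' : \forall y \near x, c * ipartial s f y + ipartial s g y =
    ipartial s (fun y : 'rV_m => c * f y + g y) y by apply: filterS N => y ->.
by case: (near_eq_is_derive N' D).
Qed.

Lemma smooth_cst (U : set V) (c : R) : open U -> smooth_real U (fun=> c : R).
Proof.
move=> _; suff : smooth_real setT (fun _ : V => c) by move=> h s x _; exact: h.
apply: (@smooth_classP (fun g => exists c, g = fun=> c)); last by exists c.
move=> _ [d ->]; split; first by move=> x; exact: cst_continuous.
move=> i; exists (fun=> 0); split; first by exists 0.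
by move=> x; exact: is_derive_cst.
Qed.

Lemma smooth_sub (U W : set V) g : W `<=` U -> smooth_real U g -> smooth_real W g.
Proof. by move=> WU gs s x /WU; exact: gs. Qed.

Lemma is_derive_coord i j x : is_derive x (e_ i) (fun y : V => y 0 j) ((i == j)%:R).
Proof.
apply/is_derive_line0.
rewrite (_ : (fun h : R => _) = fun h : R => h * (i == j)%:R + x 0 j); last first.
  by apply/funext => h; rewrite !mxE eqxx/= eq_sym.
have E := is_deriveD (is_derive_mul (is_derive_id (0 : R) 1) (is_derive_cst ((i == j)%:R : R) (0 : R) 1))
  (is_derive_cst (x 0 j) (0 : R) 1).
by rewrite mul1r mulr0 !addr0 in E.
Qed.

Lemma smooth_coord (i : 'I_m) : smooth_real setT (fun x : V => x 0 i).
Proof.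
apply: (@smooth_classP (fun g => (g = fun x : V => x 0 i) \/ exists c, g = fun=> c)); last by left.
move=> _ [->|[d ->]]; split.
- by move=> x; exact: coord_continuous.
- move=> j; exists (fun=> (j == i)%:R); split; first by right; eexists.
  by move=> x; exact: is_derive_coord.
- by move=> x; exact: cst_continuous.
- move=> j; exists (fun=> 0); split; first by right; exists 0.
  by move=> x; exact: is_derive_cst.
Qed.

(** The sums of products form a set stable under the product rule. *)
Inductive prodspan (A B : set (V -> R)) : (V -> R) -> Prop :=
| prodspan1 a b : A a -> B b -> prodspan A B (fun x => a x * b x)
| prodspanD f g : prodspan A B f -> prodspan A B g -> prodspan A B (fun x => f x + g x).

Lemma smoothM f g : smooth_real setT f -> smooth_real setT g ->
  smooth_real setT (fun x => f x * g x).
Proof.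
move=> fs gs; apply: (@smooth_classP (prodspan (smooth_real setT) (smooth_real setT)));
  last exact: prodspan1.
move=> h; elim=> [a b sa sb|h1 h2 _ [c1 d1] _ [c2 d2]].
  split=> [x|i]; first by apply: (@continuousM R V); exact: smooth_continuous.
  exists (fun x => ipartial [:: i] a x * b x + a x * ipartial [:: i] b x); split.
    apply: (@prodspanD _ _ (fun x => ipartial [:: i] a x * b x)
                           (fun x => a x * ipartial [:: i] b x)).
      by apply: (@prodspan1 _ _ (ipartial [:: i] a) b); [exact: smooth_ipartial|].
    by apply: (@prodspan1 _ _ a (ipartial [:: i] b)); [|exact: smooth_ipartial].
  by move=> x; apply: is_derive_mul; exact: smooth_has_partials.
split=> [x|i]; first by apply: continuousD; [exact: c1|exact: c2].
have [g1 [p1 q1]] := d1 i; have [g2 [p2 q2]] := d2 i.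
exists (fun x => g1 x + g2 x); split; first exact: prodspanD.
by move=> x; exact: is_deriveD.
Qed.

(** Leibniz' formula enters only through this bound: each derivative doubles
    the number of terms. *)
Lemma ipartialM_le k f g y (A B : R) : smooth_real setT f -> smooth_real setT g ->
  (forall s, (size s <= k)%N -> `|ipartial s f y| <= A) ->
  (forall s, (size s <= k)%N -> `|ipartial s g y| <= B) ->
  forall s, (size s <= k)%N -> `|ipartial s (fun x => f x * g x) y| <= 2 ^+ size s * (A * B).
Proof.
move=> fs gs fA gB s; elim/last_ind: s k f g fs gs fA gB => [|s i IH] k f g fs gs fA gB sk.
  rewrite expr0 mul1r /= normrM ler_pM//; [exact: (fA [::])|exact: (gB [::])].
rewrite -cats1 ipartial_cat.
have -> : ipartial [:: i] (fun x => f x * g x) =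
    (fun x => 1 * (ipartial [:: i] f x * g x) + f x * ipartial [:: i] g x).
  apply: ipartial_eq => x; rewrite mul1r.
  by apply: is_derive_mul; exact: smooth_has_partials.
have sf := smooth_ipartial [:: i] fs; have sg := smooth_ipartial [:: i] gs.
rewrite (@ipartial_lin setT 1 s (fun x => ipartial [:: i] f x * g x)
  (fun x => f x * ipartial [:: i] g x) openT (smoothM sf gs) (smoothM fs sg) y I) mul1r.
rewrite cats1 size_rcons in sk *; rewrite exprS -mulrA mulr_natl mulr2n.
rewrite (le_trans (ler_normD _ _))// lerD//.
  apply: (IH (size s)) => // t ts.
    by rewrite -ipartial_cat fA// cats1 size_rcons (leq_ltn_trans ts).
  by rewrite gB// (leq_trans ts)// ltnW.
apply: (IH (size s)) => // t ts.
  by rewrite fA// (leq_trans ts)// ltnW.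
by rewrite -ipartial_cat gB// cats1 size_rcons (leq_ltn_trans ts).
Qed.

End partials.

(** * Integration over tuples *)

Section borel.
Variables (R : realType) (m : nat).
Local Notation T := (m.-tuple (measurableTypeR R)).
Local Notation V := 'rV[R]_m.

Lemma rvecE (t : T) i : rvec t 0 i = tnth t i.
Proof. by rewrite mxE. Qed.

(** An open set is a countable union of cubes with rational centres, and the
    preimage of a cube is an intersection of finitely many preimages under the
    coordinates. *)
Lemma measurable_rvec_open (U : set V) : open U -> measurable [set t : T | U (rvec t)].
Proof.
move=> oU.
pose B (p : {ffun 'I_m -> rat} * nat) : set V :=
  [set x | forall i, `|x 0 i - ratr (p.1 i)| < p.2.+1%:R^-1].
rewrite (_ : [set t : T | U (rvec t)] =
  \bigcup_p [set t : T | B p `<=` U /\ (forall i, `|tnth t i - ratr (p.1 i)| < p.2.+1%:R^-1)]).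
  apply: countable_bigcupT_measurable => // p.
  have [BU|nBU] := pselect (B p `<=` U); last first.
    by rewrite (_ : [set _ | _] = set0)//; apply/seteqP; split => t //= [].
  rewrite (_ : [set _ | _] = \bigcap_(i in [set: 'I_m])
      ((fun t : T => tnth t i) @^-1` ball (ratr (p.1 i) : R) p.2.+1%:R^-1)).
    apply: fin_bigcap_measurable => //.
    move=> i _; rewrite -[X in measurable X]setTI; apply: measurable_tnth => //.
    by rewrite ball_itv; exact: measurable_itv.
  apply/seteqP; split => t /=.
    by move=> [_ H] i _ /=; rewrite -ball_normE /= distrC.
  by move=> H; split => // i; have := H i I; rewrite -ball_normE /= distrC.
apply/seteqP; split => t /=; last first.
  by move=> [p _ [BU H]]; apply: BU => i; rewrite rvecE.
move=> Ut.
have /nbhs_ballP[r /= r0 rP] := open_nbhs_nbhs (conj oU Ut).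
have [k kr] : exists k : nat, k.+1%:R^-1 < r / 2.
  have := near_infty_natSinv_lt (PosNum (divr_gt0 r0 (ltr0n R 2))).
  by case=> k _ /(_ k (leqnn k)) kr; exists k.
have k0 : 0 < k.+1%:R^-1 :> R by rewrite invr_gt0.
have Q i : exists q : rat, `|tnth t i - ratr q| < k.+1%:R^-1.
  have /rat_in_itvoo[q] : tnth t i - k.+1%:R^-1 < tnth t i + k.+1%:R^-1.
    by rewrite ltrBlDr -addrA ltrDl addr_gt0.
  rewrite in_itv/= => /andP[q1 q2]; exists q; rewrite ltr_norml; apply/andP; split.
    by rewrite ltrBrDr addrC ltrBlDr.
  by rewrite ltrBlDr addrC -ltrBlDr.
have [q qP] := choice Q.
exists ([ffun i => q i], k) => //; split => [x Bx|i]; last by rewrite ffunE.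
apply: rP; rewrite -ball_normE /= -[`|_|]/(mx_norm _) mx_normrE.
apply: (@le_lt_trans _ _ (r / 2 + k.+1%:R^-1)); last first.
  by rewrite -ltrBrDl (lt_le_trans kr)// {2}(splitr r) addrK.
apply: bigmax_le => [|[a i] _ /=].
  by rewrite addr_ge0// ltW// divr_gt0.
rewrite !mxE ord1; have := Bx i; have := qP i; rewrite /= ffunE.
move=> h1 h2; rewrite (le_trans (ler_distD (ratr (q i)) _ _))// lerD//.
  exact: ltW (lt_trans h1 kr).
by rewrite distrC ltW.
Qed.

Lemma measurable_continuous (f : V -> R) : continuous f ->
  measurable_fun setT (fun t : T => f (rvec t)).
Proof.
move=> cf mD; apply: (measurability _ (RGenOInfty.measurableE R)) => //.
move=> _ [_ [a ->] <-]; apply: measurableI => //.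
apply: (@measurable_rvec_open (f @^-1` `]a, +oo[)).
by apply: open_comp => //; move=> x _; exact: cf.
Qed.

End borel.

Section transport.
Context d1 d2 (X : measurableType d1) (Y : measurableType d2) (R : realType).
Variables (mu : {measure set X -> \bar R}) (nu : {measure set Y -> \bar R}).
Implicit Types (phi : X -> Y) (c : R).

(** A change of variables, stated for nonnegative functions so that it
    composes with Tonelli's theorem; [transport_Rintegral] extends it to
    integrable functions. *)
Definition transports phi c := forall f : Y -> \bar R, measurable_fun setT f ->
  (forall y, (0 <= f y)%E) -> (\int[nu]_y f y = c%:E * \int[mu]_x f (phi x))%E.

Variables (phi : X -> Y) (c : R).
Hypotheses (mphi : measurable_fun setT phi) (c0 : 0 < c) (H : transports phi c).

Lemma transport_integrable (f : Y -> R) : measurable_fun setT f ->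
  nu.-integrable setT (EFin \o f) <-> mu.-integrable setT (EFin \o (f \o phi)).
Proof.
move=> mf; have mfp : measurable_fun setT (f \o phi) by exact: measurableT_comp.
have E : (\int[nu]_y `|(EFin \o f) y| = c%:E * \int[mu]_x `|(EFin \o (f \o phi)) x|)%E.
  rewrite H//; first by apply: measurableT_comp => //; exact/measurable_EFinP.
split=> /integrableP[_ fin]; apply/integrableP; split; try exact/measurable_EFinP.
  rewrite E in fin; rewrite ltey; apply/negP => /eqP ey; move: fin.
  by rewrite ey gt0_muley ?lte_fin// ltxx.
by rewrite E lte_mul_pinfty ?lee_fin ?ltW// ge0_fin_numE// integral_ge0.
Qed.

Lemma transport_Rintegral (f : Y -> R) : nu.-integrable setT (EFin \o f) ->
  (\int[nu]_y f y = c * \int[mu]_x f (phi x))%R.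
Proof.
move=> fi; have mEf : measurable_fun setT (EFin \o f) by case/integrableP: fi.
have mf : measurable_fun setT f by exact/measurable_EFinP.
have fpi := (transport_integrable mf).1 fi.
have pE : (\int[nu]_y (EFin \o f)^\+ y = c%:E * \int[mu]_x (EFin \o (f \o phi))^\+ x)%E.
  rewrite H; [|exact: measurable_funepos|move=> y; exact: funepos_ge0].
  by congr (_ * _)%E; apply: eq_integral => x _; rewrite unlock.
have nE : (\int[nu]_y (EFin \o f)^\- y = c%:E * \int[mu]_x (EFin \o (f \o phi))^\- x)%E.
  rewrite H; [|exact: measurable_funeneg|move=> y; exact: funeneg_ge0].
  by congr (_ * _)%E; apply: eq_integral => x _; rewrite unlock.
rewrite /Rintegral integralE [in RHS]integralE pE nE -muleBr//.
  by rewrite fineM// fin_numB; apply/andP; split;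
   [exact: integrable_pos_fin_num|exact: integrable_neg_fin_num].
by apply: fin_num_adde_defl; rewrite fin_numN; exact: integrable_neg_fin_num.
Qed.
End transport.

Section affine1.
Variable R : realType.
Local Notation leb := (@lebesgue_measure R).
Local Notation T := (measurableTypeR R).

Lemma measurable_affine1 (a b : R) : measurable_fun setT (fun x : T => a * x + b : T).
Proof.
by apply: measurable_funD => //; apply: measurable_funM.
Qed.

Lemma affine1_pos (a b : R) : 0 < a ->
  transports leb leb (fun x : T => a * x + b : T) a.
Proof.
move=> a0 f mf f0; have an : 0 <= a by exact: ltW.
pose phi := fun x : T => a * x + b : T.
have mphi : measurable_fun setT phi by exact: measurable_affine1.
pose push : {measure set T -> \bar R} :=
  measure_function_pushforward__canonical__measure_function_Measure leb mphi.
pose nu : {measure set T -> \bar R} := mscale (NngNum an) push.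
transitivity (\int[nu]_y f y)%E.
  apply: eq_measure_integral => A mA _.
  apply: (@lebesgue_measure_unique _ nu) => // X [[u v] _ <-].
  change (leb `]u, v]%classic = a%:E * leb (phi @^-1` `]u, v]%classic))%E.
  rewrite (_ : phi @^-1` _ = `](u - b) / a, (v - b) / a]%classic).
    rewrite !lebesgue_measure_itv/= !lte_fin ltr_pM2r ?invr_gt0// ltrD2r.
    case: ifP => _; last by rewrite mule0.
    by rewrite -EFinB -EFinM -mulrBl mulrC divfK ?gt_eqF//; congr (_%:E); ring.
  apply/seteqP; split => x; rewrite /phi /= !in_itv/= => /andP[h1 h2]; apply/andP; split.
  - by rewrite ltr_pdivrMr// ltrBlDr mulrC.
  - by rewrite ler_pdivlMr// lerBrDr mulrC.
  - by move: h1; rewrite ltr_pdivrMr// ltrBlDr mulrC.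
  - by move: h2; rewrite ler_pdivlMr// lerBrDr mulrC.
rewrite ge0_integral_mscale//=; congr (_ * _)%E.
exact: (ge0_integral_pushforward mphi).
Qed.

Lemma affine1_opp : transports leb leb (fun x : T => - x : T) 1.
Proof.
move=> f mf f0; rewrite mul1e.
transitivity (\int[pushforward leb (-%R : _ -> T)]_y f y)%E.
  by apply: eq_measure_integral => A mA _; apply/esym; exact: lebesgue_measureN.
by rewrite ge0_integral_pushforward.
Qed.

Lemma affine1 (a b : R) : a != 0 ->
  transports leb leb (fun x : T => a * x + b : T) `|a|.
Proof.
move=> a0; have [ap|an|a00] := ltgtP a 0; last by rewrite a00 eqxx in a0.
  move=> f mf f0; rewrite ltr0_norm//.
  have ap' : 0 < - a by rewrite oppr_gt0.
  rewrite (affine1_pos b ap' mf f0); congr (_ * _)%E.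
  have mg : measurable_fun setT (fun x : T => f (- a * x + b)).
    by apply: measurableT_comp => //; exact: measurable_affine1.
  by rewrite (affine1_opp mg)// mul1e; apply: eq_integral => x _; rewrite mulrNN.
by rewrite gtr0_norm//; exact: affine1_pos.
Qed.

End affine1.

Section tuples.
Variable R : realType.
Local Notation leb := (@lebesgue_measure R).
Local Notation Rm := (measurableTypeR R).
Local Notation lt m := (lebesgue_tuple R m).

Definition rtup m (x : 'rV[R]_m) : m.-tuple Rm := [tuple x 0 i | i < m].

Lemma rvecK m (t : m.-tuple Rm) : rtup (rvec t) = t.
Proof. by apply: eq_from_tnth => i; rewrite tnth_mktuple rvecE. Qed.

Lemma rtupK m (x : 'rV[R]_m) : rvec (rtup x) = x.
Proof. by apply/rowP => i; rewrite rvecE tnth_mktuple. Qed.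

Lemma tnth_tcons0 m (p : Rm * m.-tuple Rm) : tnth (tcons p) ord0 = p.1.
Proof. by []. Qed.

Lemma tnth_tconsS m (p : Rm * m.-tuple Rm) i : tnth (tcons p) (lift ord0 i) = tnth p.2 i.
Proof. by rewrite /tcons tnthS. Qed.

Lemma tonelli_tcons m (f : m.+1.-tuple Rm -> \bar R) : measurable_fun setT f ->
  (forall t, (0 <= f t)%E) ->
  (\int[lt m.+1]_t f t = \int[leb]_x \int[lt m]_t f (tcons (x, t)))%E.
Proof.
move=> mf f0; transitivity (\int[(leb \x lt m)%E]_p f (tcons p))%E.
  exact: (ge0_integral_pushforward (@measurable_tcons R m) _ measurableT mf (fun t _ => f0 t)).
rewrite fubini_tonelli1//; apply: measurableT_comp => //; exact: measurable_tcons.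
Qed.

Definition affine_tup m (a b : 'I_m -> R) (t : m.-tuple Rm) : m.-tuple Rm :=
  [tuple a i * tnth t i + b i | i < m].

Lemma rvec_affine m (a b : 'I_m -> R) t :
  rvec (affine_tup a b t) = \row_i (a i * rvec t 0 i + b i).
Proof. by apply/rowP => i; rewrite !mxE tnth_mktuple. Qed.

Lemma measurable_affine m (a b : 'I_m -> R) : measurable_fun setT (affine_tup a b).
Proof.
apply/measurable_fun_tnthP => i.
rewrite (_ : _ \o _ = fun t => a i * tnth t i + b i); last first.
  by apply/funext => t /=; rewrite tnth_mktuple.
apply: measurable_funD => //; apply: measurable_funM => //; exact: measurable_tnth.
Qed.

Lemma affine_tcons m (a b : 'I_m.+1 -> R) x t : affine_tup a b (tcons (x, t)) =
  tcons (a ord0 * x + b ord0,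
         affine_tup (fun i => a (lift ord0 i)) (fun i => b (lift ord0 i)) t).
Proof.
apply: eq_from_tnth => i; rewrite tnth_mktuple.
by have [j ->|->] := unliftP ord0 i; rewrite ?tnth_tconsS ?tnth_tcons0// tnth_mktuple.
Qed.

(** By induction on the dimension: Tonelli's theorem splits off the first
    coordinate, where the one-dimensional substitution rule applies. *)
Lemma transports_affine m (a b : 'I_m -> R) : (forall i, a i != 0) ->
  transports (lt m) (lt m) (affine_tup a b) (\prod_i `|a i|).
Proof.
elim: m a b => [|m IH] a b a0 f mf f0.
  rewrite big_ord0 mul1e; apply: eq_integral => t _; congr f.
  by rewrite [t]tuple0 [affine_tup _ _ _]tuple0.
have mfa : measurable_fun setT (f \o affine_tup a b).
  by apply: measurableT_comp => //; exact: measurable_affine.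
rewrite (tonelli_tcons mf f0) (tonelli_tcons mfa (fun t => f0 _)) big_ord_recl EFinM -muleA.
have mft : measurable_fun setT (f \o @tcons R m).
  by apply: measurableT_comp => //; exact: measurable_tcons.
have mf2 x : measurable_fun setT (fun t => f (tcons (x, t))).
  by apply: (measurableT_comp mft); exact: pair1_measurable.
pose a' (i : 'I_m) := a (lift ord0 i); pose b' (i : 'I_m) := b (lift ord0 i).
have mF : measurable_fun setT (fun x => \int[lt m]_t f (tcons (x, t)))%E.
  exact: (measurable_fun_fubini_tonelli_F _ mft (fun _ => f0 _)).
have E x : (\int[lt m]_t f (tcons (x, t)) =
    (\prod_i `|a' i|)%:E * \int[lt m]_t f (tcons (x, affine_tup a' b' t)))%E.
  exact: (IH a' b' (fun i => a0 _) _ (mf2 x) (fun _ => f0 _)).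
rewrite (affine1 (b ord0) (a0 ord0) mF); last by move=> x; exact: integral_ge0.
congr (_ * _)%E; under eq_integral do rewrite E.
rewrite ge0_integralZl; first last.
- by rewrite lee_fin prodr_ge0.
- by move=> x _; apply: integral_ge0 => t _; exact: f0.
- have := measurable_fun_fubini_tonelli_F (m2 := lt m) _
    (measurableT_comp mfa (@measurable_tcons R m)) (fun _ => f0 _); congr measurable_fun; apply/funext => x.
  by apply: eq_integral => t _; rewrite /= affine_tcons.
- by [].
- by congr (_ * _)%E; apply: eq_integral => x _; apply: eq_integral => t _; rewrite /= affine_tcons.
Qed.

Lemma rvec_cat m k (p : m.-tuple Rm) (q : k.-tuple Rm) :
  rvec (cat_tuple p q : (m + k).-tuple Rm) = row_mx (rvec p) (rvec q).
Proof.
apply/rowP => i; rewrite rvecE mxE.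
case: splitP => j ij.
  by rewrite (_ : i = lshift k j) ?tnth_lshift ?rvecE//; exact/val_inj.
by rewrite (_ : i = rshift m j) ?tnth_rshift ?rvecE//; exact/val_inj.
Qed.

Definition catt m k (p : m.-tuple Rm * k.-tuple Rm) : (m + k).-tuple Rm := cat_tuple p.1 p.2.

Lemma measurable_cat m k : measurable_fun setT (@catt m k).
Proof.
apply/measurable_fun_tnthP => i.
have E p : tnth (catt p) i = row_mx (rvec p.1) (rvec p.2) 0 i :> R by rewrite -rvec_cat rvecE.
rewrite (_ : _ \o _ = fun p : m.-tuple Rm * k.-tuple Rm =>
  match fintype.split i with inl j => tnth p.1 j | inr j => tnth p.2 j end).
  case: splitP => j _.
    exact: (measurableT_comp (@measurable_tnth _ Rm m j) measurable_fst).
  exact: (measurableT_comp (@measurable_tnth _ Rm k j) measurable_snd).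
by apply/funext => p /=; rewrite E mxE; case: splitP => j _; rewrite rvecE.
Qed.

(** The measure on tuples is built by adding coordinates in front, so a block
    of m coordinates is split off by induction on m. *)
Lemma tonelli_cat m k (f : (m + k).-tuple Rm -> \bar R) : measurable_fun setT f ->
  (forall t, (0 <= f t)%E) ->
  (\int[lt (m + k)]_t f t = \int[lt m]_p \int[lt k]_q f (catt (p, q)))%E.
Proof.
elim: m f => [|m IH] f mf f0.
  have E q : (catt ([tuple], q) : k.-tuple Rm) = q by exact/val_inj.
  rewrite [lt 0]/= integral_dirac//.
    by rewrite diracE in_setT mul1e; apply: eq_integral => q _; rewrite E.
  exact: (measurable_fun_fubini_tonelli_F _ (measurableT_comp mf (@measurable_cat 0 k)) (fun _ => f0 _)).
have mft : measurable_fun setT (f \o @tcons R (m + k)).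
  by apply: measurableT_comp => //; exact: measurable_tcons.
have mf2 x : measurable_fun setT (fun t => f (tcons (x, t))).
  by apply: (measurableT_comp mft); exact: pair1_measurable.
rewrite [LHS](tonelli_tcons mf)//.
have mfc := measurableT_comp mf (@measurable_cat m.+1 k).
have F0 p : (0 <= \int[lt k]_q f (catt (p, q)))%E by apply: integral_ge0 => q _; exact: f0.
have mF : measurable_fun setT (fun p : m.+1.-tuple Rm => \int[lt k]_q f (catt (p, q)))%E.
  exact: (measurable_fun_fubini_tonelli_F _ mfc (fun _ => f0 _)).
rewrite [RHS](tonelli_tcons mF F0).
apply: eq_integral => x _; rewrite (IH _ (mf2 x))//.
apply: eq_integral => p _; apply: eq_integral => q _; congr f; exact/val_inj.
Qed.

(** An integrable weight, a multiple of which bounds any given Schwartz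
    function ([rschwartz_weight]). *)
Definition weight m (x : 'rV[R]_m) : R := \prod_i (1 + x 0 i ^+ 2)^-1.

Lemma weight_gt0 m (x : 'rV[R]_m) : 0 < weight x.
Proof. by apply: prodr_gt0 => i _; rewrite invr_gt0 ltr_pwDl// sqr_ge0. Qed.

Lemma weight_ge0 m (x : 'rV[R]_m) : 0 <= weight x.
Proof. exact/ltW/weight_gt0. Qed.

Lemma measurable_weight m : measurable_fun setT (fun t : m.-tuple Rm => weight (rvec t)).
Proof.
apply: measurable_prod => i _.
rewrite (_ : (fun x => _) = (fun x : R => (1 + x ^+ 2)^-1) \o (@tnth _ Rm ^~ i)); last first.
  by apply/funext => t /=; rewrite rvecE.
apply: measurableT_comp; last exact: measurable_tnth.
by apply: continuous_measurable_fun; exact: continuous_oneDsqrV.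
Qed.

Lemma integral_oneDsqrV : (\int[leb]_x ((1 + x ^+ 2)^-1)%:E = pi%:E)%E.
Proof.
have := @ge0_symfun_integralT R (fun x => (oneDsqr x)^-1).
rewrite /oneDsqr => -> //.
- rewrite -set_itvcy integral0y_oneDsqr -EFinM; congr (_%:E).
  by rewrite mulrC divfK.
- by move=> x; rewrite invr_ge0 addr_ge0// sqr_ge0.
- exact: continuous_oneDsqrV.
- by move=> x /=; rewrite sqrrN.
Qed.

Lemma integral_weight m : (\int[lt m]_t (weight (rvec t))%:E = (pi ^+ m)%:E)%E.
Proof.
elim: m => [|m IH].
  rewrite integral_dirac ?diracE ?in_setT ?mul1e//; first by rewrite /weight big_ord0.
  by apply/measurable_EFinP; exact: measurable_weight.
rewrite tonelli_tcons; last 2 first.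
- by apply/measurable_EFinP; exact: measurable_weight.
- by move=> t; rewrite lee_fin weight_ge0.
have E x t : weight (rvec (@tcons R m (x, t))) = (1 + x ^+ 2)^-1 * weight (rvec t).
  rewrite /weight big_ord_recl rvecE; congr (_ * _).
  by apply: eq_bigr => i _; rewrite !rvecE tnth_tconsS.
have p0 (x : R) : 0 <= (1 + x ^+ 2)^-1 by rewrite invr_ge0 addr_ge0// sqr_ge0.
transitivity (\int[leb]_x (((1 + x ^+ 2)^-1)%:E * (pi ^+ m)%:E))%E.
  apply: eq_integral => x _; under eq_integral do rewrite E EFinM.
  rewrite ge0_integralZl ?IH ?lee_fin//.
    by apply/measurable_EFinP; exact: measurable_weight.
  by move=> t _; rewrite lee_fin weight_ge0.
rewrite ge0_integralZr//.
- by rewrite integral_oneDsqrV -EFinM exprS.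
- by apply/measurable_EFinP; apply: continuous_measurable_fun; exact: continuous_oneDsqrV.
- by move=> x _; rewrite lee_fin.
- by rewrite lee_fin exprn_ge0// pi_ge0.
Qed.

Lemma integrable_weight m : (lt m).-integrable setT (fun t => (weight (rvec t))%:E).
Proof.
apply/integrableP; split; first by apply/measurable_EFinP; exact: measurable_weight.
under eq_integral do rewrite gee0_abs ?lee_fin ?weight_ge0//.
by rewrite integral_weight ltry.
Qed.

Lemma integrable_dom m (f : 'rV[R]_m -> R) (C : R) :
  measurable_fun setT (fun t : m.-tuple Rm => f (rvec t)) ->
  (forall x, `|f x| <= C * weight x) ->
  (lt m).-integrable setT (fun t => (f (rvec t))%:E).
Proof.
move=> mf fC; apply: (le_integrable _ _ _ (integrableZl measurableT C (integrable_weight m))) => //.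
  exact/measurable_EFinP.
move=> t _; rewrite -EFinM !abse_EFin lee_fin; apply: (le_trans (fC _)).
by rewrite ler_norm.
Qed.

Lemma Rintegral_weight m : (\int[lt m]_t weight (rvec t))%R = pi ^+ m.
Proof. by rewrite /Rintegral integral_weight. Qed.

Lemma le_Rintegral_dom m (f : 'rV[R]_m -> R) (C : R) :
  measurable_fun setT (fun t : m.-tuple Rm => f (rvec t)) ->
  (forall x, `|f x| <= C * weight x) ->
  `|\int[lt m]_t f (rvec t)| <= C * pi ^+ m.
Proof.
move=> mf fC; have fi := integrable_dom mf fC.
apply: (le_trans (le_normr_Rintegral measurableT fi)).
have wi : (lt m).-integrable setT (EFin \o (fun t => C * weight (rvec t))).
  exact: (integrableZl measurableT C (integrable_weight m)).
rewrite -Rintegral_weight -RintegralZl//; last exact: integrable_weight.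
by apply: le_Rintegral => //; exact: integrable_norm.
Qed.

Section glue.
Variable n : nat.
Local Notation N := (n + n + 1)%N.

(** The point of the Heisenberg group with position z, whose frequency and
    centre are the two blocks of w. *)
Definition zglue (z : 'rV[R]_n) (w : 'rV[R]_(n + 1)) : 'rV[R]_N :=
  row_mx (row_mx z (lsubmx w)) (rsubmx w).

Definition glue_tup (p : n.-tuple Rm * (n + 1).-tuple Rm) : N.-tuple Rm :=
  rtup (zglue (rvec p.1) (rvec p.2)).

Lemma rvec_glue p : rvec (glue_tup p) = zglue (rvec p.1) (rvec p.2).
Proof. exact: rtupK. Qed.

Lemma measurable_glue : measurable_fun setT glue_tup.
Proof.
apply/measurable_fun_tnthP => i.
rewrite (_ : _ \o _ = fun p : n.-tuple Rm * (n + 1).-tuple Rm =>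
  match fintype.split i with
  | inl j => match fintype.split j with
     | inl k => tnth p.1 k | inr k => tnth p.2 (lshift 1 k) end
  | inr j => tnth p.2 (rshift n j) end); last first.
  apply/funext => p /=; rewrite tnth_mktuple mxE.
  case: splitP => j _; rewrite ?mxE//.
  by case: splitP => k _; rewrite ?mxE.
case: splitP => j _; first case: splitP => k _.
- exact: (measurableT_comp (@measurable_tnth _ Rm n k) measurable_fst).
- exact: (measurableT_comp (@measurable_tnth _ Rm (n + 1) (lshift 1 k)) measurable_snd).
- exact: (measurableT_comp (@measurable_tnth _ Rm (n + 1) (rshift n j)) measurable_snd).
Qed.

Lemma transports_glue : transports (lt n \x lt (n + 1))%E (lt N) glue_tup 1.
Proof.
move=> f mf f0; rewrite mul1e.
have mfg := measurableT_comp mf measurable_glue.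
have mfc := measurableT_comp mf (@measurable_cat (n + n) 1).
rewrite -[RHS]/(\int[(lt n \x lt (n + 1))%E]_p (f \o glue_tup) p)%E (fubini_tonelli1 _ mfg (fun _ => f0 _)).
rewrite tonelli_cat// tonelli_cat; first last.
- by move=> t; apply: integral_ge0 => q _; exact: f0.
- exact: (measurable_fun_fubini_tonelli_F _ mfc (fun _ => f0 _)).
apply: eq_integral => p _; rewrite /fubini_F [RHS]tonelli_cat; first last.
- by move=> t; exact: f0.
- by apply: (measurableT_comp mfg); exact: pair1_measurable.
apply: eq_integral => x _; apply: eq_integral => s _ /=; congr f.
rewrite -[LHS]rvecK; congr rtup; rewrite /= !rvec_cat /zglue.
by rewrite row_mxKl row_mxKr.
Qed.

End glue.

Lemma is_derive_unique (V : normedModType R) (f : V -> R) x v (a b : R) :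
  is_derive x v f a -> is_derive x v f b -> a = b.
Proof. by move=> [_ <-] [_ <-]. Qed.

Lemma is_derive_integral d (Y : measurableType d) (mu : {measure set Y -> \bar R})
    (f f' : R -> Y -> R) (G : Y -> R) (a r : R) : 0 < r ->
  (forall t, `|t - a| < r -> mu.-integrable setT (EFin \o f t)) ->
  (forall t y, `|t - a| < r -> is_derive t 1 (f ^~ y) (f' t y)) ->
  mu.-integrable setT (EFin \o G) ->
  (forall t y, `|t - a| < r -> `|f' t y| <= G y) ->
  is_derive a 1 (fun t => \int[mu]_y f t y)%R (\int[mu]_y f' a y)%R.
Proof.
move=> r0 fi fd Gi fG.
have I t : `]a - r, a + r[%classic t -> `|t - a| < r.
  rewrite /= in_itv/= => /andP[h1 h2]; rewrite ltr_norml; apply/andP; split; lra.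
have Ia : `]a - r, a + r[%classic a by rewrite /= in_itv/=; apply/andP; split; lra.
have E t y : `]a - r, a + r[%classic t -> partial1of2 f t y = f' t y.
  by move=> /I It; rewrite partial1of2E; case: (fd t y It).
have fi' t : `]a - r, a + r[%classic t -> mu.-integrable setT (EFin \o f t) by move=> /I; exact: fi.
have fd' t y : `]a - r, a + r[%classic t -> setT y -> derivable (f ^~ y) t 1.
  by move=> /I It _; case: (fd t y It).
have G0 y : 0 <= G y by apply: le_trans (fG a y _); rewrite ?subrr ?normr0.
have fG' t y : `]a - r, a + r[%classic t -> setT y -> `|partial1of2 f t y| <= G y.
  by move=> It _; rewrite E//; apply: fG; exact: I.
have D := derivable_under_integral measurableT Ia fi' fd' G0 Gi fG'.
have V := differentiation_under_integral measurableT Ia fi' fd' G0 Gi fG'.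
apply: DeriveDef; first exact: D.
rewrite -derive1E V; apply: eq_Rintegral => y _; exact: E.
Qed.

Lemma weight_shift m (x : 'rV[R]_m) i (s : R) : `|s| <= 1 ->
  weight (s *: delta_mx 0 i + x) <= 3 * weight x.
Proof.
move=> s1; rewrite /weight (bigD1 i)//= [in leRHS](bigD1 i)//= !mxE !eqxx mulr1 mulrA.
rewrite (eq_bigr (fun j => (1 + x 0 j ^+ 2)^-1)); last first.
  by move=> j ji; rewrite !mxE eqxx/= (negbTE ji) mulr0 add0r.
rewrite ler_wpM2r ?prodr_ge0// => [j _|]; first by rewrite invr_ge0 addr_ge0// sqr_ge0.
have p (y : R) : 0 < 1 + y ^+ 2 by rewrite ltr_pwDl// sqr_ge0.
rewrite -ler_pdivrMl// -invfM lef_pV2 ?posrE ?mulr_gt0//.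
move: s1; rewrite ler_norml => /andP[s1 s2].
have h1 : 0 <= (2 * x 0 i + 3 * s) ^+ 2 by rewrite sqr_ge0.
have h2 : 0 <= (1 - s) * (1 + s) by rewrite mulr_ge0 ?subr_ge0// -lerBlDl sub0r.
rewrite !expr2 in h1 *; lra.
Qed.

(** The integral of F(s e_i + x) is independent of s by translation
    invariance; its derivative at s = 0 is the integral of the partial
    derivative. *)
Lemma integral_partial0 m (F dF : 'rV[R]_m -> R) i (C : R) :
  (forall x, is_derive x (delta_mx 0 i) F (dF x)) ->
  measurable_fun setT (fun t : m.-tuple Rm => F (rvec t)) ->
  (forall x, `|F x| <= C * weight x) -> (forall x, `|dF x| <= C * weight x) ->
  (\int[lt m]_t dF (rvec t) = 0)%R.
Proof.
move=> Fd mF FC dFC.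
pose b (s : R) (j : 'I_m) := s * (j == i)%:R.
pose sh s : m.-tuple Rm -> m.-tuple Rm := affine_tup (fun=> 1) (b s).
have rsh s t : rvec (sh s t) = s *: delta_mx 0 i + rvec t.
  by rewrite rvec_affine; apply/rowP => j; rewrite !mxE eqxx mul1r addrC.
have msh s : measurable_fun setT (sh s) by exact: measurable_affine.
have tr s : transports (lt m) (lt m) (sh s) 1.
  have := @transports_affine m (fun=> 1) (b s) (fun=> oner_neq0 _).
  by rewrite normr1 big1.
have Fi := integrable_dom mF FC.
have cst s : (\int[lt m]_t F (s *: delta_mx 0 i + rvec t) = \int[lt m]_t F (rvec t))%R.
  rewrite [RHS](transport_Rintegral (msh s) ltr01 (tr s) Fi) mul1r.
  by apply: eq_Rintegral => t _; rewrite rsh.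
have D : is_derive (0 : R) 1 (fun s => \int[lt m]_t F (s *: delta_mx 0 i + rvec t))%R
    (\int[lt m]_t dF (0 *: delta_mx 0 i + rvec t))%R.
  apply: (@is_derive_integral _ _ (lt m) (fun s t => F (s *: delta_mx 0 i + rvec t))
    (fun s t => dF (s *: delta_mx 0 i + rvec t)) (fun t => C * 3 * weight (rvec t)) 0 1) => //.
  - move=> s _.
    have /(transport_integrable (msh s) ltr01 (tr s)) [/(_ Fi) + _] := mF.
    by apply: eq_integrable => // t _; rewrite /= rsh.
  - by move=> s t _; apply/is_derive_line.
  - exact: (integrableZl measurableT (C * 3) (integrable_weight m)).
  - move=> s t; rewrite subr0 => s1; rewrite (le_trans (dFC _))// -mulrA ler_wpM2l//.
      by have := le_trans (normr_ge0 _) (FC 0); rewrite pmulr_lge0// weight_gt0.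
    by apply: weight_shift; exact: ltW.
have -> : (\int[lt m]_t dF (rvec t) = \int[lt m]_t dF (0 *: delta_mx 0 i + rvec t))%R.
  by apply: eq_Rintegral => t _; rewrite scale0r add0r.
apply: (is_derive_unique D).
by rewrite (_ : (fun s => _) = fun=> (\int[lt m]_t F (rvec t))%R);
  [exact: is_derive_cst|exact/funext].
Qed.

End tuples.

(** * Real Schwartz functions *)

Section rschwartz.
Variables (R : realType) (m : nat).
Local Notation V := 'rV[R]_m.
Local Notation e_ i := (delta_mx 0 i : V).
Implicit Types (f g : V -> R).

(** The Schwartz space is the largest set of bounded functions stable under
    multiplication by the coordinates and under the partial derivatives
    ([rschwartz]). Membership is proved by exhibiting a stable set of bounded
    functions, with no formula for mixed products of coordinates and
    derivatives. *)
Definition schwartz_class (C : set (V -> R)) := forall g, C g ->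
  [/\ exists B, forall x, `|g x| <= B,
      forall i, C (fun x : V => x 0 i * g x) &
      forall i, exists g', C g' /\ forall x, is_derive x (e_ i) g (g' x)].

Definition rschwartz g := exists C, schwartz_class C /\ C g.

Lemma rschwartz_is_class : schwartz_class rschwartz.
Proof.
move=> g [C [sC Cg]]; have [b x d] := sC _ Cg; split => // i.
  by exists C; split.
by have [g' [Cg' dg]] := d i; exists g'; split => //; exists C.
Qed.

Lemma rschwartz_bounded g : rschwartz g -> exists B, forall x, `|g x| <= B.
Proof. by case/rschwartz_is_class. Qed.

Lemma rschwartz_coord g i : rschwartz g -> rschwartz (fun x : V => x 0 i * g x).
Proof. by case/rschwartz_is_class. Qed.

Lemma rschwartz_partial g i : rschwartz g -> rschwartz (ipartial [:: i] g).
Proof.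
case/rschwartz_is_class => _ _ /(_ i)[g' [rg' d]].
by rewrite (ipartial_eq d).
Qed.

Lemma rschwartz_has_partials g : rschwartz g -> has_partials g (fun i => ipartial [:: i] g).
Proof.
case/rschwartz_is_class => _ _ d i x; have [g' [_ dg]] := d i.
by rewrite (ipartial_eq dg).
Qed.

Lemma rschwartz_lin c f g : rschwartz f -> rschwartz g -> rschwartz (fun x => c * f x + g x).
Proof.
move=> rf rg; pose C : set (V -> R) :=
  [set h | exists f g, [/\ rschwartz f, rschwartz g & h = fun x => c * f x + g x]].
exists C; split; last by exists f, g.
move=> _ [{rf}f [{rg}g [rf rg ->]]]; split.
- have [B fB] := rschwartz_bounded rf; have [B' gB] := rschwartz_bounded rg.
  exists (`|c| * B + B') => x; rewrite (le_trans (ler_normD _ _))// lerD// normrM.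
  by rewrite ler_wpM2l.
- move=> i; exists (fun x : V => x 0 i * f x), (fun x : V => x 0 i * g x).
  split; [exact: rschwartz_coord|exact: rschwartz_coord|].
  by apply/funext => x; ring.
- move=> i; exists (fun x => c * ipartial [:: i] f x + ipartial [:: i] g x); split.
    by exists (ipartial [:: i] f), (ipartial [:: i] g); split => //; exact: rschwartz_partial.
  by move=> x; apply: is_deriveD; [apply: is_deriveZ|]; exact: rschwartz_has_partials.
Qed.

Lemma rschwartz0 : rschwartz (fun=> 0).
Proof.
exists [set fun=> 0]; split => // _ ->; split.
- by exists 0 => x; rewrite normr0.
- by move=> i; apply/funext => x; rewrite mulr0.
- by move=> i; exists (fun=> 0); split => // x; exact: is_derive_cst.
Qed.

Lemma rschwartzZ c f : rschwartz f -> rschwartz (fun x => c * f x).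
Proof.
move=> rf; have := rschwartz_lin c rf rschwartz0; congr rschwartz.
by apply/funext => x; rewrite addr0.
Qed.

Lemma rschwartz_sum (I : Type) (r : seq I) (F : I -> V -> R) :
  (forall i, rschwartz (F i)) -> rschwartz (fun x => \sum_(i <- r) F i x).
Proof.
move=> rF; elim: r => [|i r IH].
  by under eq_fun do rewrite big_nil; exact: rschwartz0.
under eq_fun do rewrite big_cons -[F i _]mul1r.
exact: rschwartz_lin.
Qed.

Lemma rschwartz_continuous g : rschwartz g -> continuous g.
Proof.
move=> rg.
have [B BP] := choice (fun i => rschwartz_bounded (rschwartz_partial i rg)).
apply: (continuous_partials (B := \sum_i `|B i|) (rschwartz_has_partials rg)) => i y.
rewrite (le_trans (BP i y))// (bigD1 i)//= (le_trans (ler_norm _))// lerDl.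
by rewrite sumr_ge0.
Qed.

Lemma rschwartz_smooth g : rschwartz g -> smooth_real setT g.
Proof.
apply: smooth_classP => {}g rg; split; first exact: rschwartz_continuous.
move=> i; exists (ipartial [:: i] g); split; first exact: rschwartz_partial.
by move=> x; exact: rschwartz_has_partials.
Qed.

Lemma rschwartz_dir g (x v : V) : rschwartz g ->
  is_derive x v g (\sum_i v 0 i * ipartial [:: i] g x).
Proof.
move=> rg; apply: (@gradient R m g (fun i => ipartial [:: i] g) x v).
  exact: rschwartz_has_partials.
by move=> i; apply: rschwartz_continuous; exact: rschwartz_partial.
Qed.

(** The product of g by all factors 1 + x_i^2 is a combination of products of
    g by coordinates, hence is bounded. *)
Lemma rschwartz_weight g : rschwartz g -> exists2 C, 0 <= C & forall x, `|g x| <= C * weight x.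
Proof.
move=> rg.
have [] := @rschwartz_bounded (fun x : V => (\prod_(i <- enum 'I_m) (1 + x 0 i ^+ 2)) * g x).
  elim: (enum _) => [|i s IH].
    by under eq_fun do rewrite big_nil mul1r.
  under eq_fun => x.
    rewrite big_cons (_ : _ * _ = 1 * (x 0 i * (x 0 i *
      ((\prod_(i <- s) (1 + x 0 i ^+ 2)) * g x))) + (\prod_(i <- s) (1 + x 0 i ^+ 2)) * g x); last by ring.
    over.
  by apply: rschwartz_lin => //; do 2 apply: rschwartz_coord.
move=> B BP; exists `|B| => // x; have := BP x.
have p0 : 0 < \prod_i (1 + x 0 i ^+ 2) by apply: prodr_gt0 => i _; rewrite ltr_pwDl// sqr_ge0.
rewrite big_enum /= normrM gtr0_norm// mulrC -ler_pdivlMr// => /le_trans; apply.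
by rewrite /weight prodfV ler_wpM2r ?invr_ge0 ?ler_norm// ltW.
Qed.

Lemma rschwartz_diag g (a : 'I_m -> R) : (forall i, a i != 0) -> rschwartz g ->
  rschwartz (fun x => g (\row_i (a i * x 0 i))).
Proof.
move=> a0 rg; pose C : set (V -> R) :=
  [set h | exists c f, rschwartz f /\ h = fun x : V => c * f (\row_i (a i * x 0 i))].
exists C; split; last by exists 1, g; split => //; apply/funext => x; rewrite mul1r.
move=> _ [c [f [rf ->]]]; split.
- have [B fB] := rschwartz_bounded rf.
  by exists (`|c| * B) => x; rewrite normrM ler_wpM2l.
- move=> i; exists (c * (a i)^-1), (fun x : V => x 0 i * f x); split; first exact: rschwartz_coord.
  by apply/funext => x; rewrite mxE; field; exact: a0.
- move=> i; exists (fun x : V => c * a i * ipartial [:: i] f (\row_i (a i * x 0 i))); split.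
    by exists (c * a i), (ipartial [:: i] f); split => //; exact: rschwartz_partial.
  move=> x; rewrite -mulrA; apply: is_deriveZ; apply/is_derive_line0.
  have := is_deriveZdir (a i) (rschwartz_has_partials rf i (\row_i (a i * x 0 i))).
  move=> /is_derive_line0; congr is_derive; apply/funext => h; congr f.
  apply/rowP => j; rewrite !mxE eqxx/= mulrDr mulrCA; congr (_ + _).
  by have [->//|_] := eqVneq j i; rewrite !mulr0.
Qed.

Definition rescaleR (rho : V -> R) (e : R) : V -> R := fun x => e ^- m * rho (e^-1 *: x).

Lemma rschwartz_rescale g (e : R) : e != 0 -> rschwartz g -> rschwartz (rescaleR g e).
Proof.
move=> e0 rg; apply: rschwartzZ.
have := @rschwartz_diag g (fun=> e^-1) (fun=> _) rg; rewrite invr_eq0 => /(_ (fun=> e0)).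
by congr rschwartz; apply/funext => x; congr g; apply/rowP => i; rewrite !mxE.
Qed.

Lemma rescale_coord g (e : R) i (x : V) : e != 0 ->
  x 0 i * rescaleR g e x = e * rescaleR (fun x : V => x 0 i * g x) e x.
Proof. move=> e0; rewrite /rescaleR mxE; set E := e ^- m; set G := g _.
by field. Qed.

Lemma rescale_partial g (e : R) i : e != 0 -> rschwartz g ->
  ipartial [:: i] (rescaleR g e) = fun x => e^-1 * rescaleR (ipartial [:: i] g) e x.
Proof.
move=> e0 rg; apply: ipartial_eq => x; rewrite mulrCA /rescaleR.
apply: is_deriveZ; apply/is_derive_line0.
have /is_derive_line0 := is_deriveZdir e^-1 (rschwartz_has_partials rg i (e^-1 *: x)).
by congr is_derive; apply/funext => h; congr g; rewrite scalerDr !scalerA mulrC.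
Qed.

(** The infinitesimal generator of the dilations rescaleR. *)
Definition euler g : V -> R := fun x => - (m%:R * g x + \sum_i x 0 i * ipartial [:: i] g x).

Lemma rschwartz_euler g : rschwartz g -> rschwartz (euler g).
Proof.
move=> rg; rewrite /euler; under eq_fun do rewrite -mulN1r.
apply: rschwartzZ; apply: rschwartz_lin => //; apply: rschwartz_sum => i.
by apply: rschwartz_coord; exact: rschwartz_partial.
Qed.

Lemma rescale_euler g (e : R) (x : V) : e != 0 -> rschwartz g ->
  is_derive e 1 (fun e => rescaleR g e x) (e^-1 * rescaleR (euler g) e x).
Proof.
move=> e0 rg.
have dV : is_derive e (1 : R) (fun e : R => e^-1) (- e ^- 2).
  have := @is_deriveV R id e 1 1 e0 (is_derive_id _ _).
  by rewrite [_ *: 1]mulr1.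
have d1 : is_derive e (1 : R) (fun e : R => e ^- m) (- m%:R * e ^- m.+1).
  have := is_derive_pow m dV; under eq_fun do rewrite exprVn.
  congr is_derive; clear; case: m => [|k]; first by rewrite oppr0 !mul0r.
  by rewrite -!exprVn /= !exprS; ring.
have d2 : is_derive e (1 : R) (fun e : R => g (e^-1 *: x))
    ((\sum_i x 0 i * ipartial [:: i] g (e^-1 *: x)) * - e ^- 2).
  have := rschwartz_dir (e^-1 *: x) x rg.
  rewrite -[e^-1 *: x]addr0 => /is_derive_line h.
  have := is_derive1_comp h dV; rewrite addr0; congr is_derive.
  by apply/funext => t /=; rewrite addr0.
have := is_derive_mul d1 d2; congr is_derive.
rewrite /rescaleR /euler -[in RHS]exprVn.
rewrite [in RHS](eq_bigr (fun i => e^-1 * (x 0 i * ipartial [:: i] g (e^-1 *: x)))); last first.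
  by move=> i _; rewrite mxE mulrA.
rewrite -mulr_sumr; set S := \sum_i _; rewrite -!exprVn !exprS; ring.
Qed.

End rschwartz.

(** * Partial Fourier integrals of Schwartz functions *)

Section kern.
Variables (R : realType) (n : nat).
Local Notation V := 'rV[R]_n.
Local Notation W := 'rV[R]_(n + 1).
Local Notation N := (n + n + 1)%N.
Local Notation H := 'rV[R]_N.
Local Notation Rm := (measurableTypeR R).
Local Notation lt m := (lebesgue_tuple R m).
Implicit Types (F rho : H -> R) (z c x y : V) (w : W) (th : R).

Definition iz (i : 'I_n) : 'I_N := lshift 1 (lshift n i).
Definition ix (i : 'I_n) : 'I_N := lshift 1 (rshift n i).
Definition it : 'I_N := rshift (n + n) ord0.

Lemma glue_z z w i : zglue z w 0 (iz i) = z 0 i.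
Proof. by rewrite /zglue /iz !row_mxEl. Qed.

Lemma glue_x z w i : zglue z w 0 (ix i) = w 0 (lshift 1 i).
Proof. by rewrite /zglue /ix row_mxEl row_mxEr mxE. Qed.

Lemma glue_shift_z (a : R) z w i : zglue (a *: delta_mx 0 i + z) w = a *: delta_mx 0 (iz i) + zglue z w.
Proof.
apply/rowP => j; rewrite !mxE; case: splitP => k jk; rewrite !mxE; last first.
  rewrite (_ : j == iz i = false) ?andbF ?mulr0 ?add0r//.
  by apply/negP => /eqP/(congr1 val); rewrite /= jk => E; have := ltn_ord i; rewrite -E; lia.
case: splitP => l kl; rewrite !mxE; last first.
  rewrite (_ : j == iz i = false) ?andbF ?mulr0 ?add0r//.
  by apply/negP => /eqP/(congr1 val); rewrite /= jk kl => E; have := ltn_ord i; rewrite -E; lia.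
by congr (_ * (_ && _)%:R + _); rewrite -!val_eqE /= jk kl.
Qed.

Lemma glue_shift_x (a : R) z w i :
  zglue z (a *: delta_mx 0 (lshift 1 i) + w) = a *: delta_mx 0 (ix i) + zglue z w.
Proof.
apply/rowP => j; rewrite !mxE; case: splitP => k jk; rewrite !mxE; last first.
  by congr (_ * (_ && _)%:R + _); rewrite -!val_eqE /= jk; have := ltn_ord i; lia.
case: splitP => l kl; rewrite ?mxE.
  rewrite (_ : j == ix i = false) ?andbF ?mulr0 ?add0r//.
  by apply/negP => /eqP/(congr1 val); rewrite /= jk kl => E; have := ltn_ord l; rewrite E; lia.
by congr (_ * (_ && _)%:R + _); rewrite -!val_eqE /= jk kl; lia.
Qed.

Lemma weight_glue z w : weight (zglue z w) = weight z * weight w.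
Proof.
rewrite /weight big_split_ord/= big_split_ord/= [in RHS]big_split_ord/= -mulrA.
congr (_ * (_ * _)); apply: eq_bigr => i _; rewrite ?(glue_z z w i) ?(glue_x z w i)//.
by rewrite /zglue row_mxEr mxE.
Qed.

Lemma weight_le1 m (x : 'rV[R]_m) : weight x <= 1.
Proof.
apply: prodr_ile1 => i _; have h : 0 < 1 + x 0 i ^+ 2 by rewrite ltr_pwDl// sqr_ge0.
by rewrite invr_ge0 ltW//= invf_le1// lerDl sqr_ge0.
Qed.

Lemma weight_glue_le z w : weight (zglue z w) <= weight w.
Proof. by rewrite weight_glue ler_piMl ?weight_ge0 ?weight_le1. Qed.

Lemma weight_scale m (e : R) (x : 'rV[R]_m) : 0 < e < 1 -> weight (e^-1 *: x) <= weight x.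
Proof.
move=> /andP[e0 e1]; apply: ler_prod => i _; rewrite mxE.
have h (a : R) : 0 < 1 + a ^+ 2 by rewrite ltr_pwDl// sqr_ge0.
rewrite invr_ge0 ltW//= lef_pV2 ?posrE// lerD2l exprMn ler_peMl ?sqr_ge0//.
by rewrite exprn_ege1// invf_ge1// ltW.
Qed.

Lemma rescale_le rho (C e : R) a : 0 < e < 1 -> 0 <= C -> (forall a, `|rho a| <= C * weight a) ->
  `|rescaleR rho e a| <= e ^- N * C * weight a.
Proof.
move=> e01 C0 rC; have [e0 _] := andP e01.
have p : 0 < e ^- N by rewrite invr_gt0 exprn_gt0.
rewrite /rescaleR normrM gtr0_norm// -mulrA; apply: ler_wpM2l; first exact: ltW.
apply: (le_trans (rC _)).
by rewrite ler_wpM2l// weight_scale.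
Qed.

(** The phase of the kernel at w = (xi, tau), where c stands for (x + y)/2. *)
Definition phase c w : R :=
  - (2 * pi) * (w 0 (rshift n ord0) + \sum_i w 0 (lshift 1 i) * c 0 i).

Lemma phase_shift_c (b : R) c w i :
  phase (b *: delta_mx 0 i + c) w = - (2 * pi) * (b * w 0 (lshift 1 i)) + phase c w.
Proof.
rewrite /phase -mulrDr; congr (_ * _); rewrite addrCA; congr (_ + _).
rewrite (bigD1 i)//= [in RHS](bigD1 i)//= !mxE !eqxx/= mulr1 mulrDr addrA [b * _]mulrC.
by congr (_ + _); apply: eq_bigr => j ji; rewrite !mxE eqxx (negbTE ji) mulr0 add0r.
Qed.

Lemma phase_shift_w (b : R) c w i :
  phase c (b *: delta_mx 0 (lshift 1 i) + w) = - (2 * pi) * (b * c 0 i) + phase c w.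
Proof.
rewrite /phase -mulrDr; congr (_ * _); rewrite addrCA !mxE.
rewrite (_ : rshift n ord0 == lshift 1 i = false) ?andbF ?mulr0 ?add0r; last first.
  by apply/negP => /eqP/(congr1 val) /= E; have := ltn_ord i; rewrite -E; lia.
congr (_ + _).
rewrite (bigD1 i)//= [in RHS](bigD1 i)//= !mxE !eqxx/= mulr1 mulrDl addrA.
congr (_ + _); apply: eq_bigr => j ji; rewrite !mxE eqxx.
by rewrite (inj_eq (@lshift_inj _ _)) (negbTE ji) mulr0 add0r.
Qed.

(** Differentiating a cosine advances its angle by a quarter turn. This keeps
    all integrals in the same family, indexed by the angle th. *)
Lemma cos_shift (f : R -> R) (t a th : R) : is_derive t 1 f a ->
  is_derive t 1 (fun t => cos (f t + th)) (a * cos (f t + (th + pi / 2))).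
Proof.
move=> fd; rewrite addrA cosDpihalf mulrC.
have fd' : is_derive t 1 (fun t => f t + th) a.
  by have := is_deriveD fd (@is_derive_cst R R R th t 1); rewrite addr0.
exact: (is_derive1_comp (is_derive_cos _) fd').
Qed.

Definition kintegrand F th z c w := F (zglue z w) * cos (phase c w + th).

(** For th = 0 and th = - pi / 2 these are the integrals against the real and
    the imaginary part of the exponential, with z = y - x and c = (x + y)/2. *)
Definition kern F th z c : R := (\int[lt (n + 1)]_q kintegrand F th z c (rvec q))%R.

Lemma measurable_phase c : measurable_fun setT (fun q : (n + 1).-tuple Rm => phase c (rvec q)).
Proof.
apply: measurable_funM => //; apply: measurable_funD.
  by under eq_fun do rewrite rvecE; exact: measurable_tnth.
apply: measurable_sum => i; apply: measurable_funM => //.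
by under eq_fun do rewrite rvecE; exact: measurable_tnth.
Qed.

Lemma measurable_cosphase c th :
  measurable_fun setT (fun q : (n + 1).-tuple Rm => cos (phase c (rvec q) + th)).
Proof.
apply: measurableT_comp; first by apply: continuous_measurable_fun; exact: continuous_cos.
by apply: measurable_funD => //; exact: measurable_phase.
Qed.

Lemma measurable_kintegrand F th z c : continuous F ->
  measurable_fun setT (fun q : (n + 1).-tuple Rm => kintegrand F th z c (rvec q)).
Proof.
move=> cF; apply: measurable_funM; last exact: measurable_cosphase.
have := measurableT_comp (measurable_continuous cF)
  (measurableT_comp (@measurable_glue R n) (@pair1_measurable _ _ _ _ (rtup z))).
by congr measurable_fun; apply/funext => q /=; rewrite rvec_glue rtupK.
Qed.

Lemma kintegrand_le F th z c (C : R) : (forall a, `|F a| <= C * weight a) ->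
  forall w, `|kintegrand F th z c w| <= C * weight w.
Proof.
move=> FC w; rewrite /kintegrand normrM.
have C0 : 0 <= C by have := le_trans (normr_ge0 _) (FC 0); rewrite pmulr_lge0// weight_gt0.
have cos1 : `|cos (phase c w + th)| <= 1 by rewrite ler_norml cos_geN1 cos_le1.
rewrite (@le_trans _ _ (`|F (zglue z w)|))//; first by rewrite ler_piMr.
by rewrite (le_trans (FC _))// ler_wpM2l// weight_glue_le.
Qed.

Lemma kintegrand_integrable F th z c : rschwartz F ->
  (lt (n + 1)).-integrable setT (fun q => (kintegrand F th z c (rvec q))%:E).
Proof.
move=> rF; have [C C0 FC] := rschwartz_weight rF.
apply: (@integrable_dom _ _ _ C); last exact: kintegrand_le.
by apply: measurable_kintegrand; apply: rschwartz_continuous.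
Qed.

Lemma kern_le F th z c (C : R) : continuous F -> (forall a, `|F a| <= C * weight a) ->
  `|kern F th z c| <= C * pi ^+ (n + 1).
Proof.
move=> cF FC; apply: (@le_Rintegral_dom _ _ (kintegrand F th z c)).
  exact: measurable_kintegrand.
exact: kintegrand_le.
Qed.

Lemma kern_comb F G th th' z c (a b : R) : rschwartz F -> rschwartz G ->
  (\int[lt (n + 1)]_q (a * kintegrand F th z c (rvec q) + b * kintegrand G th' z c (rvec q)))%R =
  a * kern F th z c + b * kern G th' z c.
Proof.
move=> rF rG; have iF := kintegrand_integrable th z c rF; have iG := kintegrand_integrable th' z c rG.
rewrite /kern -RintegralZl// -[b * _]RintegralZl// -RintegralD//.
- exact: (integrableZl measurableT a iF).
- exact: (integrableZl measurableT b iG).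
Qed.

Lemma kernZ F th z c (a : R) : rschwartz F -> kern (fun h : H => a * F h) th z c = a * kern F th z c.
Proof.
move=> rF; have iF := kintegrand_integrable th z c rF.
rewrite /kern -RintegralZl//; apply: eq_Rintegral => q _; rewrite /kintegrand mulrA//.
Qed.

(** The two directions z and c move together because each of x and y enters in
    both of them: the pair (a, b) is (-1, 1/2) for a derivative in x, and (1,
    1/2) for a derivative in y. *)
Lemma kern_deriv F th z c i (a b : R) : rschwartz F ->
  is_derive (0 : R) 1
    (fun t => kern F th ((t * a) *: delta_mx 0 i + z) ((t * b) *: delta_mx 0 i + c))
    (a * kern (ipartial [:: iz i] F) th z c +
     - (2 * pi) * b * kern (fun h : H => h 0 (ix i) * F h) (th + pi / 2) z c).
Proof.
move=> rF; have rdF := rschwartz_partial (iz i) rF; have rxF := rschwartz_coord (ix i) rF.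
have [C1 C10 H1] := rschwartz_weight rdF; have [C2 C20 H2] := rschwartz_weight rxF.
pose zt (t : R) := (t * a) *: delta_mx 0 i + z; pose ct (t : R) := (t * b) *: delta_mx 0 i + c.
pose f' (t : R) w := a * kintegrand (ipartial [:: iz i] F) th (zt t) (ct t) w +
  (- (2 * pi) * b) * kintegrand (fun h : H => h 0 (ix i) * F h) (th + pi / 2) (zt t) (ct t) w.
rewrite -kern_comb//.
have -> : (\int[lt (n + 1)]_q (a * kintegrand (ipartial [:: iz i] F) th z c (rvec q) +
    - (2 * pi) * b * kintegrand (fun h : H => h 0 (ix i) * F h) (th + pi / 2) z c (rvec q)))%R =
   (\int[lt (n + 1)]_q f' 0 (rvec q))%R.
  by apply: eq_Rintegral => q _; rewrite /f' /zt /ct !mul0r !scale0r !add0r.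
apply: (@is_derive_integral R _ _ (lt (n + 1)) (fun t q => kintegrand F th (zt t) (ct t) (rvec q))
  (fun t q => f' t (rvec q))
  (fun q => (`|a| * C1 + `|- (2 * pi) * b| * C2) * weight (rvec q)) 0 1) => //.
- by move=> t _; exact: kintegrand_integrable.
- move=> t q _; set w := rvec q; rewrite /f' /kintegrand.
  have d1 : is_derive t 1 (fun t => F (zglue (zt t) w)) (a * ipartial [:: iz i] F (zglue (zt t) w)).
    rewrite /zt; under eq_fun do rewrite glue_shift_z -scalerA.
    rewrite glue_shift_z -scalerA; apply/is_derive_line; apply: is_deriveZdir.
    exact: rschwartz_has_partials.
  have d2 : is_derive t 1 (fun t => phase (ct t) w) (- (2 * pi) * b * w 0 (lshift 1 i)).
    rewrite /ct; under eq_fun do rewrite phase_shift_c.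
    have := is_deriveD (is_deriveZ (- (2 * pi) * b * w 0 (lshift 1 i)) (is_derive_id t (1 : R)))
      (@is_derive_cst R R R (phase c w) t 1).
    rewrite addr0 [_ *: 1]mulr1; congr is_derive; apply/funext => s.
    by rewrite !fctE/= /GRing.scale/=; ring.
  have := is_derive_mul d1 (cos_shift th d2); congr is_derive.
  by rewrite glue_x; ring.
- exact: (integrableZl measurableT _ (integrable_weight R (n + 1))).
- move=> t q _; rewrite /f' [in leRHS]mulrDl; apply: (le_trans (ler_normD _ _)).
  by apply: lerD; rewrite normrM -mulrA ler_wpM2l// kintegrand_le.
Qed.

(** An integration by parts in the frequency: c_i times the exponential is, up
    to a constant, its derivative in xi_i. *)
Lemma kern_cmul F th z c i : rschwartz F ->
  c 0 i * kern F th z c = (2 * pi)^-1 * kern (ipartial [:: ix i] F) (th - pi / 2) z c.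
Proof.
move=> rF; have rdF := rschwartz_partial (ix i) rF.
have [C1 C10 H1] := rschwartz_weight rF; have [C2 C20 H2] := rschwartz_weight rdF.
pose G := kintegrand F (th - pi / 2) z c.
pose dG w := 1 * kintegrand (ipartial [:: ix i] F) (th - pi / 2) z c w +
  (- (2 * pi) * c 0 i) * kintegrand F th z c w.
have := @integral_partial0 R _ G dG (lshift 1 i)
  (C1 + (C2 + `|- (2 * pi) * c 0 i| * C1)).
rewrite /dG kern_comb// mul1r => E.
have /eqP : kern (ipartial [:: ix i] F) (th - pi / 2) z c + - (2 * pi) * c 0 i * kern F th z c = 0.
  apply: E.
  - move=> w; apply/is_derive_line0; rewrite /G /kintegrand.
    have d1 : is_derive (0 : R) 1 (fun t => F (zglue z (t *: delta_mx 0 (lshift 1 i) + w)))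
        (ipartial [:: ix i] F (zglue z w)).
      under eq_fun do rewrite glue_shift_x.
      by apply/is_derive_line0; exact: rschwartz_has_partials.
    have d2 : is_derive (0 : R) 1 (fun t => phase c (t *: delta_mx 0 (lshift 1 i) + w))
        (- (2 * pi) * c 0 i).
      under eq_fun do rewrite phase_shift_w.
      have := is_deriveD (is_deriveZ (- (2 * pi) * c 0 i) (is_derive_id (0 : R) (1 : R)))
        (@is_derive_cst R R R (phase c w) 0 1).
      rewrite addr0 [_ *: 1]mulr1; congr is_derive; apply/funext => s.
      by rewrite !fctE/= /GRing.scale/=; ring.
    have := is_derive_mul d1 (cos_shift (th - pi / 2) d2); congr is_derive.
    by rewrite scale0r add0r subrK; ring.
  - by apply: measurable_kintegrand; apply: rschwartz_continuous.
  - move=> w; rewrite mulrDl (le_trans (kintegrand_le _ _ _ H1 _))// lerDl.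
    by rewrite mulr_ge0 ?weight_ge0// addr_ge0// mulr_ge0.
  - move=> w; rewrite mul1r [in leRHS]mulrDl.
    apply: (@le_trans _ _ ((C2 + `|- (2 * pi) * c 0 i| * C1) * weight w)); last first.
      by rewrite lerDr mulr_ge0 ?weight_ge0.
    rewrite [in leRHS]mulrDl; apply: (le_trans (ler_normD _ _)); apply: lerD; first exact: kintegrand_le.
    by rewrite normrM -mulrA ler_wpM2l// kintegrand_le.
rewrite addrC mulNr mulNr addrC subr_eq0 => /eqP ->.
by rewrite -mulrA mulKf// mulf_neq0// gt_eqF// pi_gt0.
Qed.

Lemma kern_zmulE F th z c i : rschwartz F ->
  kern (fun h : H => h 0 (iz i) * F h) th z c = z 0 i * kern F th z c.
Proof.
move=> rF; have iF := kintegrand_integrable th z c rF.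
rewrite /kern -RintegralZl//; apply: eq_Rintegral => q _.
by rewrite /kintegrand glue_z mulrA.
Qed.

(** The dilation field [euler] replaces rho. Differentiation under the
    integral is justified on a neighbourhood of e that stays away from 0. *)
Lemma kern_rescale_deriv rho th z c (e : R) : rschwartz rho -> 0 < e < 1 ->
  is_derive e 1 (fun e => kern (rescaleR rho e) th z c)
    (e^-1 * kern (rescaleR (euler rho) e) th z c).
Proof.
move=> rr /andP[e0 e1]; have re := rschwartz_euler rr.
have [C C0 HC] := rschwartz_weight re.
(* on this neighbourhood the parameter stays between e / 2 and 1 *)
pose r := Num.min (e / 2) (1 - e).
have r0 : 0 < r by rewrite lt_min divr_gt0//= subr_gt0.
have tr t : `|t - e| < r -> e / 2 < t < 1.
  by rewrite lt_min !ltr_norml => /andP[/andP[? ?] /andP[? ?]]; apply/andP; split; lra.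
have -> : e^-1 * kern (rescaleR (euler rho) e) th z c =
  (\int[lt (n + 1)]_q (e^-1 * kintegrand (rescaleR (euler rho) e) th z c (rvec q)))%R.
  by rewrite /kern RintegralZl//; apply: kintegrand_integrable; apply: rschwartz_rescale; rewrite ?gt_eqF.
apply: (@is_derive_integral R _ _ (lt (n + 1)) (fun e q => kintegrand (rescaleR rho e) th z c (rvec q))
  (fun e q => e^-1 * kintegrand (rescaleR (euler rho) e) th z c (rvec q))
  (fun q => ((e / 2)^-1 * ((e / 2) ^- N * C)) * weight (rvec q)) e r) => //.
- move=> t /tr /andP[t0 _]; apply: kintegrand_integrable; apply: rschwartz_rescale => //.
  by rewrite gt_eqF// (lt_trans _ t0)// divr_gt0.
- move=> t q /tr /andP[t0 _]; rewrite /kintegrand mulrA.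
  have tn : t != 0 by rewrite gt_eqF// (lt_trans _ t0)// divr_gt0.
  have := is_derive_mul (rescale_euler (zglue z (rvec q)) tn rr)
    (@is_derive_cst R R R (cos (phase c (rvec q) + th)) t 1).
  by rewrite mulr0 addr0.
- exact: (integrableZl measurableT _ (integrable_weight R (n + 1))).
- move=> t q /tr /andP[te t1].
  have e2 : 0 < e / 2 by rewrite divr_gt0.
  have t0 : 0 < t by exact: lt_trans te.
  rewrite normrM gtr0_norm ?invr_gt0// -mulrA; apply: ler_pM => //.
  + by rewrite invr_ge0 ltW.
  + by rewrite lef_pV2 ?posrE// ltW.
  apply: (@le_trans _ _ (t ^- N * C * weight (rvec q))).
    by apply: kintegrand_le => a; apply: rescale_le => //; rewrite t0.
  rewrite ler_wpM2r ?weight_ge0// ler_wpM2r// lef_pV2 ?posrE ?exprn_gt0//.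
  by apply: lerXn2r; rewrite ?nnegrE ltW.
Qed.

End kern.

(** * The space of kernels *)

Section fam.
Variables (R : realType) (n : nat).
Local Notation V := 'rV[R]_n.
Local Notation N := (n + n + 1)%N.
Local Notation H := 'rV[R]_N.
Local Notation e_ i := (delta_mx 0 i : V).
Implicit Types (G : R -> V -> V -> R) (rho : H -> R) (x y : V) (e : R).

(** Kernels depending on a parameter e, spanned by the integrals [kern] of
    rescaled Schwartz functions. The index K bounds the number of factors 1 /
    e besides the e^-N of the rescaling; it increases by at most one under
    each of the operations below. Closing under equality on 0 < e < 1 allows
    the operations to be computed for those e only. *)
Inductive fam (K : nat) : (R -> V -> V -> R) -> Prop :=
| fam_base j k th rho of (k <= K)%N & rschwartz rho : fam K (fun e x y =>
    e ^+ j * e^-1 ^+ k * kern (rescaleR rho e) th (y - x) (2^-1 *: (x + y)))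
| fam_lin c G G' of fam K G & fam K G' : fam K (fun e x y => c * G e x y + G' e x y)
| fam_ext G G' of fam K G &
    (forall e x y, 0 < e < 1 -> G e x y = G' e x y) : fam K G'.

Lemma fam_kern th rho : rschwartz rho ->
  fam 0 (fun e x y => kern (rescaleR rho e) th (y - x) (2^-1 *: (x + y))).
Proof.
move=> rr; apply: (fam_ext (fam_base 0 th (leqnn 0) rr)) => e x y _.
by rewrite !expr0 !mul1r.
Qed.

Lemma fam0 K : fam K (fun _ _ _ => 0).
Proof.
apply: (fam_ext (fam_base 0 0 (leq0n K) (rschwartz0 R N))) => e x y _.
have k0 := @kernZ R n (fun=> 0) 0 (y - x) (2^-1 *: (x + y)) 0 (rschwartz0 R N).
rewrite (_ : rescaleR (fun=> 0) e = fun=> 0 * 0); last first.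
  by apply/funext => a; rewrite /rescaleR mulr0 mul0r.
by rewrite k0 mul0r mulr0.
Qed.

Lemma famZ K c G : fam K G -> fam K (fun e x y => c * G e x y).
Proof.
by move=> fG; apply: (fam_ext (fam_lin c fG (fam0 K))) => e x y _; rewrite addr0.
Qed.

Lemma fam_bound K G : fam K G -> exists2 C, 0 <= C &
  forall e x y, 0 < e < 1 -> `|G e x y| <= C * e^-1 ^+ (K + N).
Proof.
elim=> [j k th rho kK rr|c G1 G2 _ [C1 C10 H1] _ [C2 C20 H2]|G1 G2 _ [C C0 HC] E].
- have [C C0 HC] := rschwartz_weight rr.
  exists (C * pi ^+ (n + 1)) => [|e x y e01].
    by rewrite mulr_ge0// exprn_ge0// pi_ge0.
  have /andP[e0 e1] := e01; have ie1 : 1 <= e^-1 by rewrite invf_ge1// ltW.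
  have ie0 : 0 <= e^-1 by rewrite invr_ge0 ltW.
  have kb : `|kern (rescaleR rho e) th (y - x) (2^-1 *: (x + y))| <=
      e^-1 ^+ N * C * pi ^+ (n + 1).
    apply: kern_le; first by apply: rschwartz_continuous; apply: rschwartz_rescale; rewrite ?gt_eqF.
    by move=> a; rewrite exprVn; exact: rescale_le.
  have pj : `|e ^+ j * e^-1 ^+ k| <= e^-1 ^+ K.
    rewrite normrM !ger0_norm ?exprn_ge0 ?(ltW e0)// -[leRHS]mul1r.
    apply: ler_pM; rewrite ?exprn_ge0//; [exact: ltW| |exact: ler_weXn2l].
    by rewrite exprn_ile1// ltW.
  rewrite normrM (exprD e^-1 K N) [leRHS]mulrCA.
  apply: ler_pM => //; apply: (le_trans kb).
  by rewrite -mulrA mulrC.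
- exists (`|c| * C1 + C2) => [|e x y e01]; first by rewrite addr_ge0// mulr_ge0.
  rewrite mulrDl; apply: (le_trans (ler_normD _ _)); apply: lerD; last exact: H2.
  by rewrite normrM -mulrA ler_wpM2l// H1.
- by exists C => // e x y e01; rewrite -E// HC.
Qed.

Let shiftx (h : R) x y i : y - (h *: e_ i + x) = (h * -1) *: e_ i + (y - x).
Proof. by rewrite mulrN1 scaleNr opprD addrCA. Qed.

Let shifty (h : R) x y i : h *: e_ i + y - x = (h * 1) *: e_ i + (y - x).
Proof. by rewrite mulr1 addrA. Qed.

Let shiftcx (h : R) x y i : 2^-1 *: (h *: e_ i + x + y) = (h * 2^-1) *: e_ i + 2^-1 *: (x + y).
Proof. by rewrite -addrA scalerDr scalerA mulrC. Qed.

Let shiftcy (h : R) x y i : 2^-1 *: (x + (h *: e_ i + y)) = (h * 2^-1) *: e_ i + 2^-1 *: (x + y).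
Proof. by rewrite addrCA scalerDr scalerA mulrC. Qed.

Let base_der (a : R) j k th rho i e x y : rschwartz rho -> 0 < e < 1 ->
  is_derive (0 : R) 1 (fun t => e ^+ j * e^-1 ^+ k *
      kern (rescaleR rho e) th ((t * a) *: e_ i + (y - x)) ((t * 2^-1) *: e_ i + 2^-1 *: (x + y)))
    (a * (e ^+ j * e^-1 ^+ k.+1 * kern (rescaleR (ipartial [:: iz i] rho) e) th (y - x) (2^-1 *: (x + y))) +
     - pi * (e ^+ j.+1 * e^-1 ^+ k *
       kern (rescaleR (fun h : H => h 0 (ix i) * rho h) e) (th + pi / 2) (y - x) (2^-1 *: (x + y)))).
Proof.
move=> rr /andP[e0 e1]; have en : e != 0 by rewrite gt_eqF.
have rre := rschwartz_rescale en rr.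
have := is_deriveZ (e ^+ j * e^-1 ^+ k) (kern_deriv th (y - x) (2^-1 *: (x + y)) i a 2^-1 rre).
congr is_derive; rewrite rescale_partial// kernZ; last first.
  by apply: rschwartz_rescale => //; exact: rschwartz_partial.
under [X in kern X (th + _)]eq_fun do rewrite rescale_coord//.
rewrite kernZ; last by apply: rschwartz_rescale => //; exact: rschwartz_coord.
rewrite /GRing.scale/= !exprS; by field.
Qed.

Lemma fam_dx K G i : fam K G -> exists2 G', fam K.+1 G' &
  forall e x y, 0 < e < 1 -> is_derive x (e_ i) (fun x => G e x y) (G' e x y).
Proof.
elim=> [j k th rho kK rr|c G1 G2 _ [D1 F1 H1] _ [D2 F2 H2]|G1 G2 _ [D F HC] E].
- eexists; last first.
    move=> e x y e01; apply/is_derive_line0.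
    under eq_fun do rewrite shiftx shiftcx.
    exact: (base_der (-1) j k th i x y rr e01).
  apply: fam_lin; first by apply: fam_base => //; exact: rschwartz_partial.
  by apply: famZ; apply: fam_base; [exact: leqW|exact: rschwartz_coord].
- exists (fun e x y => c * D1 e x y + D2 e x y); first exact: fam_lin.
  by move=> e x y e01; apply: is_deriveD; [apply: is_deriveZ; exact: H1|exact: H2].
- exists D => // e x y e01; have := HC e x y e01; congr is_derive.
  by apply/funext => x'; exact: E.
Qed.

Lemma fam_dy K G i : fam K G -> exists2 G', fam K.+1 G' &
  forall e x y, 0 < e < 1 -> is_derive y (e_ i) (G e x) (G' e x y).
Proof.
elim=> [j k th rho kK rr|c G1 G2 _ [D1 F1 H1] _ [D2 F2 H2]|G1 G2 _ [D F HC] E].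
- eexists; last first.
    move=> e x y e01; apply/is_derive_line0.
    under eq_fun do rewrite shifty shiftcy.
    exact: (base_der 1 j k th i x y rr e01).
  apply: fam_lin; first by apply: fam_base => //; exact: rschwartz_partial.
  by apply: famZ; apply: fam_base; [exact: leqW|exact: rschwartz_coord].
- exists (fun e x y => c * D1 e x y + D2 e x y); first exact: fam_lin.
  by move=> e x y e01; apply: is_deriveD; [apply: is_deriveZ; exact: H1|exact: H2].
- exists D => // e x y e01; have := HC e x y e01; congr is_derive.
  by apply/funext => y'; exact: E.
Qed.

Lemma fam_de K G : fam K G -> exists2 G', fam K.+1 G' &
  forall e x y, 0 < e < 1 -> is_derive e 1 (fun e => G e x y) (G' e x y).
Proof.
elim=> [j k th rho kK rr|c G1 G2 _ [D1 F1 H1] _ [D2 F2 H2]|G1 G2 _ [D F HC] E].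
- pose k0 e x y := kern (rescaleR rho e) th (y - x) (2^-1 *: (x + y)).
  pose k1 e x y := kern (rescaleR (euler rho) e) th (y - x) (2^-1 *: (x + y)).
  exists (fun e x y => j%:R * (e ^+ j.-1 * e^-1 ^+ k * k0 e x y) +
    (- k%:R * (e ^+ j * e^-1 ^+ k.+1 * k0 e x y) + e ^+ j * e^-1 ^+ k.+1 * k1 e x y)).
    apply: fam_lin; first by apply: fam_base => //; exact: leqW.
    apply: fam_lin; first exact: fam_base.
    by apply: fam_base => //; exact: rschwartz_euler.
  move=> e x y e01; have /andP[e0 e1] := e01; have en : e != 0 by rewrite gt_eqF.
  have d1 : is_derive e (1 : R) (fun e => e ^+ j) (j%:R * e ^+ j.-1 * 1).
    exact: (is_derive_pow j (is_derive_id e (1 : R))).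
  have d2 : is_derive e (1 : R) (fun e => e^-1 ^+ k) (k%:R * e^-1 ^+ k.-1 * - e ^- 2).
    have dV : is_derive e (1 : R) (fun e : R => e^-1) (- e ^- 2).
      have := @is_deriveV R id e 1 1 en (is_derive_id _ _).
      by rewrite [_ *: 1]mulr1.
    exact: (is_derive_pow k dV).
  have d3 := kern_rescale_deriv th (y - x) (2^-1 *: (x + y)) rr e01.
  have := is_derive_mul (is_derive_mul d1 d2) d3; congr is_derive.
  rewrite -/(k0 e x y) -/(k1 e x y) -exprVn.
  by case: k {kK d2} => [|k]; rewrite ?mul0r /= !exprS; ring.
- exists (fun e x y => c * D1 e x y + D2 e x y); first exact: fam_lin.
  by move=> e x y e01; apply: is_deriveD; [apply: is_deriveZ; exact: H1|exact: H2].
- exists D => // e x y e01; apply: near_eq_is_derive (HC e x y e01).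
  near=> t; apply: E; near: t.
  have : e \in `]0, 1[ by rewrite in_itv.
  by move=> /near_in_itvoo; apply: filterS => t; rewrite in_itv.
Unshelve. all: by end_near. Qed.

(** Multiplication by a position coordinate of the rescaled function is e
    times the rescaling of a product by that coordinate: each factor y - x
    gains a factor e. *)
Lemma fam_zmul K G i : fam K G -> exists2 G', fam K G' &
  forall e x y, 0 < e < 1 -> (y - x) 0 i * G e x y = e * G' e x y.
Proof.
elim=> [j k th rho kK rr|c G1 G2 _ [D1 F1 H1] _ [D2 F2 H2]|G1 G2 _ [D F HC] E].
- eexists; first exact: (fam_base j th kK (rschwartz_coord (iz i) rr)).
  move=> e x y /andP[e0 e1]; have en : e != 0 by rewrite gt_eqF.
  rewrite mulrCA -kern_zmulE; last exact: rschwartz_rescale.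
  under [X in kern X _]eq_fun do rewrite rescale_coord//.
  rewrite kernZ; last by apply: rschwartz_rescale => //; exact: rschwartz_coord.
  by rewrite mulrCA.
- exists (fun e x y => c * D1 e x y + D2 e x y); first exact: fam_lin.
  by move=> e x y e01; rewrite mulrDr mulrCA H1// H2//; ring.
- by exists D => // e x y e01; rewrite -E// HC.
Qed.

Lemma fam_cmul K G i : fam K G -> fam K.+1 (fun e x y => (2^-1 *: (x + y)) 0 i * G e x y).
Proof.
elim=> [j k th rho kK rr|c G1 G2 _ H1 _ H2|G1 G2 _ F E].
- have F := @fam_base K.+1 j k.+1 (th - pi / 2) _ kK (rschwartz_partial (ix i) rr).
  apply: (fam_ext (famZ ((2 * pi)^-1) F)) => e x y /andP[e0 e1].
  have en : e != 0 by rewrite gt_eqF.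
  rewrite [RHS]mulrCA kern_cmul; last exact: rschwartz_rescale.
  rewrite rescale_partial// [in RHS](kernZ _ _ _ e^-1); last first.
    by apply: rschwartz_rescale => //; exact: rschwartz_partial.
  by rewrite exprS; ring.
- apply: (fam_ext (fam_lin c H1 H2)) => e x y _; ring.
- by apply: (fam_ext F) => e x y e01; rewrite E.
Qed.

Lemma fam_dmul K G i : fam K G -> fam K.+1 (fun e x y => (y - x) 0 i * G e x y).
Proof.
elim=> [j k th rho kK rr|c G1 G2 _ H1 _ H2|G1 G2 _ F E].
- have F := @fam_base K.+1 j.+1 k th _ (leqW kK) (rschwartz_coord (iz i) rr).
  apply: (fam_ext F) => e x y /andP[e0 e1]; have en : e != 0 by rewrite gt_eqF.
  rewrite [RHS]mulrCA -kern_zmulE; last exact: rschwartz_rescale.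
  under [X in _ = _ * kern X _ _ _]eq_fun do rewrite rescale_coord//.
  rewrite kernZ; last by apply: rschwartz_rescale => //; exact: rschwartz_coord.
  by rewrite exprS; ring.
- apply: (fam_ext (fam_lin c H1 H2)) => e x y _; ring.
- by apply: (fam_ext F) => e x y e01; rewrite E.
Qed.

Lemma fam_mulx K G i : fam K G -> fam K.+1 (fun e x y => x 0 i * G e x y).
Proof.
move=> fG; apply: (fam_ext (fam_lin (- 2^-1) (fam_dmul i fG) (fam_cmul i fG))) => e x y _.
by rewrite !mxE; field.
Qed.

Lemma fam_muly K G i : fam K G -> fam K.+1 (fun e x y => y 0 i * G e x y).
Proof.
move=> fG; apply: (fam_ext (fam_lin (2^-1) (fam_dmul i fG) (fam_cmul i fG))) => e x y _.
by rewrite !mxE; field.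
Qed.

Lemma fam_zmuln K G i M : fam K G -> exists2 G', fam K G' &
  forall e x y, 0 < e < 1 -> ((y - x) 0 i) ^+ M * G e x y = e ^+ M * G' e x y.
Proof.
move=> fG; elim: M => [|M [D fD HD]]; first by exists G => // e x y _; rewrite !mul1r.
have [D' fD' HD'] := fam_zmul i fD; exists D' => // e x y e01.
by rewrite exprS -mulrA HD// mulrCA HD'// exprSr mulrA.
Qed.

(** With [fam_zmul] used often enough to beat the growth e^-(K+N): the member
    times (y - x)_i^L is O(e^L) times a member, and |(y - x)_i| >= d. *)
Lemma fam_offdiag K G M (d : R) : fam K G -> 0 < d -> exists2 C, 0 <= C &
  forall e x y i, 0 < e < 1 -> d <= `|(y - x) 0 i| -> `|G e x y| <= C * e ^+ M.
Proof.
move=> fG d0; pose L := (M + (K + N))%N.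
have Q i : exists C, 0 <= C /\ forall e x y, 0 < e < 1 -> d <= `|(y - x) 0 i| ->
    `|G e x y| <= C * e ^+ M.
  have [D fD HD] := fam_zmuln i L fG; have [C C0 HC] := fam_bound fD.
  exists (d^-1 ^+ L * C); split; first by rewrite mulr_ge0// exprn_ge0// invr_ge0 ltW.
  move=> e x y e01 dy; have /andP[e0 e1] := e01.
  have h : `|((y - x) 0 i) ^+ L * G e x y| <= C * e ^+ M.
    have eL : 0 <= e ^+ L by rewrite exprn_ge0// ltW.
    rewrite HD// normrM ger0_norm//; apply: (le_trans (ler_wpM2l eL (HC e x y e01))).
    rewrite mulrCA exprVn /L exprD -mulrA divff ?mulr1 ?mulrA//.
    by rewrite expf_neq0// gt_eqF.
  have dL : 0 < d ^+ L by rewrite exprn_gt0.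
  rewrite exprVn -mulrA mulrC ler_pdivlMr// mulrC (le_trans _ h)// normrM ler_wpM2r//.
  by rewrite normrX; apply: lerXn2r => //; rewrite nnegrE; exact: ltW.
have [C HC] := choice Q.
exists (\sum_i C i) => [|e x y i e01 dy]; first by apply: sumr_ge0 => i _; have [] := HC i.
have [C0 H1] := HC i; rewrite (le_trans (H1 e x y e01 dy))// ler_wpM2r//.
  by rewrite exprn_ge0//; case/andP: e01 => /ltW.
by rewrite (bigD1 i)//= lerDl sumr_ge0// => j _; have [] := HC j.
Qed.

End fam.

(** * Nets with derivatives of polynomial growth in the parameter *)

Section nets.
Variables (R : realType) (m : nat).
Local Notation V := 'rV[R]_m.
Local Notation e_ i := (delta_mx 0 i : V).
Implicit Types (g : R -> V -> R) (x : V) (e : R).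

(** Like [smooth_class], for nets: [rnet] is the largest set of nets that are
    O(e^-k) for some k, uniformly in x, and stable under the derivatives in x
    and in e. Its members give moderate nets ([cnet_moderate]). *)
Definition net_class (C : set (R -> V -> R)) := forall g, C g ->
  [/\ exists B k, forall e x, 0 < e < 1 -> `|g e x| <= B * e^-1 ^+ k,
      forall i, exists g', C g' /\ forall e x, 0 < e < 1 -> is_derive x (e_ i) (g e) (g' e x) &
      exists g', C g' /\ forall e x, 0 < e < 1 -> is_derive e 1 (g ^~ x) (g' e x)].

Definition rnet g := exists C, net_class C /\ C g.

Lemma rnet_is_class : net_class rnet.
Proof.
move=> g [C [nC Cg]]; have [b dx de] := nC _ Cg; split => //.
  by move=> i; have [g' [Cg' dg]] := dx i; exists g'; split => //; exists C.
by have [g' [Cg' dg]] := de; exists g'; split => //; exists C.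
Qed.

Lemma near01 e : 0 < e < 1 -> \forall t \near e, 0 < t < 1.
Proof.
move=> e01; have : e \in `]0, 1[ by rewrite in_itv.
by move=> /near_in_itvoo; apply: filterS => t; rewrite in_itv.
Qed.

Lemma rnet_ext g g' : (forall e x, 0 < e < 1 -> g e x = g' e x) -> rnet g -> rnet g'.
Proof.
move=> E rg; exists [set h | exists2 f, rnet f & forall e x, 0 < e < 1 -> f e x = h e x].
split; last by exists g.
move=> h [f rf fh]; have [[B [k b]] dx [f' [rf' de]]] := rnet_is_class rf; split.
- by exists B, k => e x e01; rewrite -fh// b.
- move=> i; have [f1 [r1 d1]] := dx i; exists f1; split; first by exists f1.
  by move=> e x e01; have := d1 e x e01; congr is_derive; apply/funext => y; exact: fh.
- exists f'; split; first by exists f'.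
  move=> e x e01; apply: near_eq_is_derive (de e x e01).
  by apply: filterS (near01 e01) => t t01; exact: fh.
Qed.

Lemma rnet_lin c f g : rnet f -> rnet g -> rnet (fun e x => c * f e x + g e x).
Proof.
move=> rf rg; exists [set h | exists f g, [/\ rnet f, rnet g & h = fun e x => c * f e x + g e x]].
split; last by exists f, g.
move=> _ [{rf}f [{rg}g [rf rg ->]]].
have [[B [k b]] dx [f' [rf' de]]] := rnet_is_class rf.
have [[B' [k' b']] dx' [g' [rg' de']]] := rnet_is_class rg; split.
- exists (`|c| * `|B| + `|B'|), (maxn k k') => e x e01.
  have /andP[e0 e1] := e01; have ie1 : 1 <= e^-1 by rewrite invf_ge1// ltW.
  have ie0 : 0 <= e^-1 by rewrite invr_ge0 ltW.
  rewrite mulrDl; apply: (le_trans (ler_normD _ _)); apply: lerD.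
    rewrite normrM -mulrA; apply: ler_wpM2l => //; apply: (le_trans (b e x e01)).
    apply: (@le_trans _ _ (`|B| * e^-1 ^+ k)); first by rewrite ler_wpM2r ?ler_norm// exprn_ge0.
    by rewrite ler_wpM2l// ler_weXn2l// leq_maxl.
  apply: (le_trans (b' e x e01)).
  apply: (@le_trans _ _ (`|B'| * e^-1 ^+ k')); first by rewrite ler_wpM2r ?ler_norm// exprn_ge0.
  by rewrite ler_wpM2l// ler_weXn2l// leq_maxr.
- move=> i; have [f1 [r1 d1]] := dx i; have [f2 [r2 d2]] := dx' i.
  exists (fun e x => c * f1 e x + f2 e x); split; first by exists f1, f2.
  by move=> e x e01; apply: is_deriveD; [apply: is_deriveZ; exact: d1|exact: d2].
- exists (fun e x => c * f' e x + g' e x); split; first by exists f', g'.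
  by move=> e x e01; apply: is_deriveD; [apply: is_deriveZ; exact: de|exact: de'].
Qed.

Definition epartial g : R -> V -> R := fun e x => 'D_1 (g ^~ x) e.

Lemma rnet_epartial g : rnet g -> rnet (epartial g).
Proof.
move=> rg; have [_ _ [g' [rg' de]]] := rnet_is_class rg.
by apply: rnet_ext rg' => e x e01; have [_ <-] := de e x e01.
Qed.

Lemma rnet_is_epartial g e x : rnet g -> 0 < e < 1 -> is_derive e 1 (g ^~ x) (epartial g e x).
Proof.
move=> rg e01; have [_ _ [g' [rg' de]]] := rnet_is_class rg.
by have [d _] := de e x e01; apply: derivableP.
Qed.

Lemma rnet_partial g i : rnet g -> rnet (fun e => ipartial [:: i] (g e)).
Proof.
move=> rg; have [_ dx _] := rnet_is_class rg; have [g' [rg' d]] := dx i.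
by apply: rnet_ext rg' => e x e01; rewrite (ipartial_eq (fun x => d e x e01)).
Qed.

Lemma rnet_has_partials g e : rnet g -> 0 < e < 1 ->
  has_partials (g e) (fun i => ipartial [:: i] (g e)).
Proof.
move=> rg e01 i x; have [_ dx _] := rnet_is_class rg; have [g' [rg' d]] := dx i.
by rewrite (ipartial_eq (fun x => d e x e01)); exact: d.
Qed.

Lemma rnet_ipartial g s : rnet g -> rnet (fun e => ipartial s (g e)).
Proof.
by move=> rg; elim: s => [//|i s IH]; exact: (rnet_partial i IH).
Qed.

Lemma rnet_bound g : rnet g -> exists B k, 0 <= B /\
  forall e x, 0 < e < 1 -> `|g e x| <= B * e^-1 ^+ k.
Proof.
case/rnet_is_class => -[B [k b]] _ _; exists `|B|, k; split => // e x e01.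
apply: (le_trans (b e x e01)); rewrite ler_wpM2r ?ler_norm// exprn_ge0// invr_ge0.
by case/andP: e01 => /ltW.
Qed.

(** There are finitely many sequences of length at most k, so one constant and
    one exponent serve for all. *)
Lemma rnet_bound_le g k : rnet g -> exists B K, 0 <= B /\
  forall s e x, (size s <= k)%N -> 0 < e < 1 -> `|ipartial s (g e) x| <= B * e^-1 ^+ K.
Proof.
elim: k g => [|k IH] g rg.
  have [B [K [B0 b]]] := rnet_bound rg; exists B, K; split => // s e x.
  by case: s => //= _; exact: b.
have [B [K [B0 b]]] := rnet_bound rg.
have /choice[BK HBK] i : exists BK : R * nat, 0 <= BK.1 /\
    forall s e x, (size s <= k)%N -> 0 < e < 1 ->
      `|ipartial s (ipartial [:: i] (g e)) x| <= BK.1 * e^-1 ^+ BK.2.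
  by have [B' [K' h]] := IH _ (rnet_partial i rg); exists (B', K').
exists (B + \sum_i (BK i).1), (maxn K (\max_i (BK i).2)); split.
  by rewrite addr_ge0// sumr_ge0// => i _; case: (HBK i).
move=> s e x sk e01; have /andP[e0 e1] := e01.
have ie1 : 1 <= e^-1 by rewrite invf_ge1// ltW.
have ie0 : 0 <= e^-1 by rewrite invr_ge0 ltW.
have S0 : 0 <= \sum_i (BK i).1 by rewrite sumr_ge0// => i _; case: (HBK i).
case/lastP: s sk => [_|s i].
  apply: (le_trans (b e x e01)); apply: ler_pM => //; [by rewrite exprn_ge0|by rewrite lerDl|].
  by rewrite ler_weXn2l// leq_maxl.
rewrite size_rcons ltnS -cats1 ipartial_cat => sk; have [Bi0 Hi] := HBK i.
apply: (le_trans (Hi s e x sk e01)); apply: ler_pM => //; first by rewrite exprn_ge0.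
  by rewrite (bigD1 i)//= addrCA lerDl addr_ge0// sumr_ge0// => j _; case: (HBK j).
by rewrite ler_weXn2l// leq_max (@leq_bigmax_cond _ xpredT (fun i => (BK i).2) i)// orbT.
Qed.

Lemma rnet_smooth g e : rnet g -> 0 < e < 1 -> smooth_real setT (g e).
Proof.
move=> rg e01; apply: (@smooth_classP _ _ [set f | exists2 g, rnet g & f = g e]); last by exists g.
move=> _ [{rg}g rg ->]; split.
  have [B [K [B0 b]]] := rnet_bound_le 1 rg.
  apply: (continuous_partials (rnet_has_partials rg e01) (B := B * e^-1 ^+ K)) => i y.
  exact: b.
move=> i; exists (ipartial [:: i] (g e)); split; last exact: rnet_has_partials.
by exists (fun e => ipartial [:: i] (g e)) => //; exact: rnet_partial.
Qed.

(** Near a parameter in (0,1) the derivative in e is bounded uniformly in x,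
    so g is Lipschitz in e there with one constant, and continuity in x is
    enough. *)
Lemma rnet_jcont g (w : R * V) : rnet g -> 0 < w.1 < 1 ->
  {for w, continuous (fun w : R * V => g w.1 w.2)}.
Proof.
move=> rg; case: w => e x /= e01; apply/(@continuous_epsP R (R * V)%type) => d d0 /=.
have /andP[e0 e1] := e01.
have [B [K [B0 b]]] := rnet_bound (rnet_epartial rg).
have cgx := smooth_continuous (rnet_smooth rg e01).
have /(@continuous_epsP R V)/(_ (d / 2)) [|d1 d10 d1P] := cgx x; first by rewrite divr_gt0.
pose r := Num.min (e / 2) (1 - e).
have r0 : 0 < r by rewrite lt_min divr_gt0//= subr_gt0.
have tr t : `|t - e| < r -> e / 2 < t < 1.
  by rewrite lt_min !ltr_norml => /andP[/andP[? ?] /andP[? ?]]; apply/andP; split; lra.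
clearbody r; pose L := B * (e / 2)^-1 ^+ K.
have e2 : 0 < e / 2 by rewrite divr_gt0.
have L0 : 0 <= L by rewrite mulr_ge0// exprn_ge0// invr_ge0 ltW.
have Lb t y : `|t - e| < r -> `|epartial g t y| <= L.
  move=> /tr /andP[t0 t1]; apply: (le_trans (b t y _)).
    by rewrite t1 (lt_trans _ t0).
  rewrite ler_wpM2l// lerXn2r// ?nnegrE ?invr_ge0 ?(ltW e2) ?(ltW (lt_trans e2 t0))//.
  by rewrite lef_pV2 ?posrE// ?ltW// (lt_trans e2).
exists (Num.min d1 (Num.min r (d / 2 / (L + 1)))).
  by rewrite !lt_min d10 r0 !divr_gt0// ltr_wpDl.
move=> [t y]; rewrite /= prod_normE /= gt_max !lt_min.
move=> /andP[/andP[_ /andP[tr1 td]] /andP[yd _]].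
have tm (s : R) : `|s| <= `|t - e| -> 0 < s + e < 1 /\ `|s + e - e| < r.
  move=> st; have se : `|s + e - e| < r by rewrite addrK (le_lt_trans st).
  by split => //; have /andP[h1 h2] := tr _ se; rewrite h2 (lt_trans _ h1).
have [s' hs|s [sh E]] := @MVT1 R (fun s => g (s + e) y) (fun s => epartial g (s + e) y) (t - e).
  have [s01 _] := tm _ hs.
  rewrite -[epartial _ _ _]mulr1; apply: (is_derive1_comp (f := g ^~ y)).
    exact: rnet_is_epartial.
  by have := is_deriveD (is_derive_id s' (1 : R)) (@is_derive_cst R R R e s' 1); rewrite addr0.
have -> : g t y - g e x = (g (t - e + e) y - g (0 + e) y) + (g e y - g e x).
  by rewrite subrK add0r addrA subrK.
rewrite (splitr d); apply: (le_trans (ler_normD _ _)); apply: lerD; last exact: d1P.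
rewrite E normrM; have [_ hs] := tm _ sh.
apply: (@le_trans _ _ (`|t - e| * (L + 1))).
  by rewrite ler_wpM2l// (le_trans (Lb _ _ hs))// lerDl.
by rewrite -ler_pdivlMr ?ltW// ltr_wpDl.
Qed.

(** Clairaut's theorem on the product of the parameter line and the space. *)
Lemma rnet_commute1 g i e x : rnet g -> 0 < e < 1 ->
  epartial (fun e => ipartial [:: i] (g e)) e x = ipartial [:: i] (epartial g e) x.
Proof.
move=> rg e01.
pose lift (f : R -> V -> R) := fun w : R * V => f w.1 w.2.
pose r := Num.min e (1 - e).
have /andP[e0 e1] := e01.
have r0 : 0 < r by rewrite lt_min e0 subr_gt0.
have wr (w : R * V) : `|w - (e, x)| < r -> 0 < w.1 < 1.
  rewrite prod_normE /= gt_max => /andP[+ _].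
  by rewrite lt_min !ltr_norml => /andP[/andP[? ?] /andP[? ?]]; apply/andP; split; lra.
have dE f (w : R * V) : rnet f -> 0 < w.1 < 1 ->
    is_derive w ((1, 0) : R * V) (lift f) (lift (epartial f) w).
  move=> rf w01; apply/is_derive_lineG0.
  have h : is_derive (0 : R) 1 (fun h => f (h *: (1 : R) + w.1) w.2) (epartial f w.1 w.2).
    exact: ((@is_derive_lineG0 R R (f ^~ w.2) w.1 1 _).1 (rnet_is_epartial w.2 rf w01)).
  move: h; congr is_derive; apply/funext => h; rewrite /lift /=.
  by congr f; rewrite scaler0 add0r.
have dX f (w : R * V) : rnet f -> 0 < w.1 < 1 ->
    is_derive w ((0, e_ i) : R * V) (lift f) (lift (fun e => ipartial [:: i] (f e)) w).
  move=> rf w01; apply/is_derive_lineG0.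
  have /is_derive_line0 := rnet_has_partials rf w01 i w.2.
  congr is_derive; apply/funext => h; rewrite /lift /=.
  by congr f; rewrite scaler0 add0r.
have rp := rnet_partial i rg; have re := rnet_epartial rg.
apply: (@clairaut R (R * V)%type (lift g) (lift (fun e => ipartial [:: i] (g e)))
  (lift (epartial g)) (lift (epartial (fun e => ipartial [:: i] (g e))))
  (lift (fun e => ipartial [:: i] (epartial g e))) (e, x) (0, e_ i) (1, 0) r r0).
- by move=> y /wr; exact: dX.
- by move=> y /wr; exact: dE.
- by move=> y /wr; exact: dE.
- by move=> y /wr; exact: dX.
- by apply: rnet_jcont => //; exact: rnet_epartial.
- by apply: (@rnet_jcont (fun e => ipartial [:: i] (epartial g e))) => //; exact: rnet_partial.
Qed.

Lemma rnet_commute g s e x : rnet g -> 0 < e < 1 ->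
  epartial (fun e => ipartial s (g e)) e x = ipartial s (epartial g e) x.
Proof.
move=> rg; elim: s e x => [//|i s IH] e x e01.
rewrite (@rnet_commute1 (fun e => ipartial s (g e)))//; last exact: rnet_ipartial.
by apply: (@ipartial_eq_on _ _ setT [:: i]) => //; [exact: openT|move=> y _; exact: IH].
Qed.

Lemma rnet_ipartial_derive g s e x : rnet g -> 0 < e < 1 ->
  is_derive e 1 (fun e => ipartial s (g e) x) (ipartial s (epartial g e) x).
Proof.
move=> rg e01; rewrite -rnet_commute//; apply: (@rnet_is_epartial (fun e => ipartial s (g e))) => //.
exact: rnet_ipartial.
Qed.

End nets.

(** * Functionals acting on families of smooth functions *)

Section slices.
Variables (R : realType) (p m : nat).
Implicit Types (F : 'rV[R]_(p + m) -> R) (x : 'rV[R]_p) (y : 'rV[R]_m).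

Lemma row_mx_shiftr (h : R) x y i :
  row_mx x (h *: delta_mx 0 i + y) = h *: delta_mx 0 (rshift p i) + row_mx x y.
Proof.
apply/rowP => j; rewrite !mxE; case: splitP => k jk; rewrite ?mxE.
  rewrite (_ : j == rshift p i = false) ?andbF ?mulr0 ?add0r//.
  by rewrite -val_eqE /= jk; have := ltn_ord k; lia.
by congr (_ * (_ && _)%:R + _); rewrite -!val_eqE /= jk; lia.
Qed.

Lemma row_mx_shiftl (h : R) x y i :
  row_mx (h *: delta_mx 0 i + x) y = h *: delta_mx 0 (lshift m i) + row_mx x y.
Proof.
apply/rowP => j; rewrite !mxE; case: splitP => k jk; rewrite ?mxE.
  by congr (_ * (_ && _)%:R + _); rewrite -!val_eqE /= jk.
rewrite (_ : j == lshift m i = false) ?andbF ?mulr0 ?add0r//.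
by rewrite -val_eqE /= jk; have := ltn_ord i; lia.
Qed.

Lemma norm_row_mx x x' y y' :
  `|row_mx x y - row_mx x' y'| <= Num.max `|x - x'| `|y - y'|.
Proof.
rewrite opp_row_mx add_row_mx [leLHS]/Num.norm/= mx_normrE.
apply: bigmax_le => [|[a j] _ /=]; first by rewrite le_max normr_ge0.
rewrite ord1 mxE; case: splitP => k _; rewrite le_max; apply/orP; [left|right].
  by rewrite [leRHS]/Num.norm/= mx_normrE (bigmax_sup (0, k)).
by rewrite [leRHS]/Num.norm/= mx_normrE (bigmax_sup (0, k)).
Qed.

Lemma slice_continuous F x : continuous F -> continuous (fun y => F (row_mx x y)).
Proof.
move=> cF y; apply/(@continuous_epsP R 'rV[R]_m) => e e0.
have /(@continuous_epsP R 'rV[R]_(p + m))/(_ e e0)[d d0 dP] := cF (row_mx x y).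
exists d => // y' yy'; apply: dP; apply: (le_lt_trans (norm_row_mx _ _ _ _)).
by rewrite subrr normr0 gt_max d0.
Qed.

Lemma slice_partial F x : smooth_real setT F ->
  has_partials (fun y => F (row_mx x y)) (fun i y => ipartial [:: rshift p i] F (row_mx x y)).
Proof.
move=> sF i y; apply/is_derive_line0.
under eq_fun do rewrite row_mx_shiftr.
by apply/is_derive_line0; exact: smooth_has_partials.
Qed.

Lemma slice_class x :
  smooth_class [set f : 'rV[R]_m -> R | exists2 F, smooth_real setT F & f = fun y => F (row_mx x y)].
Proof.
move=> _ [F sF ->]; split; first by apply: slice_continuous; exact: smooth_continuous.
move=> i; exists (fun y => ipartial [:: rshift p i] F (row_mx x y)); split.
  by exists (ipartial [:: rshift p i] F) => //; exact: smooth_ipartial.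
by move=> y; exact: slice_partial.
Qed.

Lemma slice_smooth F x : smooth_real setT F -> smooth_real setT (fun y => F (row_mx x y)).
Proof. by move=> sF; apply: (smooth_classP (@slice_class x)); exists F. Qed.

Lemma slice_ipartial F x s : smooth_real setT F ->
  ipartial s (fun y => F (row_mx x y)) = fun y => ipartial (map (@rshift p m) s) F (row_mx x y).
Proof.
move=> sF; elim: s => [//|i s IH].
rewrite -(cat1s i) ipartial_cat IH; apply: ipartial_eq => y.
by apply: slice_partial => //; exact: smooth_ipartial.
Qed.

End slices.

Section functionals.
Variables (R : realType).

(** A real linear form on smooth functions, continuous for the seminorm of
    order k on A; the real and imaginary parts of a compactly supported
    distribution are of this kind ([dist_functional]). *)
Record functional m (v : ('rV[R]_m -> R) -> R) (A : set 'rV[R]_m) (k : nat) (c : R) : Prop :=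
  Functional {
    functional_c : 0 <= c;
    functional_lin : forall a f g, smooth_real setT f -> smooth_real setT g ->
      v (fun x => a * f x + g x) = a * v f + v g;
    functional_le : forall f B, smooth_real setT f -> 0 <= B ->
      (forall s y, A y -> (size s <= k)%N -> `|ipartial s f y| <= B) -> `|v f| <= c * B }.

(** A quadratic bound for the first order Taylor remainder gives the
    derivative. *)
Lemma is_derive_quad (f : R -> R) (t d M r : R) : 0 < r ->
  (forall h, `|h| < r -> `|f (h + t) - f t - h * d| <= M * `|h| ^+ 2) -> is_derive t 1 f d.
Proof.
move=> r0 fM.
have key : (fun h : R => h^-1 *: ((f \o shift t) (h *: (1 : R)) - f t)) @ 0^' --> d.
  apply/cvgrPdist_le => e e0; near=> h.
  have h0 : h != 0 by near: h; exact: nbhs_dnbhs_neq.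
  have hr : `|h| < r by near: h; apply: dnbhs0_lt.
  have hp : 0 < `|h| by rewrite normr_gt0.
  rewrite /= [h *: 1]mulr1 distrC.
  have -> : h^-1 *: (f (h + t) - f t) - d = h^-1 * (f (h + t) - f t - h * d).
    by rewrite /GRing.scale/=; field.
  rewrite normrM normfV ler_pdivrMl//; apply: (le_trans (fM h hr)).
  rewrite expr2 mulrCA ler_wpM2l//.
  apply: (@le_trans _ _ ((`|M| + 1) * `|h|)).
    by rewrite ler_wpM2r// (le_trans (ler_norm _))// lerDl.
  rewrite -ler_pdivlMl; last by rewrite ltr_wpDl.
  rewrite mulrC; near: h; apply: dnbhs0_le; rewrite divr_gt0// ltr_wpDl//.
split; first by apply/cvg_ex; eexists; exact: key.
exact/cvg_lim.
Unshelve. all: by end_near. Qed.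

Section curve.
Variables (m : nat) (g g' g'' : R -> 'rV[R]_m -> R) (t r B : R) (k : nat).
Hypotheses (r0 : 0 < r).
Hypothesis (sg : forall s, `|s - t| < r -> smooth_real setT (g s)).
Hypothesis (sg' : forall s, `|s - t| < r -> smooth_real setT (g' s)).
Hypothesis (dg : forall s l y, `|s - t| < r ->
  is_derive s 1 (fun s => ipartial l (g s) y) (ipartial l (g' s) y)).
Hypothesis (dg' : forall s l y, `|s - t| < r ->
  is_derive s 1 (fun s => ipartial l (g' s) y) (ipartial l (g'' s) y)).
Hypothesis (bg'' : forall s l y, `|s - t| < r -> (size l <= k)%N -> `|ipartial l (g'' s) y| <= B).

Definition remainder (h : R) : 'rV[R]_m -> R :=
  fun y => - h * g' t y + (-1 * g t y + g (h + t) y).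

Lemma remainder_smooth h : `|h| < r -> smooth_real setT (remainder h).
Proof.
move=> hr; have tt : `|t - t| < r by rewrite subrr normr0.
have ht : `|h + t - t| < r by rewrite addrK.
apply: smooth_lin; [exact: openT|exact: sg'|].
by apply: smooth_lin; [exact: openT|exact: sg|exact: sg].
Qed.

Lemma remainder_le h l y : `|h| < r -> (size l <= k)%N ->
  `|ipartial l (remainder h) y| <= B * `|h| ^+ 2.
Proof.
move=> hr lk; have tt : `|t - t| < r by rewrite subrr normr0.
have ht : `|h + t - t| < r by rewrite addrK.
rewrite /remainder (@ipartial_lin _ _ setT); [|exact: openT|exact: sg'| |by []]; last first.
  by apply: smooth_lin; [exact: openT|exact: sg|exact: sg].
rewrite (@ipartial_lin _ _ setT); [|exact: openT|exact: sg|exact: sg|by []].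
have -> : - h * ipartial l (g' t) y + (-1 * ipartial l (g t) y + ipartial l (g (h + t)) y) =
  ipartial l (g (h + t)) y - ipartial l (g t) y - h * ipartial l (g' t) y by ring.
apply: (@taylor1 R (fun s => ipartial l (g s) y) (fun s => ipartial l (g' s) y)
  (fun s => ipartial l (g'' s) y)) => s sh.
- by apply: dg; exact: le_lt_trans hr.
- by apply: dg'; exact: le_lt_trans hr.
- by apply: bg'' => //; exact: le_lt_trans hr.
Qed.

(** The Taylor remainder of the curve s |-> g s, divided by h, tends to 0 in
    the seminorm that controls v, because the second derivative is bounded
    there. So v may be applied to the difference quotient. *)
Lemma functional_derive v A c : functional v A k c ->
  is_derive t 1 (fun s => v (g s)) (v (g' t)).
Proof.
case=> c0 vlin vle; have tt : `|t - t| < r by rewrite subrr normr0.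
have B0 : 0 <= B by apply: le_trans (bg'' (l := [::]) 0 tt (leq0n k)).
apply: (@is_derive_quad _ _ _ (c * B) r r0) => h hr.
have ht : `|h + t - t| < r by rewrite addrK.
have <- : v (remainder h) = v (g (h + t)) - v (g t) - h * v (g' t).
  rewrite /remainder vlin; [|exact: sg'|]; last first.
    by apply: smooth_lin; [exact: openT|exact: sg|exact: sg].
  rewrite vlin; [|exact: sg|exact: sg]; ring.
rewrite -mulrA; apply: vle; [exact: remainder_smooth|by rewrite mulr_ge0// exprn_ge0|].
by move=> s y _ sk; exact: remainder_le.
Qed.

End curve.

Lemma near01_ball (e : R) : 0 < e < 1 ->
  exists2 r, 0 < r & forall t, `|t - e| < r -> e / 2 < t < 1.
Proof.
move=> /andP[e0 e1]; exists (Num.min (e / 2) (1 - e)).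
  by rewrite lt_min divr_gt0//= subr_gt0.
move=> t; rewrite lt_min !ltr_norml => /andP[/andP[? ?] /andP[? ?]].
by apply/andP; split; lra.
Qed.

Lemma rnet_local_bound m (g : R -> 'rV[R]_m -> R) k (e : R) : rnet g -> 0 < e < 1 ->
  exists B r, [/\ 0 < r, (forall t, `|t - e| < r -> 0 < t < 1) &
   forall t s x, `|t - e| < r -> (size s <= k)%N -> `|ipartial s (g t) x| <= B].
Proof.
move=> rg e01; have /andP[e0 e1] := e01; have e2 : 0 < e / 2 by rewrite divr_gt0.
have [r r0 tr] := near01_ball e01; have [B [K [B0 b]]] := rnet_bound_le k rg.
exists (B * (e / 2)^-1 ^+ K), r; split => //.
  by move=> t /tr /andP[h ->]; rewrite (lt_trans _ h).
move=> t s x /tr /andP[t0 t1] sk; apply: (le_trans (b s t x sk _)).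
  by rewrite t1 (lt_trans _ t0).
rewrite ler_wpM2l// lerXn2r// ?nnegrE ?invr_ge0 ?(ltW e2) ?(ltW (lt_trans e2 t0))//.
by rewrite lef_pV2 ?posrE// ?ltW// (lt_trans e2).
Qed.

(** The derivatives in y commute with the derivative in x, which makes x |->
    g(x, .) along the i-th axis a curve as in [functional_derive]. *)
Lemma functional_slice_derive p m (g : R -> 'rV[R]_(p + m) -> R) v A k c i e (x : 'rV[R]_p) :
  functional v A k c -> rnet g -> 0 < e < 1 ->
  is_derive x (delta_mx 0 i) (fun x => v (fun y => g e (row_mx x y)))
    (v (fun y => ipartial [:: lshift m i] (g e) (row_mx x y))).
Proof.
move=> fv rg e01; pose li := lshift m i; apply/is_derive_line0.
(* two derivatives in x, on top of the k derivatives in y that v sees *)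
have [B [K [B0 b]]] := rnet_bound_le (k + 2) rg.
have sm s : smooth_real setT (ipartial s (g e)) by apply: smooth_ipartial; exact: rnet_smooth.
pose ga (l : seq 'I_(p + m)) (t : R) (y : 'rV[R]_m) :=
  ipartial l (g e) (row_mx (t *: delta_mx 0 i + x) y).
have dga l (t : R) s y : is_derive t 1 (fun t => ipartial s (ga l t) y) (ipartial s (ga (li :: l) t) y).
  have E l' t' : ipartial s (ga l' t') y =
      ipartial (map (@rshift p m) s ++ l') (g e) (t' *: delta_mx 0 li + row_mx x y).
    by rewrite /ga slice_ipartial// -ipartial_cat row_mx_shiftl.
  under eq_fun do rewrite E.
  rewrite E (@ipartial_perm _ _ (map (@rshift p m) s ++ li :: l) (li :: map (@rshift p m) s ++ l)); first last.
  + by rewrite perm_sym -(cat1s li) -(cat1s li l) perm_catCA perm_refl.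
  + exact: rnet_smooth.
  by apply/is_derive_line; exact: smooth_has_partials.
have D := @functional_derive m (ga [::]) (ga [:: li]) (ga [:: li; li]) 0 1 (B * e^-1 ^+ K) k ltr01
  _ _ _ _ _ v A c fv.
rewrite /ga scale0r add0r in D; apply: D.
+ by move=> t _; apply: slice_smooth; exact: (sm [::]).
+ by move=> t _; apply: slice_smooth; exact: (sm [:: li]).
+ move=> t s y _ sk; rewrite slice_ipartial; last exact: (sm [:: li; li]).
  by rewrite -ipartial_cat; apply: b => //; rewrite size_cat size_map leq_add2r.
Qed.

(** Derivatives of the new net are obtained from derivatives of g, so these
    nets form a class; the bound on v turns bounds of g into bounds of the
    net. *)
Lemma rnet_functional p m (g : R -> 'rV[R]_(p + m) -> R) v A k c :
  functional v A k c -> rnet g -> rnet (fun e (x : 'rV[R]_p) => v (fun y => g e (row_mx x y))).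
Proof.
move=> fv rg; pose C : set (R -> 'rV[R]_p -> R) := [set f | exists2 g, rnet g &
   f = fun e x => v (fun y => g e (row_mx x y))].
exists C; split; last by exists g.
move=> _ [{rg}g rg ->]; split.
- have [B [K [B0 b]]] := rnet_bound_le k rg; exists (c * B), K => e x e01.
  have [c0 _ vle] := fv; have e0 : 0 <= e^-1 by rewrite invr_ge0; case/andP: e01 => /ltW.
  rewrite -mulrA; apply: vle; first by apply: slice_smooth; exact: rnet_smooth.
    by rewrite mulr_ge0// exprn_ge0.
  move=> s y _ sk; rewrite slice_ipartial; last exact: rnet_smooth.
  by apply: b => //; rewrite size_map.
- move=> i; pose li := lshift m i.
  exists (fun e x => v (fun y => ipartial [:: li] (g e) (row_mx x y))); split.
    by exists (fun e => ipartial [:: li] (g e)) => //; exact: rnet_partial.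
  by move=> e x e01; exact: (functional_slice_derive i x fv rg e01).
- exists (fun e x => v (fun y => epartial g e (row_mx x y))); split.
    by exists (epartial g) => //; exact: rnet_epartial.
  move=> e x e01; have re := rnet_epartial rg; have ree := rnet_epartial re.
  have [B [r [r0 r01 b]]] := rnet_local_bound k ree e01.
  have E (f : R -> 'rV[R]_(p + m) -> R) s y (t : R) : rnet f -> 0 < t < 1 ->
      is_derive t 1 (fun t => ipartial s (fun y => f t (row_mx x y)) y)
       (ipartial s (fun y => epartial f t (row_mx x y)) y).
    move=> rf t01.
    apply: (@near_eq_is_derive _ _ _ (fun t => ipartial (map (@rshift p m) s) (f t) (row_mx x y))).
      by apply: filterS (near01 t01) => t' t'01; rewrite slice_ipartial//; exact: rnet_smooth.
    rewrite slice_ipartial; last by apply: rnet_smooth => //; exact: rnet_epartial.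
    exact: rnet_ipartial_derive.
  apply: (@functional_derive m (fun e y => g e (row_mx x y)) (fun e y => epartial g e (row_mx x y))
    (fun e y => epartial (epartial g) e (row_mx x y)) e r B k r0 _ _ _ _ _ v A c fv).
  + by move=> t /r01 t01; apply: slice_smooth; exact: rnet_smooth.
  + by move=> t /r01 t01; apply: slice_smooth; exact: rnet_smooth.
  + by move=> t l y /r01; exact: E.
  + by move=> t l y /r01; exact: E.
  + move=> t l y tr lk; rewrite slice_ipartial; last by apply: rnet_smooth => //; exact: r01.
    by apply: b => //; rewrite size_map.
Qed.

End functionals.

(** * Complex-valued functions, seminorms and nets *)

Section complex_facts.
Variable R : realType.
Implicit Types (a b : R) (z w : R[i]).

Lemma normc_le a b : normc (a +i* b) <= `|a| + `|b|.
Proof.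
rewrite /Normc.normc -(ler_pXn2r (n := 2)) ?nnegrE ?sqrtr_ge0 ?addr_ge0//.
rewrite sqr_sqrtr ?addr_ge0 ?sqr_ge0// sqrrD !real_normK ?num_real//.
by rewrite addrAC lerDl mulrn_wge0// mulr_ge0.
Qed.

Lemma Re_le_normc z : `|complex.Re z| <= normc z.
Proof.
case: z => a b; rewrite /Normc.normc /= -(ler_pXn2r (n := 2)) ?nnegrE ?sqrtr_ge0//.
by rewrite sqr_sqrtr ?addr_ge0 ?sqr_ge0// real_normK ?num_real// lerDl sqr_ge0.
Qed.

Lemma Im_le_normc z : `|complex.Im z| <= normc z.
Proof.
case: z => a b; rewrite /Normc.normc /= -(ler_pXn2r (n := 2)) ?nnegrE ?sqrtr_ge0//.
by rewrite sqr_sqrtr ?addr_ge0 ?sqr_ge0// real_normK ?num_real// lerDr sqr_ge0.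
Qed.

Lemma normc_real a : normc a%:C = `|a|.
Proof. by rewrite /Normc.normc /= expr0n addr0 sqrtr_sqr. Qed.

Lemma normc_ge0 z : 0 <= normc z.
Proof. by case: z => a b; exact: sqrtr_ge0. Qed.

Lemma normc0 : normc (0 : R[i]) = 0.
Proof. by rewrite (normc_real 0) normr0. Qed.

Lemma normcD z w : normc (z + w) <= normc z + normc w.
Proof. exact: le_normcD. Qed.

Lemma normcM z w : normc (z * w) = normc z * normc w.
Proof. exact: Normc.normcM. Qed.

Lemma normcN z : normc (- z) = normc z.
Proof. by case: z => a b; rewrite /Normc.normc /= !sqrrN. Qed.

Lemma ReD z w : complex.Re (z + w) = complex.Re z + complex.Re w.
Proof. by case: z; case: w. Qed.
Lemma ImD z w : complex.Im (z + w) = complex.Im z + complex.Im w.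
Proof. by case: z; case: w. Qed.
Lemma ReN z : complex.Re (- z) = - complex.Re z. Proof. by case: z. Qed.
Lemma ImN z : complex.Im (- z) = - complex.Im z. Proof. by case: z. Qed.
Lemma ReM z w : complex.Re (z * w) = complex.Re z * complex.Re w - complex.Im z * complex.Im w.
Proof. by case: z; case: w. Qed.
Lemma ImM z w : complex.Im (z * w) = complex.Re z * complex.Im w + complex.Im z * complex.Re w.
Proof. by case: z; case: w. Qed.
Lemma ReIm_eq z w : complex.Re z = complex.Re w -> complex.Im z = complex.Im w -> z = w.
Proof. by case: z => a b; case: w => c d /= -> ->. Qed.
Lemma complex_eta z : z = complex.Re z +i* complex.Im z.
Proof. by case: z. Qed.

End complex_facts.

Section complex_smooth.
Variables (R : realType) (m : nat).
Local Notation C := R[i].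
Local Notation V := 'rV[R]_m.
Implicit Types (f h : V -> C) (g : V -> R) (U A : set V).

Definition re_ f : V -> R := fun x => complex.Re (f x).
Definition im_ f : V -> R := fun x => complex.Im (f x).
Definition cplx g1 g2 : V -> C := fun x => g1 x +i* g2 x.

Lemma smooth_cplx U g1 g2 : smooth_real U g1 -> smooth_real U g2 -> smooth U (cplx g1 g2).
Proof. by move=> s1 s2; split. Qed.

Lemma smooth_clin U (c : C) f h : open U -> smooth U f -> smooth U h ->
  smooth U (fun x => c * f x + h x).
Proof.
move=> oU [rf jf] [rh jh]; split.
  rewrite (_ : (fun x => _) = fun x => complex.Re c * re_ f x + (- complex.Im c * im_ f x + re_ h x)).
    exact: (smooth_lin _ oU rf (smooth_lin _ oU jf rh)).
  by apply/funext => x; rewrite ReD ReM /re_ /im_; ring.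
rewrite (_ : (fun x => _) = fun x => complex.Re c * im_ f x + (complex.Im c * re_ f x + im_ h x)).
  exact: (smooth_lin _ oU jf (smooth_lin _ oU rf jh)).
by apply/funext => x; rewrite ImD ImM /re_ /im_; ring.
Qed.

Lemma smooth_c0 U : open U -> smooth U (fun _ : V => 0 : C).
Proof. by move=> oU; split; exact: smooth_cst. Qed.

Lemma smooth_cZ U (c : C) f : open U -> smooth U f -> smooth U (fun x => c * f x).
Proof.
move=> oU sf; have := smooth_clin c oU sf (smooth_c0 oU).
by congr smooth; apply/funext => x; rewrite addr0.
Qed.

Lemma smooth_cB U f h : open U -> smooth U f -> smooth U h -> smooth U (fun x => f x - h x).
Proof.
move=> oU sf sh; have := smooth_clin (-1) oU sh sf.
by congr smooth; apply/funext => x; rewrite mulN1r addrC.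
Qed.

Lemma smooth_csub U U' f : U' `<=` U -> smooth U f -> smooth U' f.
Proof. by move=> UU' [rf jf]; split; apply: smooth_sub UU' _. Qed.

Lemma size_mindex_seq (b : mindex m) : size (mindex_seq b) = mdeg b.
Proof.
rewrite /mindex_seq size_flatten /shape -map_comp sumnE big_map big_enum.
by apply: eq_bigr => i _; rewrite /= size_nseq.
Qed.

Lemma sup_seminorm_le A k f (B : R) : 0 <= B ->
  (forall x s, A x -> (size s <= k)%N -> `|ipartial s (re_ f) x| <= B) ->
  (forall x s, A x -> (size s <= k)%N -> `|ipartial s (im_ f) x| <= B) ->
  sup_seminorm A k f <= 2 * B.
Proof.
move=> B0 bre bim; rewrite /sup_seminorm; set S := [set _ | _].
have ub : ubound S (2 * B).
  move=> r [x [b [Ax bk ->]]]; apply: (le_trans (normc_le _ _)).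
  by rewrite mulr_natl mulr2n; apply: lerD; [apply: bre|apply: bim]; rewrite ?size_mindex_seq.
have [->|S0] := eqVneq S set0; first by rewrite sup0 mulr_ge0.
by apply: ge_sup => //; exact/set0P.
Qed.

Lemma seminorm_ge0 U (p : (V -> C) -> R) f : open U -> continuous_seminorm U p -> smooth U f -> 0 <= p f.
Proof.
move=> oU [pD pZ _] sf.
have p0 : p (fun x => 0 * f x) = 0 by rewrite pZ// normc0 mul0r.
have pN : p (fun x => (-1) * f x) = p f by rewrite pZ// normcN (normc_real 1) normr1 mul1r.
have := pD f (fun x => (-1) * f x) sf (smooth_cZ _ oU sf).
rewrite pN (_ : (fun x => f x + _) = fun x => 0 * f x); last first.
  by apply/funext => x; rewrite mulN1r subrr mul0r.
by rewrite p0 -mulr2n -mulr_natl pmulr_rge0.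
Qed.

(** A continuous seminorm is controlled by the real and imaginary parts of
    finitely many derivatives on a compact set; their number and that set are
    all that the estimates below see. *)
Lemma seminorm_bound U (p : (V -> C) -> R) : open U -> continuous_seminorm U p ->
  exists A k c, [/\ compact A, A `<=` U, 0 <= c & forall f (B : R), smooth U f -> 0 <= B ->
    (forall x s, A x -> (size s <= k)%N -> `|ipartial s (re_ f) x| <= B) ->
    (forall x s, A x -> (size s <= k)%N -> `|ipartial s (im_ f) x| <= B) -> `|p f| <= c * B].
Proof.
move=> oU cp; have [_ _ [A [k [c [cA AU pc]]]]] := cp.
exists A, k, (`|c| * 2); split => // f B sf B0 bre bim.
rewrite ger0_norm ?(seminorm_ge0 oU cp sf)//; apply: (le_trans (pc f sf)).
have h := sup_seminorm_le B0 bre bim.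
have s0 : 0 <= sup_seminorm A k f.
  rewrite /sup_seminorm; set S := [set _ | _].
  have [->|/set0P[r Sr]] := eqVneq S set0; first by rewrite sup0.
  have ub : has_ubound S.
    exists (2 * B) => t [x [b [Ax bk ->]]]; apply: (le_trans (normc_le _ _)).
    by rewrite mulr_natl mulr2n; apply: lerD; [apply: bre|apply: bim]; rewrite ?size_mindex_seq.
  by apply: le_trans (ub_le_sup ub Sr); case: Sr => x [b [_ _ ->]]; exact: normc_ge0.
rewrite -mulrA; apply: (@le_trans _ _ (`|c| * sup_seminorm A k f)).
  by rewrite ler_wpM2r// ler_norm.
by rewrite ler_wpM2l.
Qed.

End complex_smooth.

Section complex_nets.
Variables (R : realType) (m : nat).
Local Notation C := R[i].
Local Notation V := 'rV[R]_m.
Implicit Types (g : R -> V -> R).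

Definition cnet g1 g2 : R -> V -> C := fun e x => g1 e x +i* g2 e x.

Lemma bigO_le (f : R -> R) (K : R) (N : int) :
  (forall e, 0 < e < 1 -> `|f e| <= K * e ^ N) ->
  (f : R -> R^o) =O_ (0^'+) (fun e => e ^ N : R^o).
Proof.
move=> fK; apply/eqOP; near=> k; have kK : K <= k by near: k; exact: nbhs_pinfty_ge (num_real _).
near=> e.
have e0 : 0 < e by near: e; exact: nbhs_right_gt.
have e1 : e < 1 by near: e; exact: nbhs_right_lt.
have eN : 0 <= e ^ N by rewrite exprz_ge0// ltW.
apply: (le_trans (fK e _)); first by rewrite e0.
by rewrite (ger0_norm eN) ler_wpM2r.
Unshelve. all: by end_near. Qed.

Lemma iter_epartial_rnet g k : rnet g -> rnet (iter k (@epartial R m) g).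
Proof. by move=> rg; elim: k => [//|k IH]; exact: rnet_epartial. Qed.

(** The curve in the space of smooth functions has the iterated derivatives in
    e as its derivatives: a continuous seminorm of the Taylor remainder is
    O(h^2), by [seminorm_bound]. *)
Lemma cnet_smooth g1 g2 : rnet g1 -> rnet g2 -> smooth_net setT (cnet g1 g2).
Proof.
move=> r1 r2; pose D k g := iter k (@epartial R m) g.
exists (fun k => cnet (D k g1) (D k g2)); split => // k e e01.
have R1 := iter_epartial_rnet k r1; have R2 := iter_epartial_rnet k r2.
split; first by apply: smooth_cplx; exact: rnet_smooth.
move=> p cp; have [A [l [c [_ _ c0 pc]]]] := seminorm_bound openT cp.
have E1 := rnet_epartial R1; have E2 := rnet_epartial R2.
have [B1 [s1 [s10 s101 b1]]] := rnet_local_bound l (rnet_epartial E1) e01.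
have [B2 [s2 [s20 s201 b2]]] := rnet_local_bound l (rnet_epartial E2) e01.
have P g B r (h : R) : rnet g -> (forall t, `|t - e| < r -> 0 < t < 1) -> 0 < r ->
    (forall t s x, `|t - e| < r -> (size s <= l)%N ->
       `|ipartial s (epartial (epartial g) t) x| <= B) -> `|h| < r ->
    smooth_real setT (remainder g (epartial g) e h) /\
    forall s x, (size s <= l)%N -> `|ipartial s (remainder g (epartial g) e h) x| <= B * `|h| ^+ 2.
  move=> rg r01 r0 b hr; have reg := rnet_epartial rg; split.
    by apply: (remainder_smooth r0 _ _ hr) => t /r01 t01; exact: rnet_smooth.
  move=> s x sl; apply: (@remainder_le _ m g (epartial g) (epartial (epartial g)) e r B l r0 _ _ _ _ _ h s x hr sl).
  - by move=> t /r01 t01; exact: rnet_smooth.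
  - by move=> t /r01 t01; exact: rnet_smooth.
  - by move=> t q y /r01 t01; exact: rnet_ipartial_derive.
  - by move=> t q y /r01 t01; exact: rnet_ipartial_derive.
  - exact: b.
have [pD pZ _] := cp.
apply/cvgrPdist_le => d d0; near=> h.
have h0 : h != 0 by near: h; exact: nbhs_dnbhs_neq.
have hs1 : `|h| < s1 by near: h; apply: dnbhs0_lt.
have hs2 : `|h| < s2 by near: h; apply: dnbhs0_lt.
have [S1 Q1] := P _ _ _ _ R1 s101 s10 b1 hs1.
have [S2 Q2] := P _ _ _ _ R2 s201 s20 b2 hs2.
pose rem := cplx (remainder (D k g1) (epartial (D k g1)) e h)
                 (remainder (D k g2) (epartial (D k g2)) e h).
rewrite sub0r normrN (_ : (fun x => _) = fun x => (h^-1)%:C * rem x); last first.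
  apply/funext => x; rewrite /cnet /rem /cplx /remainder (addrC e h).
  by apply: ReIm_eq; rewrite !(ReD, ReN, ReM, ImD, ImN, ImM)/=; field.
rewrite pZ; last exact: smooth_cplx.
rewrite normc_real normrM normr_id.
have B0 : 0 <= `|B1| + `|B2| by rewrite addr_ge0.
have le1 : B1 * `|h| ^+ 2 <= (`|B1| + `|B2|) * `|h| ^+ 2.
  by rewrite ler_wpM2r ?exprn_ge0// (le_trans (ler_norm _))// lerDl.
have le2 : B2 * `|h| ^+ 2 <= (`|B1| + `|B2|) * `|h| ^+ 2.
  by rewrite ler_wpM2r ?exprn_ge0// (le_trans (ler_norm _))// lerDr.
have pr : `|p rem| <= c * ((`|B1| + `|B2|) * `|h| ^+ 2).
  apply: pc; [exact: smooth_cplx|by rewrite mulr_ge0// exprn_ge0| |] => x s _ sl.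
    exact: le_trans (Q1 s x sl) le1.
  exact: le_trans (Q2 s x sl) le2.
have hp : 0 < `|h| by rewrite normr_gt0.
rewrite normfV ler_pdivrMl//; apply: (le_trans pr).
rewrite expr2 !mulrA [leRHS]mulrC ler_wpM2r//.
apply: (@le_trans _ _ ((c * (`|B1| + `|B2|) + 1) * `|h|)).
  by rewrite ler_wpM2r// lerDl.
rewrite -ler_pdivlMl; last by rewrite ltr_wpDl// mulr_ge0.
by rewrite mulrC; near: h; apply: dnbhs0_le; rewrite divr_gt0// ltr_wpDl// mulr_ge0.
Unshelve. all: by end_near. Qed.

Lemma cnet_moderate g1 g2 : rnet g1 -> rnet g2 -> moderate setT (cnet g1 g2).
Proof.
move=> r1 r2; split; first exact: cnet_smooth.
move=> p cp; have [A [l [c [_ _ c0 pc]]]] := seminorm_bound openT cp.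
have [B1 [K1 [B10 b1]]] := rnet_bound_le l r1; have [B2 [K2 [B20 b2]]] := rnet_bound_le l r2.
exists (- (K1 + K2)%N%:Z); apply: (@bigO_le _ (c * (B1 + B2))) => e e01.
have /andP[e0 e1] := e01; have ie1 : 1 <= e^-1 by rewrite invf_ge1// ltW.
have ie0 : 0 <= e^-1 by rewrite invr_ge0 ltW.
have -> : e ^ (- (K1 + K2)%N%:Z) = e^-1 ^+ (K1 + K2) by rewrite -exprz_inv.
rewrite -mulrA; apply: pc.
- by apply: smooth_cplx; exact: rnet_smooth.
- by rewrite mulr_ge0 ?addr_ge0// exprn_ge0.
- move=> x s _ sl; apply: (le_trans (b1 s e x sl e01)); apply: ler_pM => //; first by rewrite exprn_ge0.
    by rewrite lerDl.
  by rewrite ler_weXn2l// leq_addr.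
- move=> x s _ sl; apply: (le_trans (b2 s e x sl e01)); apply: ler_pM => //; first by rewrite exprn_ge0.
    by rewrite lerDr.
  by rewrite ler_weXn2l// leq_addl.
Qed.

End complex_nets.

Section distributions.
Variables (R : realType) (m : nat).
Local Notation C := R[i].
Local Notation V := 'rV[R]_m.

Definition rcplx (g : V -> R) : V -> C := fun x => (g x)%:C.

Lemma rcplx_smooth g : smooth_real setT g -> smooth setT (rcplx g).
Proof. by move=> sg; split => //; exact: smooth_cst openT. Qed.

Lemma dist_functional (u : (V -> C) -> C) : compact_distribution u ->
  exists A k c, [/\ compact A, functional (fun g => complex.Re (u (rcplx g))) A k c &
    functional (fun g => complex.Im (u (rcplx g))) A k c].
Proof.
move=> [ulin cu]; have [A [k [c [cA _ c0 uc]]]] := seminorm_bound openT cu.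
have lin (a : R) f g : smooth_real setT f -> smooth_real setT g ->
    u (rcplx (fun x => a * f x + g x)) = a%:C * u (rcplx f) + u (rcplx g).
  move=> sf sg; rewrite -ulin; [|exact: rcplx_smooth|exact: rcplx_smooth].
  by congr u; apply/funext => x; rewrite /rcplx rmorphD rmorphM.
have bd f (B : R) : smooth_real setT f -> 0 <= B ->
    (forall s y, A y -> (size s <= k)%N -> `|ipartial s f y| <= B) ->
    normc (u (rcplx f)) <= c * B.
  move=> sf B0 fB; apply: (le_trans (ler_norm _)); apply: uc => //.
  - exact: rcplx_smooth.
  - by move=> x s Ax sk; exact: fB.
  - by move=> x s Ax sk; rewrite -[im_ _]/(fun=> 0 : R) ipartial0 normr0.
exists A, k, c; split => //; split => //.
- by move=> a f g sf sg; rewrite lin// ReD ReM /= mul0r subr0.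
- by move=> f B sf B0 fB; apply: le_trans (Re_le_normc _) _; exact: bd.
- by move=> a f g sf sg; rewrite lin// ImD ImM /= mul0r addr0.
- by move=> f B sf B0 fB; apply: le_trans (Im_le_normc _) _; exact: bd.
Qed.

(** A complex linear form is determined by its values on real-valued
    functions. *)
Lemma dist_split (u : (V -> C) -> C) f : compact_distribution u -> smooth setT f ->
  u f = 'i%C * u (rcplx (im_ f)) + u (rcplx (re_ f)).
Proof.
move=> [ulin _] [sr si]; rewrite -ulin; [|exact: rcplx_smooth|exact: rcplx_smooth].
by congr u; apply/funext => x; rewrite /rcplx /re_ /im_ addrC; exact: complexE.
Qed.

End distributions.

(** * Smooth functions with bounded derivatives *)

Section bsmooth.
Variables (R : realType) (m : nat).
Local Notation V := 'rV[R]_m.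
Local Notation e_ i := (delta_mx 0 i : V).
Implicit Types (f g : V -> R) (x : V).

(** A constant net in [rnet] is a smooth function all of whose derivatives are
    bounded. *)
Definition bsmooth f := rnet (fun _ : R => f).

Lemma half01 : 0 < (2^-1 : R) < 1. Proof. by lra. Qed.

Lemma bsmooth_smooth f : bsmooth f -> smooth_real setT f.
Proof. move=> bf; exact: (rnet_smooth bf half01). Qed.

Lemma bsmooth_partial f i : bsmooth f -> bsmooth (ipartial [:: i] f).
Proof. exact: rnet_partial. Qed.

Lemma bsmooth_ipartial f s : bsmooth f -> bsmooth (ipartial s f).
Proof. exact: (@rnet_ipartial R m (fun=> f)). Qed.

Lemma bsmooth_bound f : bsmooth f -> exists2 B : R, 0 <= B & forall x, `|f x| <= B.
Proof.
move=> /rnet_bound[B [k [B0 b]]]; exists (B * 2^-1^-1 ^+ k) => [|x].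
  by rewrite mulr_ge0// exprn_ge0.
exact: (b 2^-1 x half01).
Qed.

Lemma bsmoothP f : smooth_real setT f ->
  (forall s, exists B, forall x, `|ipartial s f x| <= B) -> bsmooth f.
Proof.
move=> sf bf; pose C : set (R -> V -> R) :=
  [set g | (exists s, g = fun=> ipartial s f) \/ g = fun _ _ => 0].
exists C; split; last by left; exists [::].
have C0 : C (fun _ _ => 0) by right.
move=> g Cg; split.
- case: Cg => [[s ->]|->]; last by exists 0, 0%N => e x _; rewrite normr0 mul0r.
  by have [B b] := bf s; exists B, 0%N => e x _; rewrite mulr1.
- case: Cg => [[s ->] i|-> i].
    exists (fun=> ipartial (i :: s) f); split; first by left; exists (i :: s).
    by move=> e x _; exact: (smooth_has_partials (smooth_ipartial s sf)).
  by exists (fun _ _ => 0); split => // e x _; exact: is_derive_cst.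
- exists (fun _ _ => 0); split => // e x _.
  by case: Cg => [[s ->]|->]; exact: is_derive_cst.
Qed.

Lemma rnet_bsmooth (g : R -> V -> R) e : rnet g -> 0 < e < 1 -> bsmooth (g e).
Proof.
move=> rg e01; apply: bsmoothP; first exact: rnet_smooth.
move=> s; have [B [k [_ b]]] := rnet_bound (rnet_ipartial s rg).
by exists (B * e^-1 ^+ k) => x; exact: b.
Qed.

Lemma rschwartz_bsmooth f : rschwartz f -> bsmooth f.
Proof.
move=> sf; apply: bsmoothP; first exact: rschwartz_smooth.
move=> s; suff : rschwartz (ipartial s f) by exact: rschwartz_bounded.
elim: s => // i s IH; rewrite -cat1s ipartial_cat; exact: rschwartz_partial.
Qed.

Definition tfun f := smooth_real setT f /\
  exists2 A, compact A & forall x, ~ A x -> f x = 0.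

Lemma compact_bound f (A : set V) : continuous f -> compact A ->
  exists2 B : R, 0 <= B & forall x, A x -> `|f x| <= B.
Proof.
move=> cf cA; have /compact_bounded[M [_ HM]] : compact (f @` A).
  by apply: continuous_compact => //; exact: continuous_subspaceT.
exists (`|M| + 1) => [|x Ax]; first by rewrite addr_ge0.
have h : M < `|M| + 1 by rewrite ltr_pwDr// ler_norm.
by apply: (HM _ h); exists x.
Qed.

(** The real smooth functions with compact support form a class of Schwartz
    functions: they are bounded, and the support does not grow. *)
Lemma tfun_class : schwartz_class tfun.
Proof.
move=> f [sf [A cA f0]]; split.
- have [B B0 b] := compact_bound (smooth_continuous sf) cA.
  by exists B => x; have [/b//|/f0->] := pselect (A x); rewrite normr0.
- move=> i; split; first by apply: smoothM => //; exact: smooth_coord.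
  by exists A => // x /f0->; rewrite mulr0.
- move=> i; exists (ipartial [:: i] f); split; last exact: smooth_has_partials.
  split; first exact: smooth_ipartial.
  exists A => // x nAx.
  have oA : open (~` A) by apply: closed_openC; apply: compact_closed => //; exact: (@norm_hausdorff R V).
  by rewrite (@ipartial_eq_on _ _ (~` A) [:: i] f (fun=> 0) oA)// ipartial0.
Qed.

Lemma tfun_rschwartz f : tfun f -> rschwartz f.
Proof. by move=> tf; exists tfun; split => //; exact: tfun_class. Qed.

End bsmooth.

Section fam_nets.
Variables (R : realType) (n : nat).

(** A coordinate of z = (x, y) is a coordinate of x or one of y. *)
Lemma fam_net_dx K G i : @fam R n K G -> exists g',
  (exists K' G', @fam R n K' G' /\ g' = fun e z => G' e (lsubmx z) (rsubmx z)) /\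
  forall e x, 0 < e < 1 -> is_derive x (delta_mx 0 i) (fun z => G e (lsubmx z) (rsubmx z)) (g' e x).
Proof.
move=> fG.
case: (splitP i) => j ij.
  have -> : i = lshift n j by exact/val_inj.
  have [G' fG' d] := fam_dx j fG.
  exists (fun e z => G' e (lsubmx z) (rsubmx z)); split; first by exists K.+1, G'.
  move=> e z e01; apply/is_derive_line0; have /is_derive_line0 := d e (lsubmx z) (rsubmx z) e01.
  congr is_derive; apply/funext => h; congr (G e _ _).
    apply/rowP => k; rewrite !mxE.
    by rewrite (inj_eq (@lshift_inj _ _)).
  by apply/rowP => k; rewrite !mxE eq_rlshift/= mulr0 add0r.
have -> : i = rshift n j by exact/val_inj.
have [G' fG' d] := fam_dy j fG.
exists (fun e z => G' e (lsubmx z) (rsubmx z)); split; first by exists K.+1, G'.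
move=> e z e01; apply/is_derive_line0; have /is_derive_line0 := d e (lsubmx z) (rsubmx z) e01.
congr is_derive; apply/funext => h; congr (G e _ _).
  by apply/rowP => k; rewrite !mxE eq_lrshift/= mulr0 add0r.
apply/rowP => k; rewrite !mxE.
by rewrite (inj_eq (@rshift_inj _ _)).
Qed.

Lemma fam_rnet K G : @fam R n K G -> rnet (fun e z => G e (lsubmx z) (rsubmx z)).
Proof.
move=> fG; pose C : set (R -> 'rV[R]_(n + n) -> R) :=
  [set g | exists K G, fam K G /\ g = fun e z => G e (lsubmx z) (rsubmx z)].
exists C; split; last by exists K, G.
move=> _ [{fG}K [{}G [fG ->]]]; split.
- have [B B0 b] := fam_bound fG; exists B, (K + (n + n + 1))%N => e x e01; exact: b.
- by move=> i; exact: (fam_net_dx i fG).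
- have [G' fG' d] := fam_de fG; exists (fun e z => G' e (lsubmx z) (rsubmx z)).
  by split; [exists K.+1, G'|move=> e z e01; exact: d].
Qed.

End fam_nets.

(** * Functionals commute with integrals *)

Section exchange.
Variables (R : realType) (p m : nat).
Local Notation X := 'rV[R]_p.
Local Notation V := 'rV[R]_m.
Local Notation Rm := (measurableTypeR R).
Local Notation lt m := (lebesgue_tuple R m).
Implicit Types (psi : X -> R) (F : 'rV[R]_(p + m) -> R) (f : X -> R) (x : X) (y : V).

Definition tintegrable psi := (lt p).-integrable setT (fun t => (psi (rvec t))%:E).

Lemma tintegrable_measurable psi : tintegrable psi ->
  measurable_fun setT (fun t : p.-tuple Rm => psi (rvec t)).
Proof. by move=> /measurable_int/measurable_EFinP. Qed.

Lemma tintegrable_le psi f : tintegrable psi ->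
  measurable_fun setT (fun t : p.-tuple Rm => f (rvec t)) ->
  (forall x, `|f x| <= `|psi x|) -> tintegrable f.
Proof.
move=> ip mf le; apply: (le_integrable measurableT _ _ ip); first exact/measurable_EFinP.
by move=> t _; rewrite lee_fin.
Qed.

Lemma tintegrable_norm psi : tintegrable psi -> tintegrable (fun x => `|psi x|).
Proof.
move=> ip; apply: (tintegrable_le ip); last by move=> x; rewrite normr_id.
by apply: measurableT_comp => //; exact: tintegrable_measurable.
Qed.

Lemma tintegrableZ psi (c : R) : tintegrable psi -> tintegrable (fun x => c * psi x).
Proof.
move=> ip; have := integrableZl measurableT c ip.
by apply: eq_integrable => // t _; rewrite EFinM.
Qed.

Lemma tintegrableM f psi (B : R) : continuous f -> (forall x, `|f x| <= B) ->
  tintegrable psi -> tintegrable (fun x => f x * psi x).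
Proof.
move=> cf fB ip; have B0 : 0 <= B by apply: le_trans (fB 0).
apply: (tintegrable_le (tintegrableZ B ip)).
  by apply: measurable_funM; [exact: measurable_continuous|exact: tintegrable_measurable].
by move=> x; rewrite !normrM ler_wpM2r// (le_trans (fB x))// ler_norm.
Qed.

Definition pint psi f : R := (\int[lt p]_t (f (rvec t) * psi (rvec t)))%R.

Lemma le_pint psi f (M : R) : continuous f -> (exists B : R, forall x, `|f x| <= B) -> tintegrable psi ->
  (forall x, psi x != 0 -> `|f x| <= M) ->
  `|pint psi f| <= M * (\int[lt p]_t `|psi (rvec t)|)%R.
Proof.
move=> cf [B fB] ip fM; have ifp := tintegrableM cf fB ip.
apply: (le_trans (le_normr_Rintegral measurableT ifp)).
rewrite -RintegralZl//; last exact: tintegrable_norm.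
apply: le_Rintegral => //; [exact: (tintegrable_norm ifp)|exact: (tintegrableZ M (tintegrable_norm ip))|].
move=> t _; rewrite normrM; have [->|n0] := eqVneq (psi (rvec t)) 0; first by rewrite normr0 !mulr0.
by rewrite ler_wpM2r// fM.
Qed.

Lemma pint_lin psi f g (a : R) (B B' : R) : tintegrable psi -> continuous f -> continuous g ->
  (forall x, `|f x| <= B) -> (forall x, `|g x| <= B') ->
  pint psi (fun x => a * f x + g x) = a * pint psi f + pint psi g.
Proof.
move=> ip cf cg fB gB; have i1 := tintegrableM cf fB ip; have i2 := tintegrableM cg gB ip.
rewrite /pint -RintegralZl//; rewrite -RintegralD//; last exact: (tintegrableZ a i1).
by apply: eq_Rintegral => t _; rewrite mulrDl mulrA.
Qed.

(** The integral of the family y |-> F(x, y) over x, against psi. The theorem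
    of this part is that a functional in y may be applied under this integral
    ([exchange]). *)
Definition slice_int psi F : V -> R := fun y => pint psi (fun x => F (row_mx x y)).

Lemma slicel_continuous F y : continuous F -> continuous (fun x => F (row_mx x y)).
Proof.
move=> cF x; apply/(@continuous_epsP R X) => d d0.
have /(@continuous_epsP R 'rV[R]_(p + m)) /(_ d d0)[r r0 H] := cF (row_mx x y).
exists r => // x' xx'; apply: H; apply: le_lt_trans (norm_row_mx _ _ _ _) _.
by rewrite subrr normr0 gt_max xx' r0.
Qed.

Section partials.
Variable psi : X -> R.
Hypothesis ip : tintegrable psi.

Lemma slice_int_partial F : bsmooth F ->
  has_partials (slice_int psi F) (fun i => slice_int psi (ipartial [:: rshift p i] F)).
Proof.
move=> bF i y; apply/is_derive_line0.
have bF' := bsmooth_partial (rshift p i) bF.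
have [B B0 b] := bsmooth_bound bF; have [B' B'0 b'] := bsmooth_bound bF'.
have c F' (bF'' : bsmooth F') y' := @slicel_continuous F' y' (smooth_continuous (bsmooth_smooth bF'')).
have -> : slice_int psi (ipartial [:: rshift p i] F) y =
  (\int[lt p]_t (ipartial [:: rshift p i] F (row_mx (rvec t) ((0 : R) *: delta_mx 0 i + y)) * psi (rvec t)))%R.
  by rewrite scale0r add0r.
apply: (@is_derive_integral R _ _ (lt p)
  (fun h t => F (row_mx (rvec t) (h *: delta_mx 0 i + y)) * psi (rvec t))
  (fun h t => ipartial [:: rshift p i] F (row_mx (rvec t) (h *: delta_mx 0 i + y)) * psi (rvec t))
  (fun t => B' * `|psi (rvec t)|) 0 1 ltr01).
- by move=> h _; apply: (tintegrableM (B := B) (c _ bF _)) => // x; exact: b.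
- move=> h t _; rewrite -[X in is_derive _ _ _ X]addr0 -[X in is_derive _ _ _ (_ + X)](mulr0 (F (row_mx (rvec t) (h *: delta_mx 0 i + y)))).
  have D : is_derive h 1 (fun h : R => F (row_mx (rvec t) (h *: delta_mx 0 i + y)))
      (ipartial [:: rshift p i] F (row_mx (rvec t) (h *: delta_mx 0 i + y))).
    exact: (proj1 (@is_derive_line R m _ _ _ _ _) (slice_partial (rvec t) (bsmooth_smooth bF) i (h *: delta_mx 0 i + y))).
  exact: (is_derive_mul D (is_derive_cst (psi (rvec t)) h 1)).
- exact: (tintegrableZ B' (tintegrable_norm ip)).
- by move=> h t _; rewrite normrM ler_wpM2r.
Qed.

Lemma slice_int_le F (B : R) : bsmooth F -> (forall z, `|F z| <= B) ->
  forall y, `|slice_int psi F y| <= B * (\int[lt p]_t `|psi (rvec t)|)%R.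
Proof.
move=> bF b y; apply: le_pint.
- by apply: slicel_continuous; exact: smooth_continuous (bsmooth_smooth bF).
- by exists B => x; exact: b.
- exact: ip.
- by move=> x _; exact: b.
Qed.

Lemma slice_int_smooth F : bsmooth F -> smooth_real setT (slice_int psi F).
Proof.
move=> bF; apply: (@smooth_classP _ _ [set f | exists2 F, bsmooth F & f = slice_int psi F]); last by exists F.
move=> _ [{bF}F bF ->]; split.
  have Q i : exists B, forall y, `|slice_int psi (ipartial [:: rshift p i] F) y| <= B.
    have [B _ b] := bsmooth_bound (bsmooth_partial (rshift p i) bF).
    eexists => y; exact: (slice_int_le (bsmooth_partial (rshift p i) bF) b).
  have [B b] := choice Q.
  apply: (@continuous_partials _ _ _ _ (\sum_i `|B i|) (slice_int_partial bF)) => i y.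
  apply: (le_trans (b i y)); apply: (le_trans (ler_norm _)).
  by rewrite (bigD1 i)//= lerDl sumr_ge0.
move=> i; exists (slice_int psi (ipartial [:: rshift p i] F)); split; last exact: slice_int_partial.
by exists (ipartial [:: rshift p i] F) => //; exact: bsmooth_partial.
Qed.

Lemma slice_int_ipartial F s : bsmooth F ->
  ipartial s (slice_int psi F) = slice_int psi (ipartial (map (@rshift p m) s) F).
Proof.
move=> bF; elim: s => // i s IH.
rewrite -(cat1s i) ipartial_cat IH map_cat ipartial_cat; apply: ipartial_eq.
by move=> y; apply: slice_int_partial; exact: bsmooth_ipartial.
Qed.

End partials.

Section functional.
Variables (v : (V -> R) -> R) (A : set V) (k : nat) (c : R) (F : 'rV[R]_(p + m) -> R).
Hypotheses (fv : functional v A k c) (bF : bsmooth F).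

Definition fslice : X -> R := fun x => v (fun y => F (row_mx x y)).

Lemma fslice_bsmooth : bsmooth fslice.
Proof. exact: (rnet_functional fv bF). Qed.

(** The failure of v to commute with the integral. It is additive in psi
    ([defectD]) and small when psi lives in a small ball ([defect_local]),
    hence small for every compactly supported psi, hence zero. *)
Definition defect psi : R := v (slice_int psi F) - pint psi fslice.

Lemma defectD psi1 psi2 : tintegrable psi1 -> tintegrable psi2 ->
  defect (fun x => psi1 x + psi2 x) = defect psi1 + defect psi2.
Proof.
move=> i1 i2; rewrite /defect.
have [B B0 b] := bsmooth_bound bF; have [B' B'0 b'] := bsmooth_bound fslice_bsmooth.
have cF := smooth_continuous (bsmooth_smooth bF).
have cf := smooth_continuous (bsmooth_smooth fslice_bsmooth).
have D f (M : R) : continuous f -> (forall x, `|f x| <= M) ->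
    pint (fun x => psi1 x + psi2 x) f = pint psi1 f + pint psi2 f.
  move=> cf' fM; rewrite /pint -RintegralD//.
  - by apply: eq_Rintegral => t _; rewrite mulrDr.
  - exact: (tintegrableM cf' fM i1).
  - exact: (tintegrableM cf' fM i2).
have -> : slice_int (fun x => psi1 x + psi2 x) F =
    fun y => 1 * slice_int psi1 F y + slice_int psi2 F y.
  apply/funext => y; rewrite mul1r; apply: (D _ B); first exact: slicel_continuous.
  by move=> x; exact: b.
rewrite (functional_lin fv); [|exact: slice_int_smooth|exact: slice_int_smooth].
by rewrite (D _ B')//; ring.
Qed.

Lemma slice_lip s x x0 y (B r : R) : (forall s z, (size s <= k.+1)%N -> `|ipartial s F z| <= B) ->
  (size s <= k)%N -> `|x - x0| <= r ->
  `|ipartial s F (row_mx x y) - ipartial s F (row_mx x0 y)| <= B * ((p + m)%:R * r).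
Proof.
move=> b sk xr; have B0 : 0 <= B by apply: le_trans (b [::] 0 _).
have hp := smooth_has_partials (smooth_ipartial s (bsmooth_smooth bF)).
have E : row_mx x y = (row_mx x y - row_mx x0 y) + row_mx x0 y by rewrite subrK.
rewrite {1}E; apply: le_trans.
  apply: (@lipschitz_partials _ _ _ _ B _ _ hp) => i z.
  by rewrite -ipartial_cat; apply: b; rewrite size_cat.
rewrite ler_wpM2l// mulr_natl -[X in _ *+ X]card_ord -sumr_const; apply: ler_sum => i _.
apply: le_trans (le_trans (norm_row_mx x x0 y y) _).
  by rewrite [leRHS]/Num.norm/= mx_normrE (bigmax_sup (0, i)).
by rewrite subrr normr0 ge_max xr (le_trans _ xr).
Qed.

(** If psi is supported in a ball of radius r about x0, replacing F(x, .) by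
    F(x0, .) changes both terms of the defect by at most a constant times r,
    and after the replacement the two terms agree by linearity of v. *)
Lemma defect_local psi x0 (B r : R) : tintegrable psi -> 0 <= r ->
  (forall s z, (size s <= k.+1)%N -> `|ipartial s F z| <= B) ->
  (forall x, psi x != 0 -> `|x - x0| <= r) ->
  `|defect psi| <= 2 * (c * (B * ((p + m)%:R * r)) * (\int[lt p]_t `|psi (rvec t)|)%R).
Proof.
move=> ip r0 b supp; pose N := (\int[lt p]_t `|psi (rvec t)|)%R.
pose M := B * ((p + m)%:R * r).
have B0 : 0 <= B by apply: le_trans (b [::] 0 _).
have M0 : 0 <= M by rewrite !mulr_ge0.
have N0 : 0 <= N by apply: Rintegral_ge0 => t _.
pose P1 := pint psi (fun=> 1).
pose sl x := fun y => F (row_mx x y).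
have sms x : smooth_real setT (sl x) by apply: slice_smooth; exact: bsmooth_smooth bF.
have [Bf Bf0 bf] := bsmooth_bound fslice_bsmooth.
have cfs := smooth_continuous (bsmooth_smooth fslice_bsmooth).
have c1 : continuous (fun _ : X => 1 : R) by move=> x; exact: cst_continuous.
have b1 (x : X) : `|1 : R| <= 1 by rewrite normr1.
have split f B' a : continuous f -> (forall x, `|f x| <= B') ->
    pint psi f - a * P1 = pint psi (fun x => (- a) * 1 + f x).
  by move=> cf fB; rewrite (pint_lin _ ip c1 cf b1 fB) mulNr addrC.
have est f B' a M' : continuous f -> (forall x, `|f x| <= B') ->
    (forall x, `|x - x0| <= r -> `|f x - a| <= M') -> `|pint psi f - a * P1| <= M' * N.
  move=> cf fB h; rewrite (split f B')//; apply: le_pint => //.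
  - move=> x; apply: (@continuousD R R X); first exact: cst_continuous.
    exact: cf.
  - exists (`|a| + B') => x; rewrite mulr1 (le_trans (ler_normD _ _))// normrN lerD//.
  - by move=> x /supp xr; rewrite mulr1 addrC h.
have E1 : `|v (slice_int psi F) - fslice x0 * P1| <= c * (M * N).
  have sI := slice_int_smooth ip bF.
  have -> : v (slice_int psi F) - fslice x0 * P1 = v (fun y => - P1 * sl x0 y + slice_int psi F y).
    by rewrite (functional_lin fv)// /fslice -/(sl x0); ring.
  apply: (functional_le fv).
  - exact: (smooth_lin (- P1) openT (sms x0) sI).
  - by rewrite mulr_ge0.
  - move=> s y _ sk; rewrite (ipartial_lin (- P1) s openT (sms x0) sI)//.
    rewrite (slice_int_ipartial ip)// slice_ipartial; last exact: bsmooth_smooth bF.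
    rewrite mulNr addrC mulrC.
    have bs := bsmooth_ipartial (map (@rshift p m) s) bF.
    have [B' _ b'] := bsmooth_bound bs.
    apply: (est (fun x => ipartial (map (@rshift p m) s) F (row_mx x y)) B').
    + by apply: slicel_continuous; exact: smooth_continuous (bsmooth_smooth bs).
    + by move=> x; exact: b'.
    + by move=> x xr; apply: slice_lip; rewrite ?size_map.
have E2 : `|pint psi fslice - fslice x0 * P1| <= c * M * N.
  apply: (est _ Bf) => // x xr.
  rewrite (_ : fslice x - fslice x0 = v (fun y => -1 * sl x0 y + sl x y)); last first.
    by rewrite (functional_lin fv)// mulN1r addrC.
  apply: (functional_le fv) => //; first exact: smooth_lin openT _ _.
  move=> s y _ sk; rewrite (ipartial_lin (-1) s openT (sms x0) (sms x))//.
  rewrite !slice_ipartial; [|exact: bsmooth_smooth bF|exact: bsmooth_smooth bF].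
  by rewrite mulN1r addrC; apply: slice_lip; rewrite ?size_map.
rewrite /defect (_ : v _ - _ = (v (slice_int psi F) - fslice x0 * P1) - (pint psi fslice - fslice x0 * P1)); last by ring.
apply: (le_trans (ler_normB _ _)); rewrite mulrDl !mul1r; apply: lerD => //.
by rewrite -mulrA.
Qed.

(** The parts of psi inside and outside the first ball are treated separately;
    their integrals add up, so the constant does not grow with the number of
    balls. *)
Lemma defect_cover (B r : R) (l : seq X) psi : tintegrable psi -> 0 <= r ->
  (forall s z, (size s <= k.+1)%N -> `|ipartial s F z| <= B) ->
  (forall x, psi x != 0 -> exists2 z, z \in l & `|x - z| < r) ->
  `|defect psi| <= 2 * (c * (B * ((p + m)%:R * r)) * (\int[lt p]_t `|psi (rvec t)|)%R).
Proof.
move=> + r0 b; elim: l psi => [|z l IH] psi ip supp.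
  by apply: (@defect_local _ 0) => // x /supp[].
pose U : set X := [set x | `|x - z| < r].
have oU : open U.
  rewrite (_ : U = ball z r); first exact: ball_open.
  by apply/seteqP; split => x; rewrite /U -ball_normE/= distrC.
pose ind (x : X) : R := \1_[set t : p.-tuple Rm | U (rvec t)] (rtup x).
have indE x : ind x = (x \in U)%:R.
  by rewrite /ind indicE; congr (nat_of_bool _)%:R; apply/idP/idP; rewrite !inE/= rtupK.
have mind : measurable_fun setT (fun t : p.-tuple Rm => ind (rvec t)).
  rewrite (_ : (fun t => _) = \1_[set t : p.-tuple Rm | U (rvec t)]).
    by apply: measurable_indic; exact: measurable_rvec_open.
  by apply/funext => t; rewrite /ind rvecK.
have ind01 x : ind x = 0 \/ ind x = 1 by rewrite indE; case: (_ \in _); [right|left].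
pose psi1 x := ind x * psi x; pose psi2 x := (1 - ind x) * psi x.
have mp := tintegrable_measurable ip.
have i1 : tintegrable psi1.
  apply: (tintegrable_le ip); first exact: measurable_funM.
  by move=> x; rewrite /psi1; case: (ind01 x) => ->; rewrite ?mul0r ?normr0 ?mul1r.
have i2 : tintegrable psi2.
  apply: (tintegrable_le ip).
    by apply: measurable_funM => //; apply: measurable_funB.
  by move=> x; rewrite /psi2; case: (ind01 x) => ->; rewrite ?subr0 ?subrr ?mul0r ?normr0 ?mul1r.
have -> : psi = fun x => psi1 x + psi2 x by apply/funext => x; rewrite /psi1 /psi2; ring.
have -> : (\int[lt p]_t `|psi1 (rvec t) + psi2 (rvec t)|)%R =
    (\int[lt p]_t `|psi1 (rvec t)|)%R + (\int[lt p]_t `|psi2 (rvec t)|)%R.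
  rewrite -RintegralD//; [|exact: (tintegrable_norm i1)|exact: (tintegrable_norm i2)].
  apply: eq_Rintegral => t _; rewrite /psi1 /psi2.
  by case: (ind01 (rvec t)) => ->; rewrite ?subr0 ?subrr !(mul0r,mul1r,normr0,add0r,addr0).
rewrite defectD// mulrDr mulrDr; apply: (le_trans (ler_normD _ _)); apply: lerD.
  apply: (@defect_local _ z) => // x; rewrite /psi1 mulf_eq0 negb_or indE => /andP[xU _].
  have /set_mem : x \in U by case: (x \in U) xU => //; rewrite eqxx.
  exact: ltW.
apply: IH => // x; rewrite /psi2 mulf_eq0 negb_or indE => /andP[xU /supp[y]].
rewrite inE => /orP[/eqP-> xz|yl xy]; last by exists y.
suff xU' : x \in U by rewrite xU' subrr eqxx in xU.
exact/mem_set.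
Qed.

(** A compact set is covered by finitely many balls of radius r, for every r,
    and the bound of [defect_cover] tends to 0 with r. *)
Lemma exchange (K : set X) psi : tintegrable psi -> compact K -> (forall x, psi x != 0 -> K x) ->
  v (slice_int psi F) = pint psi fslice.
Proof.
move=> ip cK supp; apply/eqP; rewrite -subr_eq0 -normr_le0.
have [B0 [K0 [B00 b]]] := rnet_bound_le k.+1 bF.
pose B := B0 * 2^-1^-1 ^+ K0.
have {}b s z : (size s <= k.+1)%N -> `|ipartial s F z| <= B.
  by move=> sk; exact: (b s 2^-1 z sk (half01 R)).
pose Q := 2 * (c * (B * (p + m)%:R) * (\int[lt p]_t `|psi (rvec t)|)%R).
apply/ler_addgt0Pr => d d0; rewrite add0r.
have Q0 : 0 <= Q.
  have B0' : 0 <= B by apply: le_trans (b [::] 0 _).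
  rewrite !mulr_ge0//; first exact: (functional_c fv).
  by apply: Rintegral_ge0 => t _.
pose r := d / (Q + 1).
have r0 : 0 < r by rewrite divr_gt0// ltr_wpDl.
have [l Kl] : exists l : seq X, forall x, K x -> exists2 z, z \in l & `|x - z| < r.
  move: cK; rewrite compact_cover => cK.
  have [||D _ KD] := cK X setT (ball ^~ r); first by move=> x _; exact: ball_open.
    by move=> x _; exists x => //; exact: ballxx.
  exists (finmap.enum_fset D) => x /KD[z /= zD]; rewrite -ball_normE/= distrC => xz.
  by exists z.
apply: (@le_trans _ _ (2 * (c * (B * ((p + m)%:R * r)) * (\int[lt p]_t `|psi (rvec t)|)%R))).
  by apply: (@defect_cover _ _ l) => //; [exact: ltW|move=> x /supp/Kl].
rewrite (_ : _ * _ = Q * r); last by rewrite /Q; ring.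
rewrite /r mulrCA -[leRHS]mulr1 ler_wpM2l ?(ltW d0)//.
by rewrite ler_pdivrMr ?mul1r ?lerDl// ltr_wpDl.
Qed.

End functional.
End exchange.

(** * Smooth cutoff functions *)

Section bump1.
Variable R : realType.
Implicit Types (g h : R -> R) (t : R).

Definition smooth1_class (C : set (R -> R)) := forall g, C g ->
  exists2 g', C g' & forall t, is_derive t 1 g (g' t).

(** Infinitely differentiable functions of one real variable, as a class
    stable under the derivative. *)
Definition smooth1 g := exists2 C, smooth1_class C & C g.

Lemma smooth1_is_class : smooth1_class smooth1.
Proof.
by move=> g [C sC /sC[g' Cg' d]]; exists g' => //; exists C.
Qed.

(** The functions t^-k exp(-1/t) extended by 0 for t <= 0. The derivative of
    one of them is a combination of two others, which makes all of them
    smooth, also at 0. *)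
Definition bexp k t : R := if 0 < t then t^-1 ^+ k * expR (- t^-1) else 0.

Inductive bexp_span : set (R -> R) :=
| bexp_base k : bexp_span (bexp k)
| bexp_lin (a : R) f g : bexp_span f -> bexp_span g -> bexp_span (fun t => a * f t + g t).

Lemma exprn_le_expR k (s : R) : 0 <= s -> s ^+ k <= k%:R ^+ k * expR s.
Proof.
move=> s0; case: k => [|k]; first by rewrite !expr0 mul1r -expR0 ler_expR.
have k0 : 0 < k.+1%:R :> R by rewrite ltr0n.
(* 1 + s / k <= exp(s / k), raised to the power k *)
have h : s <= k.+1%:R * expR (s / k.+1%:R).
  rewrite -ler_pdivrMl// mulrC; apply: le_trans (expR_ge1Dx _); by rewrite lerDr.
apply: (@le_trans _ _ ((k.+1%:R * expR (s / k.+1%:R)) ^+ k.+1)).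
  by apply: lerXn2r => //; rewrite nnegrE// (le_trans s0).
by rewrite exprMn -expRM_natl mulrCA divff ?mulr1// gt_eqF.
Qed.

(** From s^n <= n^n exp(s) at s = 1/t. The factor t^2 is what gives the
    derivative 0 at the origin. *)
Lemma bexp_le k t : `|bexp k t| <= (k + 2)%:R ^+ (k + 2) * `|t| ^+ 2.
Proof.
rewrite /bexp; case: ifP => [t0|_]; last by rewrite normr0 mulr_ge0// exprn_ge0.
have i0 : 0 <= t^-1 by rewrite invr_ge0 ltW.
rewrite ger0_norm ?mulr_ge0 ?exprn_ge0 ?expR_ge0// gtr0_norm//.
have h := exprn_le_expR (k + 2) i0.
rewrite expRN ler_pdivrMr ?expR_gt0// mulrAC -ler_pdivrMr ?exprn_gt0//.
by rewrite -exprVn -exprD.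
Qed.

Lemma bexp_derive k t :
  is_derive t 1 (bexp k) (- k%:R * bexp k.+1 t + bexp k.+2 t).
Proof.
have [t0|t0|->] := ltgtP t 0.
- have -> : - k%:R * bexp k.+1 t + bexp k.+2 t = 0.
    by rewrite /bexp ltNge (ltW t0)/= mulr0 addr0.
  apply: (@near_eq_is_derive _ _ _ (fun=> 0 : R)).
    by near=> s; rewrite /bexp ltNge (_ : s <= 0)//; near: s; exact: lt_le_nbhsl.
- have iV : is_derive t 1 (fun s : R => s^-1) (- t^-1 ^+ 2).
    apply: (is_derive_eq (is_deriveV (f := fun s : R => s) (lt0r_neq0 t0) (is_derive_id t 1))).
    by rewrite exprVn /GRing.scale/= mulr1.
  have eV : is_derive t 1 (fun s : R => expR (- s^-1)) (t^-1 ^+ 2 * expR (- t^-1)).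
    apply: (is_derive_eq (is_derive1_comp (f := @expR R) (is_derive_expR _) (is_deriveN iV))).
    by rewrite opprK mulrC.
  apply: (@near_eq_is_derive _ _ _ (fun s : R => s^-1 ^+ k * expR (- s^-1))).
    by near=> s; rewrite /bexp (_ : 0 < s)//; near: s; exact: lt_nbhsr.
  apply: (is_derive_eq (is_derive_mul (is_derive_pow k iV) eV)).
  by rewrite /bexp t0; case: k => [|k]/=; rewrite !exprS; ring.
- apply: (@is_derive_quad _ _ _ _ ((k + 2)%:R ^+ (k + 2)) 1 ltr01) => h _.
  by rewrite /bexp ltxx !mulr0 !addr0 mulr0 !subr0; exact: bexp_le.
Unshelve. all: by end_near. Qed.

Lemma bexp_smooth1 k : smooth1 (bexp k).
Proof.
exists bexp_span; last exact: bexp_base.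
move=> g; elim=> [{}k|a f {}g _ [f' sf df] _ [g' sg dg]].
  exists (fun t => - k%:R * bexp k.+1 t + bexp k.+2 t); last exact: bexp_derive.
  by apply: bexp_lin; exact: bexp_base.
exists (fun t => a * f' t + g' t); first exact: bexp_lin.
by move=> t; apply: is_deriveD; apply: is_deriveZ.
Qed.

End bump1.

Section bump.
Variables (R : realType) (m : nat).
Local Notation V := 'rV[R]_m.
Local Notation e_ i := (delta_mx 0 i : V).

(** By the chain rule the sums of products of functions h o f, with h in the
    one-variable class, by smooth functions form a class. *)
Lemma smooth1_comp (h : R -> R) (f : V -> R) : smooth1 h -> smooth_real setT f ->
  smooth_real setT (fun x => h (f x)).
Proof.
move=> sh sf.
pose A : set (V -> R) := [set g | exists2 h, smooth1 h & g = fun x => h (f x)].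
have s1 : smooth_real setT (fun _ : V => 1 : R) by exact: smooth_cst openT.
have -> : (fun x => h (f x)) = (fun x => h (f x) * 1) by apply/funext => x; rewrite mulr1.
apply: (@smooth_classP _ _ (prodspan A (smooth_real setT))); last first.
  by apply: prodspan1 => //; exists h.
move=> g; elim=> [_ b [{sh}h sh ->] sb|f1 f2 _ [c1 d1] _ [c2 d2]]; last first.
  split => [x|i]; first by apply: (@continuousD R R V); [exact: c1|exact: c2].
  have [g1 [P1 D1]] := d1 i; have [g2 [P2 D2]] := d2 i.
  exists (fun x => g1 x + g2 x); split; first exact: prodspanD.
  by move=> x; apply: is_deriveD.
have [h' sh' dh] := smooth1_is_class sh.
split => [x|i].
  apply: (@continuousM R V); last exact: (smooth_continuous sb).
  apply: (@continuous_comp _ _ _ f h); first exact: (smooth_continuous sf).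
  exact: derive_cont1 (dh (f x)).
exists (fun x => h' (f x) * (ipartial [:: i] f x * b x) + h (f x) * ipartial [:: i] b x); split.
  apply: prodspanD; apply: prodspan1.
  - by exists h'.
  - exact: (smoothM (smooth_ipartial [:: i] sf) sb).
  - by exists h.
  - exact: (smooth_ipartial [:: i] sb).
move=> x; rewrite mulrA.
have D : is_derive x (e_ i) (fun y => h (f y)) (h' (f x) * ipartial [:: i] f x).
  apply/is_derive_line0; have /is_derive_line0 D1 := smooth_has_partials sf i x.
  have D2 := dh (f ((0 : R) *: e_ i + x)).
  have := @is_derive1_comp _ h (fun t : R => f (t *: e_ i + x)) 0 _ _ D2 D1.
  by rewrite scale0r add0r.
exact: (is_derive_mul D (smooth_has_partials sb i x)).
Qed.

Lemma smooth_sum (I : Type) (r : seq I) (F : I -> V -> R) :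
  (forall i, smooth_real setT (F i)) -> smooth_real setT (fun x => \sum_(i <- r) F i x).
Proof.
move=> sF; elim: r => [|i r IH].
  rewrite (_ : (fun x => _) = fun=> 0); first exact: smooth_cst openT.
  by apply/funext => x; rewrite big_nil.
rewrite (_ : (fun x => _) = fun x => 1 * F i x + \sum_(j <- r) F j x).
  exact: (smooth_lin 1 openT (sF i) IH).
by apply/funext => x; rewrite big_cons mul1r.
Qed.

Lemma norm_coord_ge (x : V) (d : R) : 0 < d -> d <= `|x| -> exists i, d <= `|x 0 i|.
Proof.
move=> d0 dx; apply: contrapT => /forallNP h; move: dx; apply/negP; rewrite -ltNge.
rewrite [ltLHS]/Num.norm/= mx_normrE; apply: bigmax_lt => //= -[i j] _/=.
by rewrite ord1 ltNge; apply/negP; exact: h.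
Qed.

(** With eta(t) = exp(-1/t) for t > 0 and 0 for t <= 0, the function t |->
    eta(eta 1 - eta t) / eta(eta 1) equals 1 for t <= 0 and 0 for t >= 1; it
    is applied to |y - c|^2 / s^2 - 1, with the Euclidean norm. The constants
    m.+1 compare that norm with the maximum norm. *)
Lemma smooth_bump (c : V) (r : R) : 0 < r -> exists chi : V -> R,
  [/\ smooth_real setT chi, forall y, `|y - c| <= r -> chi y = 1 &
      forall y, 2 * m.+1%:R * r <= `|y - c| -> chi y = 0].
Proof.
move=> r0; pose s := m.+1%:R * r; have s0 : 0 < s by rewrite mulr_gt0.
pose q (y : V) : R := s^-1 ^+ 2 * (\sum_i (y 0 i - c 0 i) * (y 0 i - c 0 i)) + -1.
pose eta := @bexp R 0.
have e1 : 0 < eta 1 by rewrite /eta /bexp ltr01 mul1r expR_gt0.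
have e2 : 0 < eta (eta 1) by rewrite /eta /bexp e1 mul1r expR_gt0.
have etaN t : t <= 0 -> eta t = 0 by move=> t0; rewrite /eta /bexp ltNge t0.
have eta1 t : 1 <= t -> eta 1 <= eta t.
  move=> t1; have t0 : 0 < t := lt_le_trans ltr01 t1.
  by rewrite /eta /bexp ltr01 t0 !mul1r ler_expR lerN2 invr1 invf_le1.
have sq : smooth_real setT q.
  have sc i : smooth_real setT (fun y : V => y 0 i - c 0 i).
    rewrite (_ : (fun y : V => _) = fun y : V => 1 * y 0 i + - c 0 i).
      exact: (smooth_lin 1 openT (@smooth_coord R m i) (smooth_cst (- c 0 i) openT)).
    by apply/funext => y; rewrite mul1r.
  apply: (smooth_lin (s^-1 ^+ 2) openT _ (smooth_cst (-1) openT)).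
  by apply: smooth_sum => i; exact: smoothM.
exists (fun y => (eta (eta 1))^-1 * eta (-1 * eta (q y) + eta 1) + 0); split.
- have seta := @bexp_smooth1 R 0.
  apply: (smooth_lin _ openT _ (smooth_cst 0 openT)); apply: (smooth1_comp seta).
  by apply: (smooth_lin _ openT _ (smooth_cst (eta 1) openT)); exact: smooth1_comp.
- move=> y yr; rewrite addr0 (etaN (q y)) ?mulr0 ?add0r ?mulVf ?(gt_eqF e2)//.
  rewrite /q subr_le0 exprVn mulrC ler_pdivrMr ?exprn_gt0// mul1r.
  apply: (@le_trans _ _ (\sum_(i < m) r ^+ 2)).
    apply: ler_sum => i _; rewrite -expr2 -real_normK ?num_real//.
    apply: lerXn2r; rewrite ?nnegrE ?(ltW r0)//; apply: le_trans yr.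
    by have := coord_le_norm (y - c) i; rewrite !mxE.
  rewrite sumr_const card_ord /s exprMn -[leLHS]mulr_natl ler_wpM2r ?sqr_ge0//.
  rewrite expr2 -natrM ler_nat; lia.
- move=> y yr; rewrite (etaN (-1 * eta (q y) + eta 1)) ?mulr0 ?addr0// mulN1r addrC subr_le0; apply: eta1.
  rewrite /q -lerBlDr opprK -[1 + 1]/(2 : R).
  have [i hi] : exists i, 2 * s <= `|(y - c) 0 i|.
    by apply: norm_coord_ge; [rewrite mulr_gt0|rewrite /s mulrA].
  rewrite exprVn mulrC ler_pdivlMr ?exprn_gt0//.
  apply: (@le_trans _ _ ((y 0 i - c 0 i) * (y 0 i - c 0 i))); last first.
    by rewrite (bigD1 i)//= lerDl sumr_ge0// => j _; rewrite -expr2 sqr_ge0.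
  have h2 : (2 * s) ^+ 2 <= `|(y - c) 0 i| ^+ 2.
    by apply: lerXn2r => //; rewrite nnegrE// mulr_ge0// ltW.
  move: h2; rewrite !mxE real_normK ?num_real// => h2; rewrite -expr2.
  by have := sqr_ge0 s; rewrite exprMn in h2; lra.
Qed.

End bump.

(** * Oscillatory integrals and vanishing moments *)

Section osc.
Variables (R : realType) (n : nat).
Local Notation V := 'rV[R]_n.
Local Notation N := (n + n + 1)%N.
Local Notation H := 'rV[R]_N.
Local Notation Rm := (measurableTypeR R).
Local Notation lt m := (lebesgue_tuple R m).
Local Notation e_ i := (delta_mx 0 i : V).
Local Notation iz := (@iz n).
Local Notation ix := (@ix n).
Local Notation it := (@it n).
Implicit Types (rho : H -> R) (f : V -> R) (th e c : R) (x : V) (a : H).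

(** A Schwartz function all of whose moments vanish. Moments are indexed by
    sequences of coordinates rather than by multi-indices, so that
    multiplication by a coordinate is a cons. *)
Definition flat rho := rschwartz rho /\
  forall s : seq 'I_N, (\int[lt N]_t ((\prod_(i <- s) rvec t 0 i) * rho (rvec t)) = 0)%R.

(** The moment condition of the statement, for one real component of rho:
    integral c and no other moment. *)
Definition mass c rho := [/\ rschwartz rho, (\int[lt N]_t rho (rvec t) = c)%R &
  forall i, flat (fun a => a 0 i * rho a)].

Lemma flat_coord rho i : flat rho -> flat (fun a => a 0 i * rho a).
Proof.
move=> [sr m0]; split; first exact: rschwartz_coord.
move=> s; rewrite -[RHS](m0 (i :: s)); apply: eq_Rintegral => t _.
by rewrite big_cons; ring.
Qed.

(** The phase after the substitution a -> e a; for e = 1 it is the phase of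
    the representation itself. *)
Definition osc_phase e x a : R := - (2 * pi) * e *
  (a 0 it + \sum_i a 0 (ix i) * (x 0 i + 2^-1 * e * a 0 (iz i))).

(** The integrand of hatpi(rho_e) f (x) after that substitution, up to the
    angle th. *)
Definition wave rho f th e x a : R := rho a * cos (osc_phase e x a + th) * f (e *: hpos a + x).

(** Integrands that arise from [wave] by differentiation in e and x:
    coordinates of x and powers of e may appear as factors, coordinates of a
    are absorbed in rho. *)
Inductive wspan : (R -> V -> H -> R) -> Prop :=
| ws_base rho f th of flat rho & bsmooth f : wspan (wave rho f th)
| ws_lin c k k' of wspan k & wspan k' : wspan (fun e x a => c * k e x a + k' e x a)
| ws_e k of wspan k : wspan (fun e x a => e * k e x a)
| ws_x i k of wspan k : wspan (fun e x a => x 0 i * k e x a).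

Lemma ws_sum (I : Type) (r : seq I) (F : I -> R -> V -> H -> R) k0 :
  wspan k0 -> (forall i, wspan (F i)) -> wspan (fun e x a => \sum_(i <- r) F i e x a + k0 e x a).
Proof.
move=> w0 wF; elim: r => [|i r IH].
  rewrite (_ : (fun e x a => _) = k0)//.
  by apply/funext => e; apply/funext => x; apply/funext => a; rewrite big_nil add0r.
rewrite (_ : (fun e x a => _) = fun e x a => 1 * F i e x a + (\sum_(j <- r) F j e x a + k0 e x a)).
  exact: ws_lin.
by apply/funext => e; apply/funext => x; apply/funext => a; rewrite big_cons mul1r addrA.
Qed.

Lemma ws_Z c k : wspan k -> wspan (fun e x a => c * k e x a).
Proof.
move=> wk; rewrite (_ : (fun e x a => _) = fun e x a => (c - 1) * k e x a + k e x a); first exact: ws_lin.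
by apply/funext => e; apply/funext => x; apply/funext => a; ring.
Qed.

Lemma is_derive_osc_e e x a : is_derive e 1 (fun e => osc_phase e x a)
  (- (2 * pi) * (a 0 it + \sum_i a 0 (ix i) * (x 0 i + e * a 0 (iz i)))).
Proof.
pose A := a 0 it + \sum_i a 0 (ix i) * x 0 i; pose B := \sum_i a 0 (ix i) * a 0 (iz i).
have E e' : osc_phase e' x a = - (2 * pi) * (e' * A + 2^-1 * (e' * e' * B)).
  rewrite /osc_phase /A /B.
  under eq_bigr do rewrite mulrDr.
  rewrite big_split/=.
  have -> : \sum_i a 0 (ix i) * (2^-1 * e' * a 0 (iz i)) = 2^-1 * e' * \sum_i a 0 (ix i) * a 0 (iz i).
    by rewrite mulr_sumr; apply: eq_bigr => i _; ring.
  by ring.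
rewrite (_ : (fun e => _) = fun e => - (2 * pi) * (e * A + 2^-1 * (e * e * B))); last exact/funext.
have i1 := is_derive_id e (1 : R).
have dA := is_derive_mul i1 (is_derive_cst A e 1).
have dB := is_derive_mul (is_derive_mul i1 i1) (is_derive_cst B e 1).
have d2 := is_derive_mul (is_derive_cst (2^-1 : R) e 1) dB.
apply: (is_derive_eq (is_derive_mul (is_derive_cst (- (2 * pi) : R) e 1) (is_deriveD dA d2))).
under [in RHS]eq_bigr do rewrite mulrDr.
rewrite big_split/= [X in _ = _ * X]addrA -/A mul0r add0r.
have -> : \sum_i a 0 (ix i) * (e * a 0 (iz i)) = e * B.
  by rewrite mulr_sumr; apply: eq_bigr => i _; ring.
by field.
Qed.

Lemma is_derive_osc_x e x a j (h : R) : is_derive h 1 (fun h => osc_phase e (h *: e_ j + x) a)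
  (- (2 * pi) * e * a 0 (ix j)).
Proof.
rewrite (_ : (fun h => _) = fun h => (- (2 * pi) * e * a 0 (ix j)) * h + osc_phase e x a); last first.
  apply/funext => h'; rewrite /osc_phase.
  have -> : \sum_i a 0 (ix i) * ((h' *: e_ j + x) 0 i + 2^-1 * e * a 0 (iz i)) =
     h' * a 0 (ix j) + \sum_i a 0 (ix i) * (x 0 i + 2^-1 * e * a 0 (iz i)).
    rewrite (bigD1 j)//= [X in _ = _ + X](bigD1 j)//= !mxE !eqxx/= mulr1 addrA; congr (_ + _); first by ring.
    by apply: eq_bigr => i ij; rewrite !mxE (negbTE ij) andbF mulr0 add0r.
  by ring.
have D := is_derive_mul (is_derive_cst (- (2 * pi) * e * a 0 (ix j)) h 1) (is_derive_id h (1 : R)).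
apply: (is_derive_eq (is_deriveD D (is_derive_cst (osc_phase e x a) h 1))).
by rewrite mul0r add0r mulr1 addr0.
Qed.

(** The derivative of the phase and the derivative of f(x + e z) only produce
    factors that are coordinates of a, times coordinates of x or e. *)
Lemma wave_de rho f th : rschwartz rho -> (forall i, flat (fun a => a 0 i * rho a)) -> bsmooth f ->
  exists2 k, wspan k & forall e x a, is_derive e 1 (fun e => wave rho f th e x a) (k e x a).
Proof.
move=> sr fr bf.
pose th' := th + pi / 2.
pose k0 := fun e x a => - (2 * pi) * wave (fun a => a 0 it * rho a) f th' e x a.
pose F i := fun e x a => - (2 * pi) * (x 0 i * wave (fun a => a 0 (ix i) * rho a) f th' e x a) +
   (- (2 * pi) * (e * wave (fun a => a 0 (iz i) * (a 0 (ix i) * rho a)) f th' e x a) +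
    wave (fun a => a 0 (iz i) * rho a) (ipartial [:: i] f) th e x a).
exists (fun e x a => \sum_(i <- enum 'I_n) F i e x a + k0 e x a).
  apply: ws_sum; first by apply: ws_Z; exact: ws_base.
  move=> i; apply: ws_lin; first by apply: ws_x; exact: ws_base.
  apply: ws_lin; first by apply: ws_e; apply: ws_base => //; exact: flat_coord.
  by apply: ws_base => //; exact: bsmooth_partial.
move=> e x a.
have hp := smooth_has_partials (bsmooth_smooth bf).
have cp i : continuous (ipartial [:: i] f).
  exact: smooth_continuous (bsmooth_smooth (bsmooth_partial i bf)).
have df : is_derive e 1 (fun e : R => f (e *: hpos a + x))
    (\sum_i hpos a 0 i * ipartial [:: i] f (e *: hpos a + x)).
  exact: (proj1 (@is_derive_line R n _ _ _ _ _) (gradient (e *: hpos a + x) (hpos a) hp cp)).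
have dc := cos_shift th (is_derive_osc_e e x a).
have dr := is_derive_mul (is_derive_cst (rho a) e 1) dc.
apply: (is_derive_eq (is_derive_mul dr df)).
rewrite big_enum/= /k0 /F /wave -/th'.
set cs := cos (osc_phase e x a + th'); set c0 := cos (osc_phase e x a + th).
set fx := f (e *: hpos a + x).
under [in RHS]eq_bigr => i _.
  rewrite (_ : _ + _ = - (2 * pi) * rho a * cs * fx * (a 0 (ix i) * (x 0 i + e * a 0 (iz i))) +
     rho a * c0 * (hpos a 0 i * ipartial [:: i] f (e *: hpos a + x))); last by rewrite !mxE; ring.
  over.
rewrite big_split/= -!mulr_sumr.
by ring.
Qed.

Lemma wave_dx rho f th i : rschwartz rho -> (forall i, flat (fun a => a 0 i * rho a)) -> bsmooth f ->
  exists2 k, wspan k & forall e x a, is_derive x (e_ i) (fun x => wave rho f th e x a)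
    (wave rho (ipartial [:: i] f) th e x a + k e x a).
Proof.
move=> sr fr bf; pose th' := th + pi / 2.
exists (fun e x a => - (2 * pi) * (e * wave (fun a => a 0 (ix i) * rho a) f th' e x a)).
  by apply: ws_Z; apply: ws_e; exact: ws_base.
move=> e x a; apply/is_derive_line0.
have hp := smooth_has_partials (bsmooth_smooth bf) i (e *: hpos a + x).
have df : is_derive (0 : R) 1 (fun h : R => f (e *: hpos a + (h *: e_ i + x)))
    (ipartial [:: i] f (e *: hpos a + x)).
  by move: hp => /is_derive_line0; congr is_derive; apply/funext => h; rewrite addrCA.
have dc := cos_shift th (is_derive_osc_x e x a i 0).
have dr := is_derive_mul (is_derive_cst (rho a) (0 : R) 1) dc.
apply: (is_derive_eq (is_derive_mul dr df)).
by rewrite scale0r add0r /wave /th' /cst /=; ring.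
Qed.

Lemma wspan_de k : wspan k ->
  exists2 k', wspan k' & forall e x a, is_derive e 1 (fun e => k e x a) (k' e x a).
Proof.
elim=> [rho f th fr bf|c k1 k2 _ [k1' w1 d1] _ [k2' w2 d2]|k1 w [k1' w1 d1]|i k1 w [k1' w1 d1]].
- by apply: wave_de => //; [case: fr|move=> i; exact: flat_coord].
- exists (fun e x a => c * k1' e x a + k2' e x a); first exact: ws_lin.
  by move=> e x a; apply: is_deriveD; apply: is_deriveZ.
- exists (fun e x a => 1 * k1 e x a + e * k1' e x a); first by apply: ws_lin => //; exact: ws_e.
  by move=> e x a; exact: (is_derive_mul (is_derive_id e (1 : R)) (d1 e x a)).
- exists (fun e x a => x 0 i * k1' e x a); first exact: ws_x.
  by move=> e x a; apply: is_deriveZ.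
Qed.

Lemma wspan_dx j k : wspan k ->
  exists2 k', wspan k' & forall e x a, is_derive x (e_ j) (fun x => k e x a) (k' e x a).
Proof.
elim=> [rho f th fr bf|c k1 k2 _ [k1' w1 d1] _ [k2' w2 d2]|k1 w [k1' w1 d1]|i k1 w [k1' w1 d1]].
- have [k3 wk dk] := wave_dx th j (proj1 fr) (fun i => flat_coord i fr) bf.
  exists (fun e x a => 1 * wave rho (ipartial [:: j] f) th e x a + k3 e x a).
    by apply: ws_lin => //; apply: ws_base => //; exact: bsmooth_partial.
  by move=> e x a; rewrite mul1r.
- exists (fun e x a => c * k1' e x a + k2' e x a); first exact: ws_lin.
  by move=> e x a; apply: is_deriveD; apply: is_deriveZ.
- exists (fun e x a => e * k1' e x a); first exact: ws_e.
  by move=> e x a; apply: is_deriveZ.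
- exists (fun e x a => (j == i)%:R * k1 e x a + x 0 i * k1' e x a).
    by apply: ws_lin => //; exact: ws_x.
  by move=> e x a; exact: (is_derive_mul (is_derive_coord j i x) (d1 e x a)).
Qed.

Lemma hpos_le a b : `|hpos a - hpos b| <= `|a - b|.
Proof.
rewrite [leLHS]/Num.norm/= mx_normrE; apply: bigmax_le => // -[i j] _ /=.
rewrite !mxE ord1; apply: le_trans (coord_le_norm (a - b) (iz j)); by rewrite !mxE.
Qed.

Lemma shift_continuous f (e : R) x : continuous f -> continuous (fun a : H => f (e *: hpos a + x)).
Proof.
move=> cf a; apply/(@continuous_epsP R H) => d d0.
have /(@continuous_epsP R V) /(_ d d0)[r r0 hr] := cf (e *: hpos a + x).
have e1 : 0 < `|e| + 1 by rewrite ltr_wpDl.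
exists (r / (`|e| + 1)) => [|b ba]; first by rewrite divr_gt0.
apply: hr; rewrite opprD addrACA subrr addr0 -scalerBr normrZ.
apply: le_lt_trans (_ : (`|e| + 1) * `|b - a| < _); last by rewrite mulrC -ltr_pdivlMr.
by apply: ler_pM => //; [rewrite lerDl|exact: hpos_le].
Qed.

Lemma measurable_wave rho f th e x : continuous rho -> continuous f ->
  measurable_fun setT (fun t : N.-tuple Rm => wave rho f th e x (rvec t)).
Proof.
move=> cr cf; apply: measurable_funM; last first.
  exact: (measurable_continuous (@shift_continuous f e x cf)).
apply: measurable_funM; first exact: measurable_continuous.
apply: measurableT_comp; first by apply: continuous_measurable_fun; exact: continuous_cos.
apply: measurable_funD => //; apply: measurable_funM => //; apply: measurable_funD.
  by under eq_fun do rewrite rvecE; exact: measurable_tnth.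
apply: measurable_sum => i; apply: measurable_funM.
  by under eq_fun do rewrite rvecE; exact: measurable_tnth.
apply: measurable_funD => //; apply: measurable_funM => //.
by under eq_fun do rewrite rvecE; exact: measurable_tnth.
Qed.

Lemma wave_le rho f th (C B : R) e x a : (forall a, `|rho a| <= C * weight a) ->
  (forall x, `|f x| <= B) -> `|wave rho f th e x a| <= C * B * weight a.
Proof.
move=> hr hf; rewrite /wave !normrM [leRHS]mulrAC; apply: ler_pM => //.
apply: le_trans (hr a).
by rewrite -[leRHS]mulr1 ler_wpM2l// ler_norml cos_geN1 cos_le1.
Qed.

Lemma wspan_measurable k e x : wspan k ->
  measurable_fun setT (fun t : N.-tuple Rm => k e x (rvec t)).
Proof.
elim=> [rho f th [sr _] bf|c k1 k2 _ m1 _ m2|k1 _ m1|i k1 _ m1].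
- apply: measurable_wave; first exact: rschwartz_continuous.
  exact: smooth_continuous (bsmooth_smooth bf).
- by apply: measurable_funD => //; exact: measurable_funM.
- exact: measurable_funM.
- exact: measurable_funM.
Qed.

(** The bound |e| <= 2 leaves room to differentiate at every |e| <= 1. *)
Lemma wspan_le k (r : R) : wspan k -> exists2 C : R, 0 <= C & forall e x a,
  `|e| <= 2 -> (forall i, `|x 0 i| <= r) -> `|k e x a| <= C * weight a.
Proof.
elim=> [rho f th [sr _] bf|c k1 k2 _ [C1 C10 b1] _ [C2 C20 b2]|k1 _ [C1 C10 b1]|i k1 _ [C1 C10 b1]].
- have [C C0 hC] := rschwartz_weight sr; have [B B0 hB] := bsmooth_bound bf.
  by exists (C * B); [rewrite mulr_ge0|move=> e x a _ _; exact: wave_le].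
- exists (`|c| * C1 + C2) => [|e x a he hx]; first by rewrite addr_ge0// mulr_ge0.
  rewrite mulrDl (le_trans (ler_normD _ _))// lerD ?b2// normrM -mulrA.
  by rewrite ler_wpM2l// b1.
- exists (2 * C1) => [|e x a he hx]; first by rewrite mulr_ge0.
  by rewrite normrM -mulrA ler_pM// b1.
- exists (`|r| * C1) => [|e x a he hx]; first by rewrite mulr_ge0.
  by rewrite normrM -mulrA ler_pM// ?b1// (le_trans (hx i))// ler_norm.
Qed.

Definition wint (k : R -> V -> H -> R) e x : R := (\int[lt N]_t k e x (rvec t))%R.

Lemma coords_bounded x : exists r : R, forall i, `|x 0 i| <= r.
Proof. by exists `|x| => i; exact: coord_le_norm. Qed.

Lemma wspan_integrable k e x : wspan k -> `|e| <= 2 ->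
  (lt N).-integrable setT (fun t => (k e x (rvec t))%:E).
Proof.
move=> wk e2; have [r hx] := coords_bounded x; have [C _ hC] := wspan_le r wk.
apply: (integrable_dom (C := C)); first exact: wspan_measurable.
by move=> a; exact: hC.
Qed.

Lemma wave_integrable rho f th e x : rschwartz rho -> bsmooth f ->
  (lt N).-integrable setT (fun t => (wave rho f th e x (rvec t))%:E).
Proof.
move=> sr bf; have [C C0 hC] := rschwartz_weight sr; have [B B0 hB] := bsmooth_bound bf.
apply: (integrable_dom (C := C * B)); last by move=> a; exact: wave_le.
apply: measurable_wave; first exact: rschwartz_continuous.
exact: smooth_continuous (bsmooth_smooth bf).
Qed.

Lemma wint_de k k' rho f th e x : wspan k' -> `|e| <= 1 ->
  (wspan k \/ [/\ rschwartz rho, bsmooth f & k = wave rho f th]) ->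
  (forall e x a, is_derive e 1 (fun e => k e x a) (k' e x a)) ->
  is_derive e 1 (fun e => wint k e x) (wint k' e x).
Proof.
move=> wk' e1 hk d; have [r hx] := coords_bounded x; have [C _ hC] := wspan_le r wk'.
have e2 t : `|t - e| < 1 -> `|t| <= 2.
  by move=> te; rewrite -(subrK e t) (le_trans (ler_normD _ _))// -[2]/(1 + 1 : R) lerD// ltW.
apply: (@is_derive_integral R _ _ (lt N) (fun e t => k e x (rvec t)) (fun e t => k' e x (rvec t))
  (fun t => C * weight (rvec t)) e 1 ltr01).
- move=> t /e2 t2; case: hk => [wk|[sr bf ->]]; [exact: wspan_integrable|exact: wave_integrable].
- by have := integrableZl measurableT C (integrable_weight R N); apply: eq_integrable => // t _; rewrite EFinM.
- by move=> t q /e2 t2; exact: hC.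
Qed.

Lemma wint_dx k k' rho f th e x i : `|e| <= 1 ->
  (wspan k \/ [/\ rschwartz rho, bsmooth f & k = wave rho f th]) ->
  (wspan k' \/ exists k'', [/\ wspan k'', rschwartz rho, bsmooth f &
     k' = fun e x a => wave rho (ipartial [:: i] f) th e x a + k'' e x a]) ->
  (forall e x a, is_derive x (e_ i) (fun x => k e x a) (k' e x a)) ->
  is_derive x (e_ i) (fun x => wint k e x) (wint k' e x).
Proof.
move=> e1 hk hk' d; have [r hx] := coords_bounded x.
have e2 : `|e| <= 2 by rewrite (le_trans e1)// ler1n.
have hx1 (t : R) j : `|t| < 1 -> `|(t *: e_ i + x) 0 j| <= r + 1.
  move=> t1; rewrite !mxE addrC (le_trans (ler_normD _ _))// lerD// normrM.
  by rewrite (le_trans _ (ltW t1))// -[leRHS]mulr1 ler_wpM2l// eqxx/=; case: (_ == _); rewrite ?normr1 ?normr0.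
(* along the segment the coordinates of x are bounded by r + 1 *)
have [C hC] : exists C : R, forall t a, `|t| < 1 -> `|k' e (t *: e_ i + x) a| <= C * weight a.
  case: hk' => [wk'|[k'' [wk'' sr bf ->]]].
    have [C _ hC] := wspan_le (r + 1) wk'; exists C => t a t1; apply: hC => // j; exact: hx1.
  have [C _ hC] := wspan_le (r + 1) wk''.
  have [D D0 hD] := rschwartz_weight sr; have [B B0 hB] := bsmooth_bound (bsmooth_partial i bf).
  exists (D * B + C) => t a t1; rewrite mulrDl (le_trans (ler_normD _ _))// lerD//; first exact: wave_le.
  by apply: hC => // j; exact: hx1.
apply/is_derive_line0.
have -> : wint k' e x = (\int[lt N]_t k' e ((0 : R) *: e_ i + x) (rvec t))%R by rewrite scale0r add0r.
apply: (@is_derive_integral R _ _ (lt N) (fun h t => k e (h *: e_ i + x) (rvec t))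
  (fun h t => k' e (h *: e_ i + x) (rvec t)) (fun t => C * weight (rvec t)) 0 1 ltr01).
- move=> t _; case: hk => [wk|[sr bf ->]]; [exact: wspan_integrable|exact: wave_integrable].
- by move=> t q _; exact: (proj1 (@is_derive_line R n _ _ _ _ _) (d e (t *: e_ i + x) (rvec q))).
- by have := integrableZl measurableT C (integrable_weight R N); apply: eq_integrable => // t _; rewrite EFinM.
- by move=> t q; rewrite subr0; exact: hC.
Qed.

Lemma wave0 rho f th x : rschwartz rho -> wint (wave rho f th) 0 x =
  (\int[lt N]_t rho (rvec t))%R * cos th * f x.
Proof.
move=> sr; have [C C0 hC] := rschwartz_weight sr.
have ir : (lt N).-integrable setT (fun t => (rho (rvec t))%:E).
  by apply: (integrable_dom _ hC); apply: measurable_continuous; exact: rschwartz_continuous.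
rewrite -mulrA -RintegralZr//; apply: eq_Rintegral => t _.
by rewrite /wave /osc_phase mulr0 mul0r add0r scale0r add0r mulrA.
Qed.

(** At e = 0 the phase vanishes and f is evaluated at x, so the integral is a
    moment of rho times a function of x. *)
Lemma wspan0 k x : wspan k -> wint k 0 x = 0.
Proof.
have z2 : `|0 : R| <= 2 by rewrite normr0.
elim=> [rho f th [sr fr] bf|c k1 k2 w1 m1 w2 m2|k1 w1 m1|i k1 w1 m1].
- rewrite wave0//; have := fr [::].
  by under eq_Rintegral do rewrite big_nil mul1r; move=> ->; rewrite !mul0r.
- have i1 := wspan_integrable x w1 z2; have i2 := wspan_integrable x w2 z2.
  rewrite /wint RintegralD//; last first.
    by have := integrableZl measurableT c i1; apply: eq_integrable => // t _; rewrite EFinM.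
  by rewrite RintegralZl// -!/(wint _ _ _) m1 m2 mulr0 addr0.
- have i1 := wspan_integrable x w1 z2.
  by rewrite /wint RintegralZl// mul0r.
- have i1 := wspan_integrable x w1 z2.
  by rewrite /wint RintegralZl// -/(wint _ _ _) m1 mulr0.
Qed.

Definition cvanish (g : R -> V -> R) := forall (M : nat) (r : R), exists2 C : R, 0 <= C &
  forall e x, `|e| <= 1 -> (forall i, `|x 0 i| <= r) -> `|g e x| <= C * `|e| ^+ M.

(** By induction on M: the integral vanishes at e = 0 and its derivative in e
    is of the same kind, so the mean value theorem gains one factor e. *)
Lemma wspan_small k : wspan k -> cvanish (wint k).
Proof.
move=> + M r; elim: M k => [|M IH] k wk.
  have [C C0 hC] := wspan_le r wk; exists (C * pi ^+ N) => [|e x e1 hx].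
    by rewrite mulr_ge0// exprn_ge0// pi_ge0.
  rewrite expr0 mulr1; apply: le_Rintegral_dom; first exact: wspan_measurable.
  by move=> a; apply: hC => //; rewrite (le_trans e1)// ler1n.
have [k' wk' d] := wspan_de wk; have [C C0 hC] := IH _ wk'.
exists C => // e x e1 hx.
have [|s [se E]] := @MVT1 R (fun e => wint k e x) (fun e => wint k' e x) e.
  move=> t te; apply: (@wint_de k k' (fun=> 0) (fun=> 0) 0) => //; last by left.
  exact: le_trans te e1.
rewrite wspan0// subr0 in E; rewrite E normrM exprS mulrCA ler_wpM2l//.
apply: (le_trans (hC s x (le_trans se e1) hx)); rewrite ler_wpM2l//.
by apply: lerXn2r; rewrite ?nnegrE.
Qed.

(** The difference between the approximation of f and its limit, and the terms
    that its derivatives produce. *)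
Inductive dfam : (R -> V -> R) -> Prop :=
| df_base rho c f th of mass c rho & bsmooth f :
    dfam (fun e x => wint (wave rho f th) e x - c * cos th * f x)
| df_wint k of wspan k : dfam (wint k)
| df_lin c g g' of dfam g & dfam g' : dfam (fun e x => c * g e x + g' e x).

(** The value at e = 0 cancels, and the derivative in e only involves rho
    multiplied by a coordinate, all of whose moments vanish. *)
Lemma dfam_small g : dfam g -> cvanish g.
Proof.
elim=> [rho c f th mr bf|k wk|c g1 g2 _ h1 _ h2] M r; last first.
- have [C1 C10 b1] := h1 M r; have [C2 C20 b2] := h2 M r.
  exists (`|c| * C1 + C2) => [|e x e1 hx]; first by rewrite addr_ge0// mulr_ge0.
  rewrite mulrDl (le_trans (ler_normD _ _))// lerD ?b2// normrM -mulrA.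
  by rewrite ler_wpM2l// b1.
- exact: wspan_small.
- have [sr m0 fr] := mr; have [k wk dk] := wave_de th sr fr bf.
  have [C C0 hC] := wspan_small wk M r; exists C => // e x e1 hx.
  have [|s [se E]] := @MVT1 R (fun e => wint (wave rho f th) e x) (fun e => wint k e x) e.
    move=> t te; apply: (@wint_de (wave rho f th) k rho f th) => //; last by right.
    exact: le_trans te e1.
  rewrite wave0// m0 in E; rewrite E normrM -[leRHS]mul1r ler_pM//.
  apply: (le_trans (hC s x (le_trans se e1) hx)); rewrite ler_wpM2l//.
  by apply: lerXn2r; rewrite ?nnegrE.
Qed.

(** A derivative in x falls on f, which gives a difference of the same kind,
    or on the phase, which gives a factor e xi_i and hence a term without
    moments. *)
Lemma dfam_dx i g : dfam g -> exists2 g', dfam g' &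
  forall e x, `|e| <= 1 -> is_derive x (e_ i) (g e) (g' e x).
Proof.
elim=> [rho c f th mr bf|k wk|c g1 g2 _ [g1' w1 d1] _ [g2' w2 d2]].
- have [sr m0 fr] := mr; have [k wk dk] := wave_dx th i sr fr bf.
  have bf' := bsmooth_partial i bf.
  exists (fun e x => 1 * (wint (wave rho (ipartial [:: i] f) th) e x - c * cos th * ipartial [:: i] f x) + wint k e x).
    by apply: df_lin; [exact: df_base|exact: df_wint].
  move=> e x e1.
  have e2 : `|e| <= 2 by rewrite (le_trans e1)// ler1n.
  have D : is_derive x (e_ i) (fun x => wint (wave rho f th) e x)
      (wint (fun e x a => wave rho (ipartial [:: i] f) th e x a + k e x a) e x).
    apply: (@wint_dx (wave rho f th) _ rho f th) => //; first by right.
    by right; exists k.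
  have E := smooth_has_partials (bsmooth_smooth bf) i x.
  apply: (is_derive_eq (is_deriveB D (is_deriveZ (c * cos th) E))).
  rewrite /wint RintegralD//; [|exact: wave_integrable|exact: wspan_integrable].
  by rewrite mul1r /GRing.scale/= addrAC.
- have [k' wk' d] := wspan_dx i wk; exists (wint k'); first exact: df_wint.
  by move=> e x e1; apply: (@wint_dx k k' (fun=> 0) (fun=> 0) 0) => //; left.
- exists (fun e x => c * g1' e x + g2' e x); first exact: df_lin.
  by move=> e x e1; apply: is_deriveD; [apply: is_deriveZ; exact: d1|exact: d2].
Qed.

Lemma dfam_ipartial_small g s (M : nat) (r : R) : dfam g -> exists2 C : R, 0 <= C &
  forall e x, 0 < e < 1 -> (forall i, `|x 0 i| <= r) -> `|ipartial s (g e) x| <= C * e ^+ M.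
Proof.
have E01 e : 0 < e < 1 -> `|e| <= 1 by move=> /andP[e0 e1]; rewrite gtr0_norm// ltW.
move=> dg; have [g' dg' E] : exists2 g', dfam g' & forall e, 0 < e < 1 -> ipartial s (g e) = g' e.
  elim: s => [|i s [g' dg' E]]; first by exists g.
  have [g'' dg'' d] := dfam_dx i dg'; exists g'' => // e e01.
  rewrite -cat1s ipartial_cat E//; apply: ipartial_eq => x; apply: d; exact: E01.
have [C C0 hC] := dfam_small dg' M r; exists C => // e x e01 hx.
by rewrite E// -[X in _ * X ^+ _]ger0_norm; [apply: hC => //; exact: E01|case/andP: e01 => /ltW].
Qed.

End osc.

(** * Moments, and the kernel integrals as oscillatory integrals *)

Section schwartz_hyp.
Variables (R : realType) (m : nat).
Local Notation V := 'rV[R]_m.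
Local Notation e_ i := (delta_mx 0 i : V).

Definition counts (s : seq 'I_m) : mindex m := [ffun i => count_mem i s].

Lemma mpow_counts (s : seq 'I_m) (x : V) : \prod_(i <- s) x 0 i = mpow x (counts s).
Proof.
elim: s => [|i s IH]; first by rewrite big_nil /mpow big1// => i _; rewrite ffunE.
rewrite big_cons IH /mpow [in RHS](bigD1 i)//= (bigD1 i)//= mulrA !ffunE/= eqxx -exprS; congr (_ * _).
by apply: eq_bigr => j ji; rewrite !ffunE/= eq_sym (negbTE ji).
Qed.

(** By Clairaut's theorem any sequence of derivatives may be sorted into the
    sequence of a multi-index. *)
Lemma mindex_seq_counts (s : seq 'I_m) : perm_eq s (mindex_seq (counts s)).
Proof.
apply/allP => i _ /=; apply/eqP.
rewrite /mindex_seq count_flatten -map_comp sumnE big_map big_enum/= (bigD1 i)//= big1 ?addn0.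
  by rewrite count_nseq/= eqxx mul1n ffunE.
by move=> j ji; rewrite count_nseq/= (negbTE ji).
Qed.

(** The Schwartz hypothesis bounds these functions, and the product rule shows
    that they are stable under derivatives. *)
Inductive weyl_span (g : V -> R) : (V -> R) -> Prop :=
| weyl_ipartial s : weyl_span g (ipartial s g)
| weyl_mul i h of weyl_span g h : weyl_span g (fun x => x 0 i * h x)
| weyl_lin (c : R) h h' of weyl_span g h & weyl_span g h' : weyl_span g (fun x => c * h x + h' x).

Lemma weyl_rschwartz (g : V -> R) : smooth_real setT g ->
  (forall s (l : seq 'I_m), exists B : R, forall x : V, `|(\prod_(i <- l) x 0 i) * ipartial s g x| <= B) -> rschwartz g.
Proof.
move=> sg bg; exists (weyl_span g); split; last exact: (weyl_ipartial g [::]).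
move=> h wh; split.
- suff : forall l : seq 'I_m, exists B : R, forall x : V, `|(\prod_(i <- l) x 0 i) * h x| <= B.
    by move=> /(_ [::])[B hB]; exists B => x; have := hB x; rewrite big_nil mul1r.
  elim: wh => [s|i {}h _ IH|c h1 h2 _ IH1 _ IH2] l; first exact: bg.
    have [B hB] := IH (i :: l); exists B => x.
    by have := hB x; rewrite big_cons -mulrA mulrCA.
  have [B1 b1] := IH1 l; have [B2 b2] := IH2 l; exists (`|c| * B1 + B2) => x.
  rewrite mulrDr mulrCA (le_trans (ler_normD _ _))// lerD//.
  by rewrite normrM ler_wpM2l.
- by move=> i; exact: weyl_mul.
- move=> j; elim: wh => [s|i {}h wh [h' [wh' dh]]|c h1 h2 _ [h1' [w1 d1]] _ [h2' [w2 d2]]].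
  + exists (ipartial (j :: s) g); split; first exact: weyl_ipartial.
    exact: (smooth_has_partials (smooth_ipartial s sg)).
  + exists (fun x => (j == i)%:R * h x + x 0 i * h' x); split.
      by apply: weyl_lin => //; exact: weyl_mul.
    by move=> x; exact: (is_derive_mul (is_derive_coord j i x) (dh x)).
  + exists (fun x => c * h1' x + h2' x); split; first exact: weyl_lin.
    by move=> x; apply: is_deriveD; apply: is_deriveZ.
Qed.

Lemma rschwartz_integrable (g : V -> R) : rschwartz g ->
  (lebesgue_tuple R m).-integrable setT (fun t => (g (rvec t))%:E).
Proof.
move=> sg; have [C _ hC] := rschwartz_weight sg.
by apply: (integrable_dom _ hC); apply: measurable_continuous; exact: rschwartz_continuous.
Qed.

Lemma schwartz_rschwartz f : schwartz f -> rschwartz (@re_ R m f) /\ rschwartz (im_ f).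
Proof.
move=> [[sr si] bf].
have Q s (l : seq 'I_m) : exists B : R, forall x : V, `|\prod_(i <- l) x 0 i| * Normc.normc (mderiv (counts s) f x) <= B.
  by have [B hB] := bf (counts l) (counts s); exists B => x; rewrite mpow_counts.
split; apply: weyl_rschwartz => // s l; have [B hB] := Q s l; exists B => x.
  rewrite normrM (le_trans _ (hB x))// ler_wpM2l//.
  by rewrite (ipartial_perm sr (mindex_seq_counts s)); exact: (Re_le_normc (mderiv (counts s) f x)).
rewrite normrM (le_trans _ (hB x))// ler_wpM2l//.
by rewrite (ipartial_perm si (mindex_seq_counts s)); exact: (Im_le_normc (mderiv (counts s) f x)).
Qed.

End schwartz_hyp.

Section mass_of.
Variables (R : realType) (n : nat).
Local Notation N := (n + n + 1)%N.
Local Notation H := 'rV[R]_N.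
Local Notation Rm := (measurableTypeR R).
Local Notation lt m := (lebesgue_tuple R m).

Lemma mass_moments (rho : H -> R) (c : R) : rschwartz rho -> (\int[lt N]_t rho (rvec t) = c)%R ->
  (forall a : mindex N, a != [ffun=> 0%N] -> (\int[lt N]_t (mpow (rvec t) a * rho (rvec t)) = 0)%R) ->
  mass c rho.
Proof.
move=> sr r1 r0; split => // i; split; first exact: rschwartz_coord.
move=> s; rewrite -[RHS](r0 (counts (i :: s))).
  by apply: eq_Rintegral => t _; rewrite -mpow_counts big_cons; ring.
by apply/eqP => /ffunP/(_ i); rewrite !ffunE/= eqxx.
Qed.

Definition zsign (i : 'I_N) : R := if [exists j, i == iz j] then -1 else 1.
(** Reflection in the position variable: the transpose of the operator
    attached to rho is attached to its reflection ([opK_refl]). *)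
Definition zrefl (rho : H -> R) : H -> R := fun a => rho (\row_i (zsign i * a 0 i)).

Lemma zsign_norm i : `|zsign i| = 1.
Proof. by rewrite /zsign; case: ifP; rewrite ?normrN normr1. Qed.

Lemma zsignK i : zsign i * zsign i = 1.
Proof. by rewrite /zsign; case: ifP => _; rewrite ?mulN1r ?opprK ?mul1r. Qed.

Lemma zsign_neq0 i : zsign i != 0.
Proof. by rewrite -normr_gt0 zsign_norm. Qed.

Lemma Rintegral_zrefl (g : H -> R) : rschwartz g ->
  (\int[lt N]_t g (rvec t) = \int[lt N]_t g (\row_i (zsign i * rvec t 0 i)))%R.
Proof.
move=> sg; have T := @transports_affine R N zsign (fun=> 0) zsign_neq0.
have E : \prod_i `|zsign i| = 1 by rewrite big1// => i _; exact: zsign_norm.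
rewrite E in T.
rewrite (transport_Rintegral (@measurable_affine R N zsign (fun=> 0)) ltr01 T (rschwartz_integrable sg)).
rewrite mul1r; apply: eq_Rintegral => t _; rewrite rvec_affine; congr g.
by apply/rowP => i; rewrite !mxE addr0.
Qed.

(** A moment changes at most by a sign under a reflection. *)
Lemma mass_zrefl (rho : H -> R) (c : R) : mass c rho -> mass c (zrefl rho).
Proof.
move=> [sr r1 fr]; have sz := rschwartz_diag zsign_neq0 sr.
split => //; first by rewrite -r1 [RHS]Rintegral_zrefl.
move=> i; split; first exact: rschwartz_coord.
move=> s; have [si f0] := fr i.
have ss : rschwartz (fun a : H => (\prod_(j <- s) a 0 j) * (a 0 i * rho a)).
  elim: s => [|j s IH].
    by rewrite (_ : (fun a => _) = fun a : H => a 0 i * rho a)//; apply/funext => a; rewrite big_nil mul1r.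
  rewrite (_ : (fun a => _) = fun a : H => a 0 j * ((\prod_(j <- s) a 0 j) * (a 0 i * rho a))).
    exact: rschwartz_coord.
  by apply/funext => a; rewrite big_cons -mulrA.
(* the sign of the monomial under the reflection *)
pose sg := (\prod_(j <- s) zsign j) * zsign i.
have E t : (\prod_(j <- s) rvec t 0 j) * (rvec t 0 i * zrefl rho (rvec t)) =
   sg * ((\prod_(j <- s) (\row_i (zsign i * rvec t 0 i)) 0 j) *
    ((\row_i (zsign i * rvec t 0 i)) 0 i * rho (\row_i (zsign i * rvec t 0 i)))).
  rewrite /zrefl; set r := rho _.
  have -> : \prod_(j <- s) (\row_i (zsign i * rvec t 0 i)) 0 j =
     (\prod_(j <- s) zsign j) * \prod_(j <- s) rvec t 0 j.
    by rewrite -big_split/=; apply: eq_bigr => j _; rewrite mxE.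
  have S : (\prod_(j <- s) zsign j) * (\prod_(j <- s) zsign j) = 1.
    by rewrite -big_split/= big1// => j _; exact: zsignK.
  rewrite mxE /sg; set P := \prod_(j <- s) zsign j; set Q := \prod_(j <- s) _.
  transitivity ((P * P) * (zsign i * zsign i) * (Q * (rvec t 0 i * r))); last by ring.
  by rewrite S zsignK !mul1r.
under eq_Rintegral do rewrite E.
rewrite RintegralZl//.
  by rewrite -(Rintegral_zrefl ss) f0 mulr0.
exact: (rschwartz_integrable (rschwartz_diag zsign_neq0 ss)).
Qed.

End mass_of.

Section kernel_fubini.
Variables (R : realType) (n : nat).
Local Notation V := 'rV[R]_n.
Local Notation N := (n + n + 1)%N.
Local Notation H := 'rV[R]_N.
Local Notation Rm := (measurableTypeR R).
Local Notation lt m := (lebesgue_tuple R m).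
Implicit Types (F : H -> R) (f : V -> R) (th e : R) (x : V).

(** The functions on which the operators act below: bounded smooth functions
    and square integrable functions are of this kind. *)
Definition wadm f x := measurable_fun setT (fun t : n.-tuple Rm => f (rvec t)) /\
  (lt n).-integrable setT (fun t => (weight (rvec t) * f (rvec t + x))%:E).

Definition shift_tup x : n.-tuple Rm -> n.-tuple Rm := affine_tup (fun=> 1) (fun i => x 0 i).

Lemma rvec_shift x t : rvec (shift_tup x t) = rvec t + x.
Proof. by rewrite rvec_affine; apply/rowP => i; rewrite !mxE mul1r. Qed.

Lemma shift_transports x : transports (lt n) (lt n) (shift_tup x) 1.
Proof.
have := @transports_affine R n (fun=> 1) (fun i => x 0 i) (fun _ => oner_neq0 _).
by under eq_bigr do rewrite normr1; rewrite big1.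
Qed.

Lemma measurable_shift x : measurable_fun setT (shift_tup x).
Proof. exact: measurable_affine. Qed.

Lemma wave1_measurable F f th x : continuous F ->
  measurable_fun setT (fun t : n.-tuple Rm => f (rvec t)) ->
  measurable_fun setT (fun t : N.-tuple Rm => wave F f th 1 x (rvec t)).
Proof.
move=> cF mf.
rewrite (_ : (fun t => _) = fun t : N.-tuple Rm => wave F (fun=> 1) th 1 x (rvec t) * f (hpos (rvec t) + x)).
  apply: measurable_funM; first by apply: measurable_wave => // y; exact: cst_continuous.
  pose h (t : N.-tuple Rm) : n.-tuple Rm := [tuple tnth t (iz i) + x 0 i | i < n].
  rewrite (_ : (fun t => _) = (fun t : n.-tuple Rm => f (rvec t)) \o h).
    apply: measurableT_comp => //; apply/measurable_fun_tnthP => i.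
    rewrite (_ : _ \o _ = fun t => tnth t (iz i) + x 0 i); last first.
      by apply/funext => t /=; rewrite tnth_mktuple.
    by apply: measurable_funD => //; exact: measurable_tnth.
  apply/funext => t /=; congr f; apply/rowP => i.
  by rewrite !mxE tnth_mktuple.
by apply/funext => t; rewrite /wave scale1r mulr1.
Qed.

Lemma wave1_glue F f th x z w : wave F f th 1 x (zglue z w) =
  kintegrand F th z (2^-1 *: z + x) w * f (z + x).
Proof.
rewrite /wave /kintegrand scale1r; congr (_ * _ * _).
  congr (cos (_ + _)); rewrite /osc_phase /phase mulr1 /zglue; congr (_ * (_ + _)).
    by rewrite /it row_mxEr mxE; congr (w _ _); exact/val_inj.
  apply: eq_bigr => i _; rewrite glue_x glue_z !mxE; congr (_ * _).
  by rewrite mulr1 addrC.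
by rewrite /hpos /zglue !row_mxKl.
Qed.

(** The integral over the group is an iterated integral over the position z
    and over (xi, tau); the inner one is the kernel at y = x + z. It converges
    absolutely because F is bounded by a product of weights, so Fubini's
    theorem applies, followed by the translation y = x + z. *)
Lemma kernel_fubini F f th x : rschwartz F -> wadm f x ->
  (lt N).-integrable setT (fun t => (wave F f th 1 x (rvec t))%:E) /\
  (lt n).-integrable setT (fun t => (kern F th (rvec t - x) (2^-1 *: (x + rvec t)) * f (rvec t))%:E) /\
  (\int[lt n]_t (kern F th (rvec t - x) (2^-1 *: (x + rvec t)) * f (rvec t)) =
   wint (wave F f th) 1 x)%R.
Proof.
move=> sF [mf iwf]; have cF := rschwartz_continuous sF.
have [C C0 hC] := rschwartz_weight sF.
pose W (t : N.-tuple Rm) := wave F f th 1 x (rvec t).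
have mW : measurable_fun setT W by exact: wave1_measurable.
pose P := fun p : n.-tuple Rm * (n + 1).-tuple Rm => W (glue_tup p).
have mP : measurable_fun setT P by apply: measurableT_comp => //; exact: measurable_glue.
have PE p : P p = kintegrand F th (rvec p.1) (2^-1 *: rvec p.1 + x) (rvec p.2) * f (rvec p.1 + x).
  by rewrite /P /W rvec_glue wave1_glue.
have Ple p : `|P p| <= C * `|weight (rvec p.1) * f (rvec p.1 + x)| * weight (rvec p.2).
  rewrite PE normrM [X in _ <= _ * X * _]normrM (ger0_norm (weight_ge0 _)).
  rewrite [leRHS](_ : _ = (C * weight (rvec p.1) * weight (rvec p.2)) * `|f (rvec p.1 + x)|); last by ring.
  rewrite ler_wpM2r// /kintegrand normrM -[leRHS]mulr1; apply: ler_pM => //.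
    by rewrite -mulrA -weight_glue.
  by rewrite ler_norml cos_geN1 cos_le1.
have iP : (lt n \x lt (n + 1))%E.-integrable setT (EFin \o P).
  apply/integrable12ltyP; first exact/measurable_EFinP.
  apply: (@le_lt_trans _ _ (\int[lt n]_p ((C * pi ^+ (n + 1))%:E * `|(weight (rvec p) * f (rvec p + x))%:E|))%E).
    apply: ge0_le_integral => //.
    + by move=> p _; apply: integral_ge0.
    + apply: (@measurable_fun_fubini_tonelli_F _ _ _ _ _ _ (fun p => `|(P p)%:E|)%E) => //.
      by apply: measurableT_comp => //; exact/measurable_EFinP.
    + by apply: measurable_funeM; apply: measurableT_comp => //; case/integrableP: iwf.
    + move=> p _.
      apply: (@le_trans _ _ (\int[lt (n + 1)]_q ((C * `|weight (rvec p) * f (rvec p + x)|)%:E * (weight (rvec q))%:E))%E).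
        apply: ge0_le_integral => //.
        * apply: measurableT_comp => //; apply/measurable_EFinP.
          by apply: (measurableT_comp mP); exact: pair1_measurable.
        * by apply: measurable_funeM; apply/measurable_EFinP; exact: measurable_weight.
        * by move=> q _; rewrite -EFinM lee_fin; exact: (Ple (p, q)).
      rewrite ge0_integralZl//; last first.
      * by rewrite lee_fin mulr_ge0.
      * by move=> q _; rewrite lee_fin weight_ge0.
      * by apply/measurable_EFinP; exact: measurable_weight.
      by rewrite integral_weight -EFinM/= -EFinM lee_fin mulrAC.
  rewrite ge0_integralZl//; last first.
  + by rewrite lee_fin mulr_ge0// exprn_ge0// pi_ge0.
  + by apply: measurableT_comp => //; case/integrableP: iwf.
  rewrite lte_mul_pinfty//; first by rewrite lee_fin mulr_ge0// exprn_ge0// pi_ge0.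
  by case/integrableP: iwf.
have T := @transports_glue R n; have mg := @measurable_glue R n.
have iW : (lt N).-integrable setT (EFin \o W) by apply/(transport_integrable mg ltr01 T mW).
have EW : wint (wave F f th) 1 x = (\int[(lt n \x lt (n + 1))%E]_p P p)%R.
  by rewrite /wint (transport_Rintegral mg ltr01 T iW) mul1r.
pose G (t : n.-tuple Rm) := kern F th (rvec t) (2^-1 *: rvec t + x) * f (rvec t + x).
have FE p : (\int[lt (n + 1)]_q (P (p, q))%:E = (G p)%:E)%E.
  have ik := kintegrand_integrable th (rvec p) (2^-1 *: rvec p + x) sF.
  rewrite /G /kern mulrC -RintegralZl// /Rintegral fineK; last first.
    apply: integrable_fin_num => //; have := integrableZl measurableT (f (rvec p + x)) ik.
    by apply: eq_integrable => // t _; rewrite EFinM.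
  by apply: eq_integral => q _; rewrite PE mulrC.
have iG : (lt n).-integrable setT (EFin \o G).
  by have := integrable_fubini_F iP; apply: eq_integrable => // p _; rewrite /fubini_F FE.
have EG : (\int[lt n]_p G p = \int[(lt n \x lt (n + 1))%E]_p P p)%R.
  rewrite /Rintegral; congr fine; rewrite -(integral12_prod_meas1 iP).
  by apply: eq_integral => p _; rewrite /fubini_F -FE.
have Tx := shift_transports (- x); have mx := measurable_shift (- x).
have GE t : G (shift_tup (- x) t) = kern F th (rvec t - x) (2^-1 *: (x + rvec t)) * f (rvec t).
  rewrite /G rvec_shift subrK; congr (kern _ _ _ _ * _).
  by apply/rowP => i; rewrite !mxE; field.
split=> //; split.
  have mG : measurable_fun setT G by case/integrableP: iG => /measurable_EFinP.
  have := (transport_integrable mx ltr01 Tx mG).1 iG.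
  by apply: eq_integrable => // t _; rewrite -GE.
rewrite EW -EG (transport_Rintegral mx ltr01 Tx iG) mul1r.
by apply: eq_Rintegral => t _; rewrite GE.
Qed.

Lemma wadm_bsmooth f x : bsmooth f -> wadm f x.
Proof.
move=> bf; have [B B0 hB] := bsmooth_bound bf.
have cf := smooth_continuous (bsmooth_smooth bf).
have mf : measurable_fun setT (fun t : n.-tuple Rm => f (rvec t)) by exact: measurable_continuous.
split => //; apply: (integrable_dom (f := fun y => weight y * f (y + x)) (C := B)); last first.
  by move=> y; rewrite normrM mulrC (ger0_norm (weight_ge0 _)) ler_wpM2r// weight_ge0.
apply: measurable_funM; first exact: measurable_weight.
rewrite (_ : (fun t => _) = (fun t : n.-tuple Rm => f (rvec t)) \o shift_tup x).
  by apply: measurableT_comp => //; exact: measurable_shift.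
by apply/funext => t /=; rewrite rvec_shift.
Qed.

(** The substitution a -> e a. *)
Lemma wave_rescale rho f th e x : 0 < e -> rschwartz rho -> bsmooth f ->
  wint (wave (rescaleR rho e) f th) 1 x = wint (wave rho f th) e x.
Proof.
move=> e0 sr bf; have en : e != 0 by rewrite gt_eqF.
have T := @transports_affine R N (fun=> e) (fun=> 0) (fun _ => en).
have E : \prod_(i < N) `|e| = e ^+ N by rewrite prodr_const card_ord gtr0_norm.
rewrite E in T.
have iw := wave_integrable th 1 x (rschwartz_rescale en sr) bf.
rewrite {1}/wint (transport_Rintegral (measurable_affine _ _) (exprn_gt0 _ e0) T iw).
rewrite -RintegralZl//; last first.
  have mw : measurable_fun setT (fun t : N.-tuple Rm => wave (rescaleR rho e) f th 1 x (rvec t)).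
    by case/integrableP: iw => /measurable_EFinP.
  exact: ((transport_integrable (measurable_affine _ _) (exprn_gt0 _ e0) T mw).1 iw).
apply: eq_Rintegral => t _; rewrite rvec_affine.
have -> : (\row_i (e * rvec t 0 i + 0) : H) = e *: rvec t by apply/rowP => i; rewrite !mxE addr0.
set a := rvec t; rewrite /wave /rescaleR scalerA mulVf// !scale1r.
have -> : osc_phase 1 x (e *: a) = osc_phase e x a.
  rewrite /osc_phase mulr1 -[RHS]mulrA; congr (_ * _); rewrite !mxE mulrDr mulr_sumr; congr (_ + _).
  by apply: eq_bigr => i _; rewrite !mxE; ring.
have -> : hpos (e *: a) = e *: hpos a by apply/rowP => i; rewrite !mxE.
by rewrite !mulrA divff ?mul1r// expf_neq0.
Qed.

End kernel_fubini.

(** * The integral kernel of the integrated representation *)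

Section of_rschwartz.
Variables (R : realType) (m : nat).
Local Notation V := 'rV[R]_m.

Lemma rschwartz_mpow (a : mindex m) (g : V -> R) : rschwartz g -> rschwartz (fun x => mpow x a * g x).
Proof.
move=> sg; rewrite /mpow.
have E (l : seq 'I_m) : rschwartz (fun x : V => (\prod_(i <- l) x 0 i ^+ a i) * g x).
  elim: l => [|i l IH].
    by rewrite (_ : (fun x => _) = g)//; apply/funext => x; rewrite big_nil mul1r.
  have P k : rschwartz (fun x : V => x 0 i ^+ k * ((\prod_(i <- l) x 0 i ^+ a i) * g x)).
    elim: k => [|k IHk].
      by move: IH; congr rschwartz; apply/funext => x; rewrite expr0 mul1r.
    have := rschwartz_coord i IHk; congr rschwartz; apply/funext => x.
    by rewrite exprS mulrA.
  by move: (P (a i)); congr rschwartz; apply/funext => x; rewrite big_cons mulrA.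
exact: E.
Qed.

Lemma rschwartz_ipartial s (g : V -> R) : rschwartz g -> rschwartz (ipartial s g).
Proof.
move=> sg; elim: s => // i s IH; rewrite -cat1s ipartial_cat; exact: rschwartz_partial.
Qed.

Lemma rschwartz_schwartz (f : V -> R[i]) : rschwartz (re_ f) -> rschwartz (im_ f) -> schwartz f.
Proof.
move=> sr si; split; first by split; exact: rschwartz_smooth.
move=> a b.
have [B1 b1] := rschwartz_bounded (rschwartz_mpow a (rschwartz_ipartial (mindex_seq b) sr)).
have [B2 b2] := rschwartz_bounded (rschwartz_mpow a (rschwartz_ipartial (mindex_seq b) si)).
exists (B1 + B2) => x; apply: (le_trans (ler_wpM2l (normr_ge0 _) (normc_le _ _))).
by rewrite mulrDr -!normrM lerD.
Qed.

End of_rschwartz.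

Section fam_schwartz.
Variables (R : realType) (n : nat).

(** For fixed e the members of [fam] form a class of Schwartz functions of (x,
    y), by stability under multiplication by the coordinates of x and y. *)
Lemma fam_schwartz K G e : @fam R n K G -> 0 < e < 1 ->
  rschwartz (fun z => G e (lsubmx z) (rsubmx z)).
Proof.
move=> fG e01.
exists [set g | exists K G, fam K G /\ g = fun z => G e (lsubmx z) (rsubmx z)]; split; last by exists K, G.
move=> _ [{fG}K [{}G [fG ->]]]; split.
- have [B B0 b] := fam_bound fG; exists (B * e^-1 ^+ (K + (n + n + 1))) => x; exact: b.
- move=> i; case: (splitP i) => j ij.
    have -> : i = lshift n j by exact/val_inj.
    exists K.+1, (fun e (x y : 'rV[R]_n) => x 0 j * G e x y); split; first exact: fam_mulx.
    by apply/funext => z; rewrite !mxE.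
  have -> : i = rshift n j by exact/val_inj.
  exists K.+1, (fun e (x y : 'rV[R]_n) => y 0 j * G e x y); split; first exact: fam_muly.
  by apply/funext => z; rewrite !mxE.
- move=> i.
  have [g' [[K' [G' [fG' ->]]] d]] : exists g', (exists K G, @fam R n K G /\ g' = fun e z => G e (lsubmx z) (rsubmx z)) /\
     forall e x, 0 < e < 1 -> is_derive x (delta_mx 0 i) (fun z => G e (lsubmx z) (rsubmx z)) (g' e x).
    exact: (fam_net_dx i fG).
  exists (fun z => G' e (lsubmx z) (rsubmx z)); split; first by exists K', G'.
  by move=> x; exact: d.
Qed.

End fam_schwartz.

Section operator.
Variables (R : realType) (n : nat).
Local Notation C := R[i].
Local Notation V := 'rV[R]_n.
Local Notation N := (n + n + 1)%N.
Local Notation H := 'rV[R]_N.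
Local Notation Rm := (measurableTypeR R).
Local Notation lt m := (lebesgue_tuple R m).
Implicit Types (e th : R) (x y : V) (f : V -> C) (r : H -> R).

Definition skern rho th e x y : R := kern (rescaleR rho e) th (y - x) (2^-1 *: (x + y)).

Definition kre r1 r2 e x y : R := -1 * skern r2 (- (pi / 2)) e x y + skern r1 0 e x y.
Definition kim r1 r2 e x y : R := 1 * skern r1 (- (pi / 2)) e x y + skern r2 0 e x y.
(** The kernel K_e for rho = r1 + i r2. *)
Definition opK r1 r2 e x y : C := kre r1 r2 e x y +i* kim r1 r2 e x y.

Lemma fam_kre r1 r2 : rschwartz r1 -> rschwartz r2 -> fam 0 (kre r1 r2).
Proof. by move=> s1 s2; apply: fam_lin; exact: fam_kern. Qed.

Lemma fam_kim r1 r2 : rschwartz r1 -> rschwartz r2 -> fam 0 (kim r1 r2).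
Proof. by move=> s1 s2; apply: fam_lin; exact: fam_kern. Qed.

Lemma opK_schwartz r1 r2 e : rschwartz r1 -> rschwartz r2 -> 0 < e < 1 -> schwartz_kernel (opK r1 r2 e).
Proof.
move=> s1 s2 e01; apply: rschwartz_schwartz.
  exact: (fam_schwartz (fam_kre s1 s2) e01).
exact: (fam_schwartz (fam_kim s1 s2) e01).
Qed.

(** The product of r1 + i r2, of the exponential and of f1 + i f2, expanded
    into real integrals w rho th f; the angle - pi / 2 turns the cosine into a
    sine. *)
Definition combine (w : (H -> R) -> R -> (V -> R) -> R) r1 r2 (f1 f2 : V -> R) : C :=
  (w r1 0 f1 + -1 * w r2 (- (pi / 2)) f1 + -1 * w r1 (- (pi / 2)) f2 + -1 * w r2 0 f2) +i*
  (w r1 0 f2 + -1 * w r2 (- (pi / 2)) f2 + 1 * w r1 (- (pi / 2)) f1 + 1 * w r2 0 f1).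

Lemma Rintegral4 d (T : measurableType d) (mu : {measure set T -> \bar R}) (a b c d' : T -> R) (s t u : R) :
  mu.-integrable setT (EFin \o a) -> mu.-integrable setT (EFin \o b) ->
  mu.-integrable setT (EFin \o c) -> mu.-integrable setT (EFin \o d') ->
  (\int[mu]_x (a x + s * b x + t * c x + u * d' x) =
   \int[mu]_x a x + s * \int[mu]_x b x + t * \int[mu]_x c x + u * \int[mu]_x d' x)%R.
Proof.
move=> ia ib ic id'.
have Z (v : R) (g : T -> R) : mu.-integrable setT (EFin \o g) ->
    mu.-integrable setT (fun z => (v * g z)%:E).
  by move=> ig; have := integrableZl measurableT v ig; apply: eq_integrable => // x _; rewrite EFinM.
have D (g h : T -> R) : mu.-integrable setT (EFin \o g) -> mu.-integrable setT (EFin \o h) ->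
    mu.-integrable setT (fun z => (g z + h z)%:E).
  by move=> ig ih; have := integrableD measurableT ig ih; apply: eq_integrable => // x _; rewrite EFinD.
have i1 := D _ _ ia (Z s _ ib); have i2 := D _ _ i1 (Z t _ ic).
rewrite RintegralD//; last exact: Z.
rewrite RintegralD//; last exact: Z.
rewrite RintegralD//; last exact: Z.
by rewrite !RintegralZl.
Qed.

Lemma kernel_fun_combine r1 r2 e f x : 0 < e < 1 -> rschwartz r1 -> rschwartz r2 ->
  wadm (re_ f) x -> wadm (im_ f) x ->
  kernel_fun (opK r1 r2 e) f x =
  combine (fun rho th g => wint (wave (rescaleR rho e) g th) 1 x) r1 r2 (re_ f) (im_ f).
Proof.
move=> e01 s1 s2 w1 w2; have e0 : e != 0 by rewrite gt_eqF//; case/andP: e01.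
have F rho th g (sr : rschwartz rho) (wg : wadm g x) := kernel_fubini th (rschwartz_rescale e0 sr) wg.
have I rho th g (sr : rschwartz rho) (wg : wadm g x) := proj1 (proj2 (F rho th g sr wg)).
have E rho th g (sr : rschwartz rho) (wg : wadm g x) := proj2 (proj2 (F rho th g sr wg)).
rewrite /kernel_fun /cintegral /combine -!E//; congr (_ +i* _).
  rewrite -Rintegral4; [|exact: I|exact: I|exact: I|exact: I].
  by apply: eq_Rintegral => t _; rewrite ReM /opK /= /kre /kim /skern /re_ /im_; ring.
rewrite -Rintegral4; [|exact: I|exact: I|exact: I|exact: I].
by apply: eq_Rintegral => t _; rewrite ImM /opK /= /kre /kim /skern /re_ /im_; ring.
Qed.

(** The three phases of the representation at the inverse of a add up to the
    phase of [wave] at e = 1. *)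
Lemma schrodinger_osc (x : V) (a : H) f :
  schrodinger (hinv a) f x = expi (osc_phase 1 x a) * f (hpos a + x).
Proof.
rewrite /schrodinger /translation /modulation /hinv.
have expiD (p q : R) : expi (p + q) = expi p * expi q.
  by rewrite /expi cosD sinD; apply: ReIm_eq; rewrite ?ReM ?ImM/=; ring.
have hN : hpos (- a) = - hpos a by apply/rowP => i; rewrite !mxE.
have fN : hfreq (- a) = - hfreq a by apply/rowP => i; rewrite !mxE.
rewrite mulrA -!expiD; congr (expi _ * f _); last by rewrite hN opprK addrC.
rewrite hN fN opprK /osc_phase.
have -> : hcenter (- a) = - a 0 (it n) by rewrite /hcenter !mxE /it; congr (- a _ _); rewrite ?ord1.
have -> : dot (- hpos a) (- hfreq a) = \sum_i a 0 (ix i) * a 0 (iz i).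
  by apply: eq_bigr => i _; rewrite !mxE mulrNN mulrC.
have -> : dot (- hfreq a) (x + hpos a) = - (\sum_i a 0 (ix i) * x 0 i + \sum_i a 0 (ix i) * a 0 (iz i)).
  rewrite -big_split/= -sumrN; apply: eq_bigr => i _; rewrite !mxE mulNr mulrDr.
  by [].
have -> : \sum_i a 0 (ix i) * (x 0 i + 2^-1 * 1 * a 0 (iz i)) =
    \sum_i a 0 (ix i) * x 0 i + 2^-1 * \sum_i a 0 (ix i) * a 0 (iz i).
  rewrite mulr_sumr -big_split/=; apply: eq_bigr => i _; ring.
by field.
Qed.

Lemma sin_cos_shift (t : R) : sin t = cos (t - pi / 2).
Proof. by rewrite cosB cos_pihalf sin_pihalf mulr0 add0r mulr1. Qed.

Lemma integrated_rep_combine (F : H -> C) f x : rschwartz (re_ F) -> rschwartz (im_ F) ->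
  wadm (re_ f) x -> wadm (im_ f) x ->
  integrated_rep F f x = combine (fun rho th g => wint (wave rho g th) 1 x) (re_ F) (im_ F) (re_ f) (im_ f).
Proof.
move=> s1 s2 w1 w2.
have I rho th g (sr : rschwartz rho) (wg : wadm g x) := proj1 (kernel_fubini th sr wg).
rewrite /integrated_rep /cintegral /combine; congr (_ +i* _).
  rewrite -Rintegral4; [|exact: I|exact: I|exact: I|exact: I].
  apply: eq_Rintegral => t _; rewrite schrodinger_osc ReM ReM ImM /= sin_cos_shift.
  by rewrite /wave /re_ /im_ scale1r addr0; ring.
rewrite -Rintegral4; [|exact: I|exact: I|exact: I|exact: I].
apply: eq_Rintegral => t _; rewrite schrodinger_osc ImM ReM ImM /= sin_cos_shift.
by rewrite /wave /re_ /im_ scale1r addr0; ring.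
Qed.

(** By |weight f| <= weight + |f|^2, as the weight is at most 1. *)
Lemma wadm_L2 f x : L2 f -> wadm (re_ f) x /\ wadm (im_ f) x.
Proof.
move=> [m1 m2 fin].
have mn : measurable_fun setT (fun t : n.-tuple Rm => normc (f (rvec t)) ^+ 2).
  rewrite (_ : (fun t => _) = fun t => re_ f (rvec t) ^+ 2 + im_ f (rvec t) ^+ 2).
    by apply: measurable_funD; apply: measurable_funX.
  apply/funext => t; rewrite /re_ /im_; case: (f (rvec t)) => a b /=.
  by rewrite sqr_sqrtr// addr_ge0// sqr_ge0.
have i2 : (lt n).-integrable setT (EFin \o fun t : n.-tuple Rm => normc (f (rvec t)) ^+ 2).
  apply/integrableP; split; first exact/measurable_EFinP.
  by under eq_integral do rewrite gee0_abs ?lee_fin ?exprn_ge0 ?normc_ge0//.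
have is2 := (transport_integrable (measurable_shift x) ltr01 (@shift_transports R n x) mn).1 i2.
have Q (g : V -> R) : measurable_fun setT (fun t : n.-tuple Rm => g (rvec t)) ->
    (forall y, `|g y| <= normc (f y)) -> wadm g x.
  move=> mg gle; split => //.
  have iw : (lt n).-integrable setT (fun t => (weight (rvec t) + normc (f (rvec t + x)) ^+ 2)%:E).
    have := integrableD measurableT (integrable_weight R n) is2.
    by apply: eq_integrable => // t _; rewrite /= rvec_shift EFinD.
  apply: (le_integrable measurableT _ _ iw).
    apply/measurable_EFinP; apply: measurable_funM; first exact: measurable_weight.
    rewrite (_ : (fun t => _) = (fun t : n.-tuple Rm => g (rvec t)) \o shift_tup x).
      by apply: measurableT_comp => //; exact: measurable_shift.
    by apply/funext => t /=; rewrite rvec_shift.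
  move=> t _; rewrite lee_fin normrM (ger0_norm (weight_ge0 _)).
  rewrite [leRHS]ger0_norm ?addr_ge0 ?weight_ge0 ?exprn_ge0 ?normc_ge0//.
  set w := weight _; have w0 : 0 <= w by exact: weight_ge0.
  have w1 : w <= 1 by exact: weight_le1.
  apply: (le_trans (ler_wpM2l w0 (gle _))); set k := normc _.
  have := sqr_ge0 (w - k); have : w * w <= w by rewrite -[leRHS]mulr1 ler_wpM2l.
  have := sqr_ge0 k; rewrite sqrrB !expr2; nra.
split; apply: Q => // y; [exact: Re_le_normc|exact: Im_le_normc].
Qed.

End operator.

(** * Pairings with test functions and negligible nets *)

Section pairing.
Variables (R : realType) (m : nat).
Local Notation C := R[i].
Local Notation V := 'rV[R]_m.
Local Notation Rm := (measurableTypeR R).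
Local Notation lt m := (lebesgue_tuple R m).
Implicit Types (g h : V -> R) (W A : set V).

Lemma test_rschwartz (phi : V -> C) : test_function phi ->
  [/\ rschwartz (re_ phi), rschwartz (im_ phi) &
   exists2 A : set V, compact A & forall x, ~ A x -> phi x = 0].
Proof.
move=> [[sr si] cp]; have Z x : ~ closure [set x | phi x != 0] x -> phi x = 0.
  by move=> n0; apply/eqP; apply: contra_notT n0 => n0; exact: subset_closure.
split; last by exists (closure [set x | phi x != 0]).
  by apply: tfun_rschwartz; split => //; exists (closure [set x | phi x != 0]) => // x /Z E; rewrite /re_ E.
by apply: tfun_rschwartz; split => //; exists (closure [set x | phi x != 0]) => // x /Z E; rewrite /im_ E.
Qed.

Lemma compact_bound_in g A : (forall x, A x -> {for x, continuous g}) -> compact A ->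
  exists2 B : R, 0 <= B & forall x, A x -> `|g x| <= B.
Proof.
move=> cg cA; have /compact_bounded[M [_ HM]] : compact (g @` A).
  apply: continuous_compact => //; apply: continuous_in_subspaceT => x /set_mem Ax; exact: cg.
exists (`|M| + 1) => [|x Ax]; first by rewrite addr_ge0.
have h : M < `|M| + 1 by rewrite ltr_pwDr// ler_norm.
by apply: (HM _ h); exists x.
Qed.

Section cut.
Variables (W A : set V) (g h : V -> R).
Hypotheses (oW : open W) (cA : compact A) (AW : A `<=` W) (sg : smooth_real W g)
  (sh : rschwartz h) (h0 : forall x, ~ A x -> h x = 0).

(** The product is continuous where g is, and vanishes on the complement of A,
    which is open. *)
Lemma cut_continuous : continuous (fun x => g x * h x).
Proof.
move=> x; have [Wx|nWx] := pselect (W x).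
  apply: (@continuousM R V); last exact: rschwartz_continuous.
  by have [] := sg [::] Wx.
have oA : open (~` A) by apply: closed_openC; apply: compact_closed => //; exact: (@norm_hausdorff R V).
apply: (@near_eq_continuous _ _ _ (fun=> 0 : R)); last exact: cst_continuous.
apply: (@open_near_eq _ _ (~` A)) => // [Ax|y nAy]; first by apply: nWx; exact: AW.
by rewrite h0// mulr0.
Qed.

Lemma cut_le (B D : R) : 0 <= B -> (forall x, A x -> `|g x| <= B) -> (forall x, `|h x| <= D * weight x) ->
  forall x, `|g x * h x| <= B * D * weight x.
Proof.
move=> B0 hB hD x; rewrite normrM -mulrA; have [Ax|nAx] := pselect (A x).
  by apply: ler_pM => //; exact: hB.
rewrite h0// normr0 mulr0 mulr_ge0// (le_trans _ (hD x))//.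
Qed.

Lemma cut_bound : exists2 B : R, 0 <= B & forall x, A x -> `|g x| <= B.
Proof. by apply: compact_bound_in => // x Ax; have [] := sg [::] (AW Ax). Qed.

Lemma cut_integrable : tintegrable (fun x => g x * h x).
Proof.
have [B B0 hB] := cut_bound; have [D _ hD] := rschwartz_weight sh.
apply: (integrable_dom (C := B * D)); last exact: cut_le.
exact: (measurable_continuous cut_continuous).
Qed.

Lemma cut_pint_le (B D : R) : 0 <= B -> (forall x, A x -> `|g x| <= B) -> (forall x, `|h x| <= D * weight x) ->
  `|pint h g| <= B * D * pi ^+ m.
Proof.
move=> B0 hB hD; apply: (le_Rintegral_dom (measurable_continuous cut_continuous)); exact: cut_le.
Qed.

End cut.

Lemma pintD h (a : R) g g' : tintegrable (fun x => g x * h x) -> tintegrable (fun x => g' x * h x) ->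
  pint h (fun x => a * g x + g' x) = a * pint h g + pint h g'.
Proof.
move=> i1 i2; rewrite /pint -RintegralZl//; rewrite -RintegralD//; last exact: (tintegrableZ a i1).
by apply: eq_Rintegral => t _; rewrite mulrDl mulrA.
Qed.

Lemma sup_seminorm_ub W A (f : V -> C) : compact A -> A `<=` W -> smooth W f ->
  forall x, A x -> normc (f x) <= sup_seminorm A 0 f.
Proof.
move=> cA AW [sr si] x Ax.
have [B1 _ b1] : exists2 B : R, 0 <= B & forall x, A x -> `|re_ f x| <= B.
  by apply: compact_bound_in => // y Ay; have [] := sr [::] _ (AW _ Ay).
have [B2 _ b2] : exists2 B : R, 0 <= B & forall x, A x -> `|im_ f x| <= B.
  by apply: compact_bound_in => // y Ay; have [] := si [::] _ (AW _ Ay).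
have E (b : mindex m) y : (mdeg b <= 0)%N -> mderiv b f y = f y.
  rewrite leqn0 -size_mindex_seq => /nilP b0; rewrite /mderiv b0 /=.
  by rewrite -complex_eta.
rewrite /sup_seminorm; apply: ub_le_sup.
  exists (B1 + B2) => _ [y [b [Ay b0 ->]]]; rewrite E// [f y]complex_eta.
  by apply: (le_trans (normc_le _ _)); apply: lerD; [exact: b1|exact: b2].
exists x, [ffun=> 0%N]; split => //; first by rewrite /mdeg big1// => i _; rewrite ffunE.
by rewrite E// /mdeg big1// => i _; rewrite ffunE.
Qed.

Section test_pairing.
Variables (W : set V) (phi : V -> C).
Hypotheses (oW : open W) (tphi : test_function phi) (sW : closure [set x | phi x != 0] `<=` W).
Let A := closure [set x | phi x != 0].

Let cA : compact A. Proof. by case: tphi. Qed.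
Let s1 : rschwartz (re_ phi). Proof. by have [] := test_rschwartz tphi. Qed.
Let s2 : rschwartz (im_ phi). Proof. by have [] := test_rschwartz tphi. Qed.
Let phi0 x : ~ A x -> phi x = 0.
Proof. by move=> n0; apply/eqP; apply: contra_notT n0 => n0; exact: subset_closure. Qed.
Let z1 x : ~ A x -> re_ phi x = 0. Proof. by move=> /phi0; rewrite /re_ => ->. Qed.
Let z2 x : ~ A x -> im_ phi x = 0. Proof. by move=> /phi0; rewrite /im_ => ->. Qed.

Lemma cintegral_pint (f : V -> C) : smooth W f -> cintegral (fun x => f x * phi x) =
  (-1 * pint (im_ phi) (im_ f) + pint (re_ phi) (re_ f)) +i*
  (1 * pint (im_ phi) (re_ f) + pint (re_ phi) (im_ f)).
Proof.
move=> [sr si].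
have i11 := cut_integrable cA sW sr s1 z1; have i12 := cut_integrable cA sW sr s2 z2.
have i21 := cut_integrable cA sW si s1 z1; have i22 := cut_integrable cA sW si s2 z2.
rewrite /cintegral /pint; congr (_ +i* _).
  rewrite -RintegralZl// -RintegralD//; last exact: (tintegrableZ (-1) i22).
  by apply: eq_Rintegral => t _; rewrite ReM /re_ /im_; ring.
rewrite -RintegralZl// -RintegralD//; last exact: (tintegrableZ 1 i12).
by apply: eq_Rintegral => t _; rewrite ImM /re_ /im_; ring.
Qed.

Lemma cintegral_lin (c : C) (f h : V -> C) : smooth W f -> smooth W h ->
  cintegral (fun x => (c * f x + h x) * phi x) =
  c * cintegral (fun x => f x * phi x) + cintegral (fun x => h x * phi x).
Proof.
move=> sf sh; have scf := smooth_clin c oW sf sh.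
rewrite (cintegral_pint scf) (cintegral_pint sf) (cintegral_pint sh).
move: sf sh => [fr fi] [hr hi].
have I (g : V -> R) (psi : V -> R) : smooth_real W g -> rschwartz psi -> (forall x, ~ A x -> psi x = 0) ->
   tintegrable (fun x => g x * psi x) by move=> sg sp zp; exact: (cut_integrable cA sW sg sp zp).
have PR (psi : V -> R) : rschwartz psi -> (forall x, ~ A x -> psi x = 0) ->
   pint psi (re_ (fun x => c * f x + h x)) =
   complex.Re c * pint psi (re_ f) + (- complex.Im c * pint psi (im_ f) + pint psi (re_ h)).
  move=> sp zp; rewrite -(pintD _ (I _ _ fi sp zp) (I _ _ hr sp zp)) -(pintD _ (I _ _ fr sp zp)).
    by congr pint; apply/funext => x; rewrite /re_ ReD ReM /im_; ring.
  exact: (I _ _ (smooth_lin (- complex.Im c) oW fi hr) sp zp).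
have PI (psi : V -> R) : rschwartz psi -> (forall x, ~ A x -> psi x = 0) ->
   pint psi (im_ (fun x => c * f x + h x)) =
   complex.Re c * pint psi (im_ f) + (complex.Im c * pint psi (re_ f) + pint psi (im_ h)).
  move=> sp zp; rewrite -(pintD _ (I _ _ fr sp zp) (I _ _ hi sp zp)) -(pintD _ (I _ _ fi sp zp)).
    by congr pint; apply/funext => x; rewrite /im_ ImD ImM /re_; ring.
  exact: (I _ _ (smooth_lin (complex.Im c) oW fr hi) sp zp).
rewrite !PR// !PI//.
by apply: ReIm_eq; rewrite ?(ReD, ImD, ReM, ImM)/=; ring.
Qed.

(** The pairing with a test function supported in W is a continuous seminorm
    on the smooth functions on W. It is the seminorm by which negligible nets
    are tested below. *)
Lemma test_seminorm : continuous_seminorm W (fun f => normc (cintegral (fun x => f x * phi x))).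
Proof.
split.
- move=> f h sf sh; apply: le_trans (normcD _ _).
  rewrite -[X in normc (X + _)]mul1r -cintegral_lin//; set F := cintegral _; set G := cintegral _.
  by rewrite (_ : F = G)//; congr cintegral; apply/funext => x; rewrite mul1r.
- move=> c f sf; rewrite -normcM; congr normc.
  have s0 := smooth_c0 oW; have := cintegral_lin c sf s0.
  have -> : cintegral (fun x : V => (0 : C) * phi x) = 0.
    rewrite (cintegral_pint s0).
    have P0 psi : pint psi (fun=> 0 : R) = 0.
      rewrite /pint (_ : (fun t => _) = fun=> (0 : R)); last by apply/funext => t; rewrite mul0r.
      by rewrite /Rintegral integral0.
    by rewrite /re_ /im_ /= !P0 mulr0 mulr0 addr0.
  by rewrite addr0 => <-; congr cintegral; apply/funext => x; rewrite addr0.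
- have [D1 D10 h1] := rschwartz_weight s1; have [D2 D20 h2] := rschwartz_weight s2.
  exists A, 0%N, (2 * (D1 + D2) * pi ^+ m); split => // f sf.
  have ub := sup_seminorm_ub cA sW sf; set S := sup_seminorm A 0 f.
  have [fr fi] := sf.
  have S0 : 0 <= S.
    rewrite /S /sup_seminorm; set E := [set _ | _].
    have [->|/set0P[r Er]] := eqVneq E set0; first by rewrite sup0.
    case: Er => x [b [Ax _ _]]; exact: le_trans (normc_ge0 _) (ub x Ax).
  have ur x : A x -> `|re_ f x| <= S by move=> Ax; apply: le_trans (Re_le_normc _) (ub x Ax).
  have ui x : A x -> `|im_ f x| <= S by move=> Ax; apply: le_trans (Im_le_normc _) (ub x Ax).
  rewrite cintegral_pint//; apply: (le_trans (normc_le _ _)).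
  have Q (g psi : V -> R) D : smooth_real W g -> rschwartz psi -> (forall x, ~ A x -> psi x = 0) ->
      (forall x, A x -> `|g x| <= S) -> (forall x, `|psi x| <= D * weight x) ->
      `|pint psi g| <= S * D * pi ^+ m.
    by move=> sg sp zp ug up; exact: (cut_pint_le cA sW sg sp zp S0 ug up).
  have q11 := Q _ _ _ fr s1 z1 ur h1; have q12 := Q _ _ _ fr s2 z2 ur h2.
  have q21 := Q _ _ _ fi s1 z1 ui h1; have q22 := Q _ _ _ fi s2 z2 ui h2.
  rewrite mulN1r mul1r.
  apply: (@le_trans _ _ ((S * D2 * pi ^+ m + S * D1 * pi ^+ m) + (S * D2 * pi ^+ m + S * D1 * pi ^+ m))).
    apply: lerD; apply: (le_trans (ler_normD _ _)); rewrite ?normrN; exact: lerD.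
  rewrite le_eqVlt; apply/orP; left; apply/eqP; ring.
Qed.

End test_pairing.

(** The compactly supported distribution defined by a test function. Through
    it the results on nets u(K_e(x, .)) apply to hatpi(rho_e) phi. *)
Lemma test_distribution (phi : V -> C) : test_function phi ->
  compact_distribution (fun f => cintegral (fun x => f x * phi x)).
Proof.
move=> tphi; have s : closure [set x | phi x != 0] `<=` setT by [].
split; last exact: (test_seminorm openT tphi s).
move=> c f h sf sh; exact: (cintegral_lin openT tphi s).
Qed.

End pairing.

Section negligible.
Variables (R : realType) (m : nat).
Local Notation C := R[i].
Local Notation V := 'rV[R]_m.
Local Notation net := (R -> V -> C).
Implicit Types (f g : net) (W : set V).

Lemma bigO_near (f : R -> R) (K : R) (N : int) :
  (\forall e \near 0^'+, `|f e| <= K * e ^ N) ->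
  (f : R -> R^o) =O_ (0^'+) (fun e => e ^ N : R^o).
Proof.
move=> fK; apply/eqOP; near=> k; have kK : K <= k by near: k; exact: nbhs_pinfty_ge (num_real _).
near=> e.
have e0 : 0 < e by near: e; exact: nbhs_right_gt.
have eN : 0 <= e ^ N by rewrite exprz_ge0// ltW.
apply: (@le_trans _ _ (K * e ^ N)); first by near: e.
by rewrite (ger0_norm eN) ler_wpM2r.
Unshelve. all: by end_near. Qed.

Lemma bigO_ex (f : R -> R) (N : int) : (f : R -> R^o) =O_ (0^'+) (fun e => e ^ N : R^o) ->
  exists2 K : R, 0 < K & \forall e \near 0^'+, `|f e| <= K * e ^ N.
Proof.
move=> /eqO_exP[K K0 H]; exists K => //; near=> e.
have e0 : 0 < e by near: e; exact: nbhs_right_gt.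
have eN : 0 <= e ^ N by rewrite exprz_ge0// ltW.
by rewrite -[X in _ <= _ * X](ger0_norm eN); near: e.
Unshelve. all: by end_near. Qed.

(** A continuous seminorm on the functions on W is also one on functions
    defined everywhere, so restriction preserves moderate and negligible nets. *)
Lemma seminorm_up W (p : (V -> C) -> R) : continuous_seminorm W p -> continuous_seminorm setT p.
Proof.
have up (f : V -> C) : smooth setT f -> smooth W f by exact: smooth_csub.
move=> [pD pZ [A [k [c [cA AW pc]]]]]; split.
- by move=> f h /up sf /up sh; exact: pD.
- by move=> c' f /up sf; exact: pZ.
- by exists A, k, c; split => // f /up sf; exact: pc.
Qed.

Lemma smooth_net_sub W f : smooth_net setT f -> smooth_net W f.
Proof.
move=> [d [d0 H]]; exists d; split => // k e e01; have [sd cv] := H k e e01.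
by split; [exact: smooth_csub sd|move=> p /seminorm_up; exact: cv].
Qed.

Lemma moderate_sub W f : moderate setT f -> moderate W f.
Proof. by move=> [sf mf]; split; [exact: smooth_net_sub|move=> p /seminorm_up; exact: mf]. Qed.

Lemma negligible_sub W f : negligible setT f -> negligible W f.
Proof. by move=> [sf mf]; split; [exact: smooth_net_sub|move=> p /seminorm_up; exact: mf]. Qed.

Lemma smooth_net_at W f e : smooth_net W f -> 0 < e < 1 -> smooth W (f e).
Proof. by move=> [d [<- H]] e01; have [] := H 0%N e e01. Qed.

Lemma seminorm_lin W (p : (V -> C) -> R) (c : C) (f h : V -> C) : open W -> continuous_seminorm W p ->
  smooth W f -> smooth W h -> p (fun x => c * f x + h x) <= normc c * p f + p h.
Proof.
move=> oW [pD pZ _] sf sh; apply: (le_trans (pD _ _ (smooth_cZ c oW sf) sh)).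
by rewrite pZ.
Qed.

Lemma smooth_net_lin W (c : C) f g : open W -> smooth_net W f -> smooth_net W g ->
  smooth_net W (fun e x => c * f e x + g e x).
Proof.
move=> oW [d1 [<- H1]] [d2 [<- H2]].
exists (fun k e x => c * d1 k e x + d2 k e x); split => // k e e01.
have [s1 c1] := H1 k e e01; have [s2 c2] := H2 k e e01; split; first exact: smooth_clin.
move=> p cp.
pose X h := fun x : V => (h^-1)%:C * (d1 k (e + h) x - d1 k e x) - d1 k.+1 e x.
pose Y h := fun x : V => (h^-1)%:C * (d2 k (e + h) x - d2 k e x) - d2 k.+1 e x.
have cv : (normc c * p (X h) + p (Y h)) @[h --> 0^'] --> (0 : R).
  have {2}-> : (0 : R) = normc c * 0 + 0 by rewrite mulr0 addr0.
  by apply: cvgD; [apply: cvgM; [exact: cvg_cst|exact: c1]|exact: c2].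
have [r r0 hr] := near01_ball e01.
apply/cvgrPdist_le => d d0; near=> h.
have eh : 0 < e + h < 1.
  have /hr/andP[h1 h2] : `|e + h - e| < r by rewrite addrAC subrr add0r; near: h; exact: dnbhs0_lt.
  by rewrite h2 andbT (lt_trans _ h1)// divr_gt0//; case/andP: e01.
have [s1' _] := H1 k (e + h) eh; have [s2' _] := H2 k (e + h) eh.
have [s1'' _] := H1 k.+1 e e01; have [s2'' _] := H2 k.+1 e e01.
have sX : smooth W (X h) := smooth_cB oW (smooth_cZ _ oW (smooth_cB oW s1' s1)) s1''.
have sY : smooth W (Y h) := smooth_cB oW (smooth_cZ _ oW (smooth_cB oW s2' s2)) s2''.
have -> : (fun x => (h^-1)%:C * (c * d1 k (e + h) x + d2 k (e + h) x - (c * d1 k e x + d2 k e x)) -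
    (c * d1 k.+1 e x + d2 k.+1 e x)) = fun x => c * X h x + Y h x.
  by apply/funext => x; rewrite /X /Y; ring.
rewrite sub0r normrN ger0_norm; last exact: (seminorm_ge0 oW cp (smooth_clin c oW sX sY)).
apply: (le_trans (seminorm_lin c oW cp sX sY)); apply: (le_trans (ler_norm _)).
near: h; move/cvgrPdist_le: cv => /(_ d d0); apply: filterS => h.
by rewrite sub0r normrN.
Unshelve. all: by end_near. Qed.

Lemma negligible_lin W (c : C) f g : open W -> negligible W f -> negligible W g ->
  negligible W (fun e x => c * f e x + g e x).
Proof.
move=> oW [sf nf] [sg ng]; split; first exact: smooth_net_lin.
move=> p cp N; have [K1 K10 b1] := bigO_ex (nf p cp N); have [K2 K20 b2] := bigO_ex (ng p cp N).
apply: (@bigO_near _ (normc c * K1 + K2)); near=> e.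
have e01 : 0 < e < 1.
  by apply/andP; split; near: e; [exact: nbhs_right_gt|exact: nbhs_right_lt].
have s1 := smooth_net_at sf e01; have s2 := smooth_net_at sg e01.
rewrite ger0_norm; last exact: (seminorm_ge0 oW cp (smooth_clin c oW s1 s2)).
apply: (le_trans (seminorm_lin c oW cp s1 s2)); rewrite mulrDl -mulrA; apply: lerD.
  rewrite ler_wpM2l ?normc_ge0// (le_trans (ler_norm _))//; near: e; exact: b1.
by rewrite (le_trans (ler_norm _))//; near: e; exact: b2.
Unshelve. all: by end_near. Qed.

Lemma negligible_cvg W f p : negligible W f -> continuous_seminorm W p ->
  p (f e) @[e --> 0^'+] --> (0 : R).
Proof.
move=> [sf nf] cp; have [K K0 b] := bigO_ex (nf p cp 1%Z).
apply/cvgrPdist_le => d d0; near=> e.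
have e0 : 0 < e by near: e; exact: nbhs_right_gt.
rewrite sub0r normrN; apply: (@le_trans _ _ (K * e ^ 1%Z)); first by near: e.
rewrite expr1z -ler_pdivlMl// mulrC; near: e; apply: nbhs_right_le.
by rewrite divr_gt0.
Unshelve. all: by end_near. Qed.

(** There are finitely many sequences of length at most k. *)
Lemma uniform_size (P : seq 'I_m -> R -> Prop) k :
  (forall s, exists2 K, 0 <= K & P s K) -> (forall s K K', K <= K' -> P s K -> P s K') ->
  exists2 K, 0 <= K & forall s, (size s <= k)%N -> P s K.
Proof.
move=> PK mono; elim: k => [|k [K K0 hK]].
  have [K K0 hK] := PK [::]; exists K => // s; by rewrite leqn0 => /nilP->.
have Q (t : k.+1.-tuple 'I_m) : exists K' : R, 0 <= K' /\ P t K'.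
  by have [K' K'0 hK'] := PK t; exists K'.
have [Kt hKt] := choice Q.
have Kt0 t : 0 <= Kt t by case: (hKt t).
exists (K + \sum_t Kt t) => [|s]; first by rewrite addr_ge0// sumr_ge0.
rewrite leq_eqVlt => /orP[/eqP sk|sk]; last by apply: mono (hK s sk); rewrite lerDl sumr_ge0.
have [_] := hKt (tcast sk (in_tuple s)); rewrite val_tcast/=; apply: mono.
by rewrite (bigD1 (tcast sk (in_tuple s)))//= addrCA lerDl addr_ge0// sumr_ge0.
Qed.

Lemma cnet_negligible W (g1 g2 : R -> V -> R) : open W -> rnet g1 -> rnet g2 ->
  (forall A s (M : nat), compact A -> A `<=` W -> exists2 K : R, 0 <= K & forall e x, 0 < e < 1 -> A x ->
    `|ipartial s (g1 e) x| <= K * e ^+ M /\ `|ipartial s (g2 e) x| <= K * e ^+ M) ->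
  negligible W (cnet g1 g2).
Proof.
move=> oW r1 r2 small; split; first exact/smooth_net_sub/cnet_smooth.
move=> p cp N; have [A [k [c [cA AW c0 pc]]]] := seminorm_bound oW cp.
pose M := `|N|%N.
have [K K0 hK] : exists2 K : R, 0 <= K & forall s, (size s <= k)%N -> forall e x, 0 < e < 1 -> A x ->
    `|ipartial s (g1 e) x| <= K * e ^+ M /\ `|ipartial s (g2 e) x| <= K * e ^+ M.
  apply: uniform_size => [s|s B B' BB' hB e x e01 Ax]; first exact: small.
  have eM : 0 <= e ^+ M by rewrite exprn_ge0//; case/andP: e01 => /ltW.
  have [h1 h2] := hB e x e01 Ax.
  by split; [apply: le_trans h1 _|apply: le_trans h2 _]; rewrite ler_wpM2r.
apply: (@bigO_le R (fun e => p (cnet g1 g2 e)) (c * K)) => e e01; have /andP[e0 e1] := e01.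
have eM : e ^+ M <= e ^ N.
  rewrite /M; case: N {M hK} => n /=; first by [].
  rewrite NegzE -exprnN; apply: (@le_trans _ _ 1); first by rewrite exprn_ile1// ltW.
  by rewrite invf_ge1 ?exprn_gt0// exprn_ile1// ltW.
apply: (@le_trans _ _ (c * (K * e ^+ M))); last by rewrite mulrA ler_wpM2l// mulr_ge0.
apply: pc; first by apply: smooth_csub (_ : W `<=` setT) _ => //; apply: smooth_cplx; exact: rnet_smooth.
- by rewrite mulr_ge0// exprn_ge0// ltW.
- by move=> x s Ax sk; have [] := hK s sk e x e01 Ax.
- by move=> x s Ax sk; have [] := hK s sk e x e01 Ax.
Qed.

End negligible.

(** * Localization, and decay away from the diagonal *)

Section cutoffs.
Variables (R : realType) (m : nat).
Local Notation C := R[i].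
Local Notation V := 'rV[R]_m.
Implicit Types (f : V -> C) (chi : V -> R) (u : (V -> C) -> C).

Definition scale chi f : V -> C := fun x => (chi x)%:C * f x.

Lemma re_scale chi f : re_ (scale chi f) = fun x => chi x * re_ f x.
Proof. by apply/funext => x; rewrite /re_ /scale ReM /= mul0r subr0. Qed.

Lemma im_scale chi f : im_ (scale chi f) = fun x => chi x * im_ f x.
Proof. by apply/funext => x; rewrite /im_ /scale ImM /= mul0r addr0. Qed.

Lemma scale_smooth chi f : smooth_real setT chi -> smooth setT f -> smooth setT (scale chi f).
Proof.
move=> sc [sr si]; split.
  by rewrite -/(re_ (scale chi f)) re_scale; exact: smoothM.
by rewrite -/(im_ (scale chi f)) im_scale; exact: smoothM.
Qed.

Lemma scale_test chi f (c : V) (r : R) : smooth_real setT chi -> smooth setT f ->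
  (forall y, r <= `|y - c| -> chi y = 0) ->
  test_function (scale chi f) /\ (closure [set x | scale chi f x != 0] `<=` [set y | `|y - c| <= r]).
Proof.
move=> sc sf c0; pose D : set V := [set y | `|y - c| <= r].
have cD : closed D.
  rewrite (_ : D = (fun y => `|y - c|) @^-1` [set t : R | t <= r]); last by [].
  apply: closed_comp; last exact: closed_le.
  move=> y _; apply: continuous_comp; last exact: norm_continuous.
  by apply: (@continuousB R V V); [exact: cvg_id|exact: cst_continuous].
have SD : closure [set x | scale chi f x != 0] `<=` D.
  rewrite [X in _ `<=` X]((closure_id D).1 cD); apply: closure_subset => y /= fy.
  rewrite /D /= leNgt; apply/negP => ry; move: fy; rewrite /scale c0 ?(ltW ry)// mul0r eqxx//.
have bD : bounded_set D.
  exists (r + `|c|); split; first exact: num_real.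
  move=> M rM y yD /=; rewrite -(subrK c y) (le_trans (ler_normD _ _))// ltW//.
  by rewrite (le_lt_trans _ rM)// lerD2r.
split; last exact: SD.
split; first exact: scale_smooth sc sf.
by apply: subclosed_compact (bounded_closed_compact bD cD) SD; exact: closed_closure.
Qed.

(** All derivatives vanish on a neighbourhood of the compact set that controls
    u. *)
Lemma dist0 u A k c f : (forall g (B : R), smooth setT g -> 0 <= B ->
    (forall x s, A x -> (size s <= k)%N -> `|ipartial s (re_ g) x| <= B) ->
    (forall x s, A x -> (size s <= k)%N -> `|ipartial s (im_ g) x| <= B) -> `|normc (u g)| <= c * B) ->
  smooth setT f -> (exists W, [/\ open W, A `<=` W & forall x, W x -> f x = 0]) -> u f = 0.
Proof.
move=> uc sf [W [oW AW f0]]; have := uc f 0 sf (lexx _).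
have h (g : V -> R) : (forall x, W x -> g x = 0) -> forall x s, A x -> (size s <= k)%N -> `|ipartial s g x| <= 0.
  move=> g0 x s Ax _; rewrite (ipartial_eq_on (U := W) s (g := fun=> 0) oW)//; last exact: AW.
  by rewrite ipartial0 normr0.
move=> /(_ _ _)/=.
rewrite mulr0 normr_le0 => /(_ (h _ _) (h _ _)) H.
have : normc (u f) == 0 by apply: H => x /f0 E; rewrite /re_ /im_ E.
rewrite /normc; case: (u f) => a b /=; rewrite sqrtr_eq0 => ab.
have a2 := sqr_ge0 a; have b2 := sqr_ge0 b.
have /eqP : a ^+ 2 = 0 by apply/eqP; rewrite eq_le a2 andbT (le_trans _ ab)// lerDl.
have /eqP : b ^+ 2 = 0 by apply/eqP; rewrite eq_le b2 andbT (le_trans _ ab)// lerDr.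
by rewrite !sqrf_eq0 => /eqP-> /eqP->.
Qed.

(** A cutoff equal to 1 near the compact sets that control u and v replaces f
    by a test function without changing u f and v f. *)
Lemma dist_eq_test u v : compact_distribution u -> compact_distribution v ->
  (forall phi, test_function phi -> u phi = v phi) -> distribution_eq u v.
Proof.
move=> [ul uc] [vl vc] uv f sf.
have [A1 [k1 [c1 [cA1 _ _ b1]]]] := seminorm_bound openT uc.
have [A2 [k2 [c2 [cA2 _ _ b2]]]] := seminorm_bound openT vc.
have cn : continuous (fun y : V => `|y|) by exact: norm_continuous.
have [M1 M10 h1] := @compact_bound R m (fun y => `|y|) A1 cn cA1.
have [M2 M20 h2] := @compact_bound R m (fun y => `|y|) A2 cn cA2.
(* both compact sets lie in the open ball of radius M *)
pose M := M1 + M2 + 1; have M0 : 0 < M by rewrite ltr_wpDl// addr_ge0.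
have [ch [sc ch1 ch0]] := @smooth_bump R m (0 : V) M M0.
have [tf _] := scale_test sc sf ch0.
have scf := scale_smooth sc sf.
pose W : set V := [set y | `|y| < M].
have oW : open W.
  rewrite (_ : W = ball (0 : V) M); first exact: ball_open.
  by apply/seteqP; split => x; rewrite /W -ball_normE/= sub0r normrN.
have z w A (hw : A `<=` W) (wl : forall (c : C) f h, smooth setT f -> smooth setT h ->
     w (fun x => c * f x + h x) = c * w f + w h) k c :
    (forall g (B : R), smooth setT g -> 0 <= B ->
    (forall x s, A x -> (size s <= k)%N -> `|ipartial s (re_ g) x| <= B) ->
    (forall x s, A x -> (size s <= k)%N -> `|ipartial s (im_ g) x| <= B) -> `|normc (w g)| <= c * B) ->
    w f = w (scale ch f).
  move=> wc; have sd := smooth_clin (-1) openT scf sf.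
  have := dist0 wc sd; rewrite wl// => H.
  apply/eqP; rewrite -subr_eq0 addrC -mulN1r; apply/eqP; apply: H.
  exists W; split => // x xW; rewrite /scale ch1 ?subr0 ?(ltW xW)//.
  by rewrite mul1r mulN1r addNr.
rewrite (z u A1 _ ul k1 c1 b1); last first.
  by move=> y /h1; rewrite normr_id /W /= => hy; rewrite (le_lt_trans hy)// /M; lra.
rewrite (z v A2 _ vl k2 c2 b2); last first.
  by move=> y /h2; rewrite normr_id /W /= => hy; rewrite (le_lt_trans hy)// /M; lra.
exact: uv.
Qed.

End cutoffs.

Section approximate_unit.
Variables (R : realType) (n : nat).
Local Notation C := R[i].
Local Notation V := 'rV[R]_n.
Local Notation N := (n + n + 1)%N.
Local Notation H := 'rV[R]_N.
Local Notation Rm := (measurableTypeR R).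
Local Notation lt m := (lebesgue_tuple R m).
Local Notation net := (R -> V -> C).
Implicit Types (e th : R) (x y : V) (u v : (V -> C) -> C).

Lemma fam_slice_smooth K G e x : @fam R n K G -> 0 < e < 1 -> smooth_real setT (G e x).
Proof.
move=> fG e01; have := slice_smooth x (rnet_smooth (fam_rnet fG) e01).
by congr smooth_real; apply/funext => y; rewrite row_mxKl row_mxKr.
Qed.

Lemma fam_functional_rnet K G w A k c : @fam R n K G -> functional w A k c ->
  rnet (fun e x => w (G e x)).
Proof.
move=> fG fw; have := rnet_functional fw (fam_rnet fG); congr rnet.
by apply/funext => e; apply/funext => x; congr w; apply/funext => y; rewrite row_mxKl row_mxKr.
Qed.

(** The derivatives of x |-> w(G_e(x, .)) are again of this form, by stability
    of [fam] under the derivatives in x. *)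
Lemma fam_functional_ipartial K G w A k c s : @fam R n K G -> functional w A k c ->
  exists K' G', @fam R n K' G' /\
  forall e, 0 < e < 1 -> ipartial s (fun x => w (G e x)) = fun x => w (G' e x).
Proof.
move=> fG fw; elim: s => [|i s [K' [G' [fG' E]]]]; first by exists K, G.
have [g' [[K2 [G2 [fG2 g'E]]] d]] := fam_net_dx (lshift n i) fG'.
exists K2, G2; split => // e e01; rewrite -cat1s ipartial_cat E//; apply: ipartial_eq => x.
have := functional_slice_derive i x fw (fam_rnet fG') e01.
rewrite (ipartial_eq (fun z => d e z e01)) g'E.
have L (F : R -> V -> V -> R) x' : (fun y => F e (lsubmx (row_mx x' y)) (rsubmx (row_mx x' y))) = F e x'.
  by apply/funext => y; rewrite row_mxKl row_mxKr.
by rewrite L; congr is_derive; apply/funext => x'; rewrite L.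
Qed.

(** As w kills chi times anything, only (1 - chi) G_e(x, .) matters. It
    vanishes where |y - x0| < r, and elsewhere |y - x| >= r / 2, where
    [fam_offdiag] applies to all derivatives in y. *)
Lemma offdiag_small W (M : nat) w A k c K0 G chi (x0 : V) (r : R) : @fam R n K0 G -> functional w A k c ->
  compact A -> 0 < r ->
  smooth_real setT chi -> (forall y, `|y - x0| <= r -> chi y = 1) ->
  (forall g, smooth_real setT g -> w (fun y => chi y * g y) = 0) ->
  W `<=` [set x | `|x - x0| < r / 2] ->
  exists2 C0 : R, 0 <= C0 & forall e x, 0 < e < 1 -> W x -> `|w (G e x)| <= C0 * e ^+ M.
Proof.
move=> fG fw cA r0 sc c1 w0 Wr.
pose ch y := -1 * chi y + 1.
have sch : smooth_real setT ch := smooth_lin (-1) openT sc (smooth_cst 1 openT).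
have [X X0 hX] : exists2 X : R, 0 <= X & forall s, (size s <= k)%N -> forall y, A y -> `|ipartial s ch y| <= X.
  apply: uniform_size => [s|s B B' BB' hB y Ay]; last exact: le_trans (hB y Ay) BB'.
  apply: compact_bound cA; exact: smooth_continuous (smooth_ipartial s sch).
have [Y Y0 hY] : exists2 Y : R, 0 <= Y & forall s, (size s <= k)%N -> forall e x y, 0 < e < 1 ->
    r / 2 <= `|y - x| -> `|ipartial s (G e x) y| <= Y * e ^+ M.
  apply: uniform_size => [s|s B B' BB' hB e x y e01 yx]; last first.
    by apply: le_trans (hB e x y e01 yx) _; rewrite ler_wpM2r// exprn_ge0//; case/andP: e01 => /ltW.
  have [K' [G' [fG' E]]] : exists K' G', @fam R n K' G' /\ forall e x, 0 < e < 1 -> ipartial s (G e x) = G' e x.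
    elim: s => [|i s [K' [G' [fG' E]]]]; first by exists K0, G.
    have [G'' fG'' d] := fam_dy i fG'; exists K'.+1, G''; split => // e x e01.
    by rewrite -cat1s ipartial_cat E//; apply: ipartial_eq => y; exact: d.
  have rh : 0 < r / 2 by rewrite divr_gt0.
  have [B B0 hB] := fam_offdiag M fG' rh; exists B => // e x y e01 yx.
  have [i hi] := norm_coord_ge rh yx.
  by rewrite E//; exact: hB hi.
have [c0 wl wle] := fw.
exists (c * (2 ^+ k * (X * Y))) => [|e x e01 Wx]; first by rewrite !mulr_ge0// exprn_ge0.
have eM : 0 <= e ^+ M by rewrite exprn_ge0//; case/andP: e01 => /ltW.
have sG := fam_slice_smooth x fG e01.
have -> : w (G e x) = w (fun y => ch y * G e x y).
  have -> : (fun y => ch y * G e x y) = fun y => -1 * (chi y * G e x y) + G e x y.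
    by apply/funext => y; rewrite /ch; ring.
  by rewrite (wl _ _ _ (smoothM sc sG) sG) (w0 _ sG) mulr0 add0r.
rewrite -mulrA; apply: wle; first exact: smoothM sch sG.
  by rewrite !mulr_ge0// exprn_ge0.
move=> s y Ay sk; have [yr|yr] := ltP `|y - x0| r.
  pose U : set V := [set y | `|y - x0| < r].
  have oU : open U.
    rewrite (_ : U = ball x0 r); first exact: ball_open.
    by apply/seteqP; split => z; rewrite /U -ball_normE/= distrC.
  rewrite (ipartial_eq_on (U := U) s (g := fun=> 0) oU)//.
    by rewrite ipartial0 normr0 mulr_ge0// !mulr_ge0// exprn_ge0.
  by move=> z zr; rewrite /ch c1 ?(ltW zr)//; ring.
have yx : r / 2 <= `|y - x|.
  have := Wr x Wx; rewrite /= => xr; have := ler_distD x y x0.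
  move=> h; rewrite -(lerD2r `|x - x0|); apply: le_trans _ h; apply: le_trans _ yr.
  by rewrite [leRHS](splitr r) lerD2l ltW.
apply: (@le_trans _ _ (2 ^+ size s * (X * (Y * e ^+ M)))).
  apply: (ipartialM_le sch sG (k := k)) sk.
    by move=> t tk; exact: hX.
  by move=> t tk; exact: hY.
by rewrite -!mulrA ler_wpM2r ?mulr_ge0// ler_weXn2l// ler1n.
Qed.

Section net_of_distribution.
Variables (r1 r2 : H -> R).
Hypotheses (s1 : rschwartz r1) (s2 : rschwartz r2).
Local Notation K := (opK r1 r2).

Lemma opK_smooth e x : 0 < e < 1 -> smooth setT (K e x).
Proof.
move=> e01; apply: smooth_cplx.
  exact: (fam_slice_smooth x (fam_kre s1 s2) e01).
exact: (fam_slice_smooth x (fam_kim s1 s2) e01).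
Qed.

Lemma dist_opK u e x : compact_distribution u -> 0 < e < 1 ->
  u (K e x) =
  (-1 * complex.Im (u (rcplx (kim r1 r2 e x))) + complex.Re (u (rcplx (kre r1 r2 e x)))) +i*
  (1 * complex.Re (u (rcplx (kim r1 r2 e x))) + complex.Im (u (rcplx (kre r1 r2 e x)))).
Proof.
move=> du e01; rewrite [LHS](dist_split du (opK_smooth x e01)).
rewrite -[im_ _]/(kim r1 r2 e x) -[re_ _]/(kre r1 r2 e x).
by apply: ReIm_eq; rewrite ?(ReD, ImD, ReM, ImM)/=; ring.
Qed.

Lemma dist_rnet u : compact_distribution u ->
  rnet (fun e x => complex.Re (u (K e x))) /\ rnet (fun e x => complex.Im (u (K e x))).
Proof.
move=> du; have [A [k [c [_ fr fi]]]] := dist_functional du.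
split.
  have := rnet_lin (-1) (fam_functional_rnet (fam_kim s1 s2) fi) (fam_functional_rnet (fam_kre s1 s2) fr).
  by apply: rnet_ext => e x e01; rewrite dist_opK.
have := rnet_lin 1 (fam_functional_rnet (fam_kim s1 s2) fr) (fam_functional_rnet (fam_kre s1 s2) fi).
by apply: rnet_ext => e x e01; rewrite dist_opK.
Qed.

(** The net u(K_e(x, .)). *)
Definition dnet u : net := fun e => kernel_distribution (K e) u.

Lemma dnetE u : dnet u = cnet (fun e x => complex.Re (u (K e x))) (fun e x => complex.Im (u (K e x))).
Proof. by apply/funext => e; apply/funext => x; rewrite /cnet -complex_eta. Qed.

Lemma dnet_moderate u : compact_distribution u -> moderate setT (dnet u).
Proof. by move=> /dist_rnet[? ?]; rewrite dnetE; exact: cnet_moderate. Qed.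

(** A cutoff supported in U and equal to 1 near x0 splits K_e(x, .): u
    vanishes on the first part, a test function supported in U, and
    [offdiag_small] controls the second. *)
Lemma dnet_negligible u U x0 : compact_distribution u -> open U -> U x0 ->
  (forall f, test_function f -> closure [set x | f x != 0] `<=` U -> u f = 0) ->
  exists W, [/\ open W, W x0 & negligible W (dnet u)].
Proof.
move=> du oU Ux0 u0; have [A [k [c [cA fr fi]]]] := dist_functional du.
have /nbhs_ballP[d d0 dU] : nbhs x0 U by apply: open_nbhs_nbhs.
have k0 : 0 < 2 * n.+1%:R + 1 :> R by rewrite ltr_wpDl.
(* the cutoff of radius r vanishes outside the ball of radius 2 (n + 1) r < d *)
pose r := d / (2 * n.+1%:R + 1); have r0 : 0 < r by rewrite divr_gt0.
have rd : 2 * n.+1%:R * r < d.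
  by rewrite /r mulrA ltr_pdivrMr// mulrC ltr_pM2l// ltrDl.
have [chi [sc c1 c0]] := @smooth_bump R n x0 r r0.
pose W : set V := [set x | `|x - x0| < r / 2].
have oW : open W.
  rewrite (_ : W = ball x0 (r / 2)); first exact: ball_open.
  by apply/seteqP; split => x; rewrite /W -ball_normE/= distrC.
have uchi g : smooth_real setT g -> u (rcplx (fun y => chi y * g y)) = 0.
  move=> sg; have [tf cl] := scale_test sc (rcplx_smooth sg) c0.
  have -> : rcplx (fun y => chi y * g y) = scale chi (rcplx g).
    by apply/funext => y; rewrite /scale /rcplx rmorphM.
  apply: u0 => //; apply: subset_trans cl _ => y /= yr; apply: dU.
  by rewrite -ball_normE/= distrC (le_lt_trans yr).
exists W; split => //; first by rewrite /W /= subrr normr0 divr_gt0.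
have [rr ri] := dist_rnet du; rewrite dnetE; apply: cnet_negligible => // B s M cB BW.
have S w (fw : functional w A k c) K0 G : (forall g, smooth_real setT g -> w (fun y => chi y * g y) = 0) ->
    @fam R n K0 G -> exists2 C0 : R, 0 <= C0 & forall e x, 0 < e < 1 -> W x ->
    `|ipartial s (fun x => w (G e x)) x| <= C0 * e ^+ M.
  move=> w0 fG; have [K' [G' [fG' E]]] := fam_functional_ipartial s fG fw.
  have [C0 C00 hC] := offdiag_small M fG' fw cA r0 sc c1 w0 (@subset_refl _ W).
  by exists C0 => // e x e01 Wx; rewrite E//; exact: hC.
have fr0 g : smooth_real setT g -> complex.Re (u (rcplx (fun y => chi y * g y))) = 0.
  by move=> /uchi->.
have fi0 g : smooth_real setT g -> complex.Im (u (rcplx (fun y => chi y * g y))) = 0.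
  by move=> /uchi->.
have [C1 C10 h1] := S _ fr _ _ fr0 (fam_kre s1 s2); have [C2 C20 h2] := S _ fi _ _ fi0 (fam_kre s1 s2).
have [C3 C30 h3] := S _ fr _ _ fr0 (fam_kim s1 s2); have [C4 C40 h4] := S _ fi _ _ fi0 (fam_kim s1 s2).
exists (C1 + C2 + C3 + C4) => [|e x e01 /BW Wx]; first by rewrite !addr_ge0.
have eM : 0 <= e ^+ M by rewrite exprn_ge0//; case/andP: e01 => /ltW.
have sm w (fw : functional w A k c) K0 G (fG : @fam R n K0 G) : smooth_real setT (fun x => w (G e x)).
  exact: (rnet_smooth (fam_functional_rnet fG fw) e01).
have E1 : (fun x => complex.Re (u (K e x))) = fun x => -1 * complex.Im (u (rcplx (kim r1 r2 e x))) + complex.Re (u (rcplx (kre r1 r2 e x))).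
  by apply/funext => y; rewrite dist_opK.
have E2 : (fun x => complex.Im (u (K e x))) = fun x => 1 * complex.Re (u (rcplx (kim r1 r2 e x))) + complex.Im (u (rcplx (kre r1 r2 e x))).
  by apply/funext => y; rewrite dist_opK.
rewrite E1 E2.
rewrite (ipartial_lin (-1) s openT (sm _ fi _ _ (fam_kim s1 s2)) (sm _ fr _ _ (fam_kre s1 s2)))//.
rewrite (ipartial_lin 1 s openT (sm _ fr _ _ (fam_kim s1 s2)) (sm _ fi _ _ (fam_kre s1 s2)))//.
have {}h1 := h1 e x e01 Wx; have {}h2 := h2 e x e01 Wx.
have {}h3 := h3 e x e01 Wx; have {}h4 := h4 e x e01 Wx.
have q1 : 0 <= C1 * e ^+ M by exact: mulr_ge0.
have q2 : 0 <= C2 * e ^+ M by exact: mulr_ge0.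
have q3 : 0 <= C3 * e ^+ M by exact: mulr_ge0.
have q4 : 0 <= C4 * e ^+ M by exact: mulr_ge0.
rewrite mulN1r mul1r !mulrDl; split; apply: (le_trans (ler_normD _ _)); rewrite ?normrN; lra.
Qed.

End net_of_distribution.

End approximate_unit.

(** * Convergence, injectivity and supports *)

Section convergence.
Variables (R : realType) (n : nat).
Local Notation C := R[i].
Local Notation V := 'rV[R]_n.
Local Notation N := (n + n + 1)%N.
Local Notation H := 'rV[R]_N.
Local Notation Rm := (measurableTypeR R).
Local Notation lt m := (lebesgue_tuple R m).
Local Notation net := (R -> V -> C).
Implicit Types (e th : R) (x y : V) (u v : (V -> C) -> C) (phi : V -> C).

(** Exchanging x and y changes the sign of y - x and leaves (x + y)/2 fixed. *)
Lemma opK_refl (r1 r2 : H -> R) e x y : opK r1 r2 e x y = opK (zrefl r1) (zrefl r2) e y x.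
Proof.
have E rho th : skern rho th e x y = skern (zrefl rho) th e y x.
  rewrite /skern /kern (addrC y x); apply: eq_Rintegral => q _.
  rewrite /kintegrand /rescaleR /zrefl; congr (_ * rho _ * _).
  have zi (i : 'I_n) : zsign R (iz i) = -1.
    by rewrite /zsign (_ : [exists j, _] = true)//; apply/existsP; exists i.
  have zo (i : 'I_(n + n + 1)) : (forall j : 'I_n, i != iz j) -> zsign R i = 1.
    move=> h; rewrite /zsign (_ : [exists j, _] = false)//; apply/negbTE/existsPn => j; exact: h.
  apply/rowP => i; rewrite [RHS]mxE; case: (splitP i) => [j ij|j ij].
    have {}ij : i = lshift 1 j by exact/val_inj.
    case: (splitP j) => [l jl|l jl].
      have {}jl : j = lshift n l by exact/val_inj.
      rewrite ij jl -[lshift 1 (lshift n l)]/(iz l) zi mxE [in RHS]mxE !glue_z !mxE.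
      by rewrite mulN1r -mulrN opprB.
    have {}jl : j = rshift n l by exact/val_inj.
    rewrite ij jl -[lshift 1 (rshift n l)]/(ix l) zo ?mul1r; first by rewrite mxE [in RHS]mxE !glue_x.
    move=> k; apply/eqP => /(congr1 val)/= h; have := ltn_ord k; lia.
  have {}ij : i = rshift (n + n) j by exact/val_inj.
  rewrite zo ?mul1r; first by rewrite ij mxE [in RHS]mxE /zglue !row_mxEr.
  move=> k; apply/eqP => /(congr1 val)/= h; have := ltn_ord k; rewrite ij/= in h; lia.
by rewrite /opK /kre /kim !E.
Qed.

Lemma complex_regroup (a b c d p q r s : R) :
  (-1 * (1 * a + b) + (-1 * c + d)) +i* (1 * (-1 * p + q) + (1 * r + s)) =
  'i%C * ((1 * q + r) +i* (1 * b + c)) + (-1 * a + d) +i* (-1 * p + s).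
Proof. by apply: ReIm_eq; rewrite ?(ReD, ImD, ReM, ImM)/=; ring. Qed.

Section masses.
Variables (r1 r2 : H -> R).
Hypotheses (m1 : mass 1 r1) (m2 : mass 0 r2).
Local Notation K := (opK r1 r2).
Let s1 : rschwartz r1. Proof. by case: m1. Qed.
Let s2 : rschwartz r2. Proof. by case: m2. Qed.

(** The component r1 has integral 1 and r2 has integral 0. Among the eight
    integrals the limits of all but two vanish: those with r2 by its integral,
    those with r1 and the angle - pi / 2 because the cosine of that angle is
    0. *)
Lemma test_dfam f : bsmooth (re_ f) -> bsmooth (im_ f) -> exists d1 d2, [/\ dfam d1, dfam d2 &
  forall e x, 0 < e < 1 -> kernel_fun (K e) f x - f x = d1 e x +i* d2 e x].
Proof.
move=> b1 b2; pose q : R := - (pi / 2).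
have cq : cos q = 0 by rewrite /q cosN cos_pihalf.
pose D c rho g th := fun e x => wint (wave rho g th) e x - c * cos th * g x.
have F c rho g th : mass c rho -> bsmooth g -> dfam (D c rho g th) by exact: df_base.
exists (fun e x => -1 * D 0 r2 (im_ f) 0 e x + (-1 * D 1 r1 (im_ f) q e x + (-1 * D 0 r2 (re_ f) q e x + D 1 r1 (re_ f) 0 e x))).
exists (fun e x => 1 * D 0 r2 (re_ f) 0 e x + (1 * D 1 r1 (re_ f) q e x + (-1 * D 0 r2 (im_ f) q e x + D 1 r1 (im_ f) 0 e x))).
split.
- by do 3!(apply: df_lin; first exact: F); exact: F.
- by do 3!(apply: df_lin; first exact: F); exact: F.
move=> e x e01; have e0 : 0 < e by case/andP: e01.
rewrite kernel_fun_combine//; [|exact: wadm_bsmooth|exact: wadm_bsmooth].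
rewrite /combine !wave_rescale// /D cos0 -/q cq.
by apply: ReIm_eq; rewrite ?(ReD, ImD, ReN, ImN)/= /re_ /im_; ring.
Qed.

(** The net is smooth because it is the net of the distribution defined by f,
    minus a constant net; the estimates come from [dfam_ipartial_small]. *)
Lemma test_negligible f : test_function f -> negligible setT (fun e x => kernel_fun (K e) f x - f x).
Proof.
move=> tf; have [sf1 sf2 _] := test_rschwartz tf.
have b1 := rschwartz_bsmooth sf1; have b2 := rschwartz_bsmooth sf2.
have [d1 [d2 [D1 D2 E]]] := test_dfam b1 b2.
have [rr ri] := dist_rnet s1 s2 (test_distribution tf).
pose g1 e x := -1 * re_ f x + complex.Re (kernel_fun (K e) f x).
pose g2 e x := -1 * im_ f x + complex.Im (kernel_fun (K e) f x).
have -> : (fun e x => kernel_fun (K e) f x - f x) = cnet g1 g2.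
  apply/funext => e; apply/funext => x; rewrite /cnet /g1 /g2 /re_ /im_.
  by apply: ReIm_eq; rewrite ?(ReD, ImD, ReN, ImN)/= mulN1r addrC.
have rg1 : rnet g1 by exact: (rnet_lin (-1) b1 rr).
have rg2 : rnet g2 by exact: (rnet_lin (-1) b2 ri).
apply: cnet_negligible => //; first exact: openT.
move=> A s M cA _.
have [r _ hr] : exists2 r : R, 0 <= r & forall x, A x -> `| `|x| | <= r.
  by apply: (@compact_bound R n (fun y => `|y|)) => //; exact: norm_continuous.
have [C1 C10 h1] := dfam_ipartial_small s M r D1; have [C2 C20 h2] := dfam_ipartial_small s M r D2.
exists (C1 + C2) => [|e x e01 Ax]; first by rewrite addr_ge0.
have eM : 0 <= e ^+ M by rewrite exprn_ge0//; case/andP: e01 => /ltW.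
have hx i : `|x 0 i| <= r.
  by apply: le_trans (coord_le_norm x i) _; have := hr x Ax; rewrite normr_id.
have E1 : g1 e = d1 e.
  apply/funext => y; have := congr1 (@complex.Re R) (E e y e01).
  by rewrite ReD ReN /= /g1 /re_ mulN1r addrC.
have E2 : g2 e = d2 e.
  apply/funext => y; have := congr1 (@complex.Im R) (E e y e01).
  by rewrite ImD ImN /= /g2 /im_ mulN1r addrC.
rewrite E1 E2 mulrDl; split.
  by apply: (le_trans (h1 e x e01 hx)); rewrite lerDl mulr_ge0.
by apply: (le_trans (h2 e x e01 hx)); rewrite lerDr mulr_ge0.
Qed.

End masses.

Section limits.
Variables (r1 r2 : H -> R).
Hypotheses (m1 : mass 1 r1) (m2 : mass 0 r2).
Local Notation K := (opK r1 r2).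
Local Notation Kt := (opK (zrefl r1) (zrefl r2)).
Let s1 : rschwartz r1. Proof. by case: m1. Qed.
Let s2 : rschwartz r2. Proof. by case: m2. Qed.
Let t1 : rschwartz (zrefl r1). Proof. by case: (mass_zrefl m1). Qed.
Let t2 : rschwartz (zrefl r2). Proof. by case: (mass_zrefl m2). Qed.

(** By [exchange] for each of the eight products of a real or imaginary part
    of u, of the kernel and of phi. *)
Lemma pairing_transpose u phi e : compact_distribution u -> test_function phi -> 0 < e < 1 ->
  cintegral (fun x => kernel_distribution (K e) u x * phi x) = u (kernel_fun (Kt e) phi).
Proof.
move=> du tphi e01; have [p1 p2 [B cB phi0]] := test_rschwartz tphi.
have [A [k [c [cA fr fi]]]] := dist_functional du.
pose vr g := complex.Re (u (rcplx g)); pose vi g := complex.Im (u (rcplx g)).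
rewrite -/vr in fr; rewrite -/vi in fi.
have sub : closure [set x | phi x != 0] `<=` setT by [].
have b1 := rnet_bsmooth (fam_rnet (fam_kre s1 s2)) e01.
have b2 := rnet_bsmooth (fam_rnet (fam_kim s1 s2)) e01.
set F1 := (fun z : 'rV[R]_(n + n) => kre r1 r2 e (lsubmx z) (rsubmx z)) in b1.
set F2 := (fun z : 'rV[R]_(n + n) => kim r1 r2 e (lsubmx z) (rsubmx z)) in b2.
have i1 := rschwartz_integrable p1; have i2 := rschwartz_integrable p2.
have z1 x : re_ phi x != 0 -> B x.
  by move=> n0; apply: contrapT => /phi0 E; rewrite /re_ E eqxx in n0.
have z2 x : im_ phi x != 0 -> B x.
  by move=> n0; apply: contrapT => /phi0 E; rewrite /im_ E eqxx in n0.
have X w (fw : functional w A k c) F (bF : bsmooth F) psi (ip : tintegrable psi)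
  (z : forall x, psi x != 0 -> B x) := exchange fw bF ip cB z.
have S (psi : V -> R) (ip : tintegrable psi) (F : 'rV[R]_(n + n) -> R) (bF : bsmooth F) := slice_int_smooth ip bF.
have f1E w x : fslice w F1 x = w (kre r1 r2 e x).
  by congr w; apply/funext => y; rewrite /F1 row_mxKl row_mxKr.
have f2E w x : fslice w F2 x = w (kim r1 r2 e x).
  by congr w; apply/funext => y; rewrite /F2 row_mxKl row_mxKr.
have LE : kernel_fun (Kt e) phi = cplx
   (fun y => -1 * slice_int (im_ phi) F2 y + slice_int (re_ phi) F1 y)
   (fun y => 1 * slice_int (im_ phi) F1 y + slice_int (re_ phi) F2 y).
  apply/funext => y; rewrite /kernel_fun.
  rewrite (cintegral_pint tphi sub (opK_smooth t1 t2 y e01)) /cplx /slice_int.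
  have E1 : re_ (Kt e y) = fun x => F1 (row_mx x y).
    by apply/funext => x; rewrite /re_ -opK_refl /F1 row_mxKl row_mxKr.
  have E2 : im_ (Kt e y) = fun x => F2 (row_mx x y).
    by apply/funext => x; rewrite /im_ -opK_refl /F2 row_mxKl row_mxKr.
  by rewrite E1 E2.
have sL1 := smooth_lin (-1) openT (S _ i2 _ b2) (S _ i1 _ b1).
have sL2 := smooth_lin 1 openT (S _ i2 _ b1) (S _ i1 _ b2).
have sL : smooth setT (kernel_fun (Kt e) phi) by rewrite LE; exact: (smooth_cplx sL1 sL2).
rewrite [RHS](dist_split du sL).
have -> : im_ (kernel_fun (Kt e) phi) = fun y => 1 * slice_int (im_ phi) F1 y + slice_int (re_ phi) F2 y by rewrite LE.
have -> : re_ (kernel_fun (Kt e) phi) = fun y => -1 * slice_int (im_ phi) F2 y + slice_int (re_ phi) F1 y by rewrite LE.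
have [rr ri] := dist_rnet s1 s2 du.
have sd : smooth setT (kernel_distribution (K e) u).
  split; [exact: (rnet_smooth rr e01)|exact: (rnet_smooth ri e01)].
rewrite (cintegral_pint tphi sub sd).
have q w (fw : functional w A k c) F (bF : bsmooth F) psi (ip : tintegrable psi) :
    tintegrable (fun x => fslice w F x * psi x).
  have bf := fslice_bsmooth fw bF; have [M M0 hM] := bsmooth_bound bf.
  exact: (tintegrableM (smooth_continuous (bsmooth_smooth bf)) hM ip).
have Er : re_ (kernel_distribution (K e) u) = fun x => -1 * fslice vi F2 x + fslice vr F1 x.
  by apply/funext => x; rewrite f1E f2E /re_ /kernel_distribution (dist_opK s1 s2 x du e01).
have Ei : im_ (kernel_distribution (K e) u) = fun x => 1 * fslice vr F2 x + fslice vi F1 x.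
  by apply/funext => x; rewrite f1E f2E /im_ /kernel_distribution (dist_opK s1 s2 x du e01).
rewrite Er Ei.
rewrite !(pintD _ (q _ fi _ b2 _ i2) (q _ fr _ b1 _ i2)) !(pintD _ (q _ fr _ b2 _ i2) (q _ fi _ b1 _ i2)).
rewrite !(pintD _ (q _ fi _ b2 _ i1) (q _ fr _ b1 _ i1)) !(pintD _ (q _ fr _ b2 _ i1) (q _ fi _ b1 _ i1)).
have LR : u (rcplx (fun y => -1 * slice_int (im_ phi) F2 y + slice_int (re_ phi) F1 y)) =
   (-1 * vr (slice_int (im_ phi) F2) + vr (slice_int (re_ phi) F1)) +i*
   (-1 * vi (slice_int (im_ phi) F2) + vi (slice_int (re_ phi) F1)).
  rewrite [LHS]complex_eta; congr (_ +i* _).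
    exact: (functional_lin fr (-1) (S _ i2 _ b2) (S _ i1 _ b1)).
  exact: (functional_lin fi (-1) (S _ i2 _ b2) (S _ i1 _ b1)).
have LI : u (rcplx (fun y => 1 * slice_int (im_ phi) F1 y + slice_int (re_ phi) F2 y)) =
   (1 * vr (slice_int (im_ phi) F1) + vr (slice_int (re_ phi) F2)) +i*
   (1 * vi (slice_int (im_ phi) F1) + vi (slice_int (re_ phi) F2)).
  rewrite [LHS]complex_eta; congr (_ +i* _).
    exact: (functional_lin fr 1 (S _ i2 _ b1) (S _ i1 _ b2)).
  exact: (functional_lin fi 1 (S _ i2 _ b1) (S _ i1 _ b2)).
apply: (etrans _ (esym (congr2 (fun a b : C => 'i%C * a + b) LI LR))).
have q1 := X _ fr _ b1 _ i1 z1; have q2 := X _ fr _ b1 _ i2 z2.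
have q3 := X _ fr _ b2 _ i1 z1; have q4 := X _ fr _ b2 _ i2 z2.
have q5 := X _ fi _ b1 _ i1 z1; have q6 := X _ fi _ b1 _ i2 z2.
have q7 := X _ fi _ b2 _ i1 z1; have q8 := X _ fi _ b2 _ i2 z2.
rewrite -q1 -q2 -q3 -q4 -q5 -q6 -q7 -q8.
exact: complex_regroup.
Qed.

(** By the transposition, the quantity is u applied to the approximation of
    phi attached to the reflected functions, minus u(phi). That approximation
    differs from phi by a negligible net, and u is continuous. *)
Lemma pairing_limit u phi : compact_distribution u -> test_function phi ->
  normc (cintegral (fun x => kernel_distribution (K e) u x * phi x) - u phi) @[e --> 0^'+] --> (0 : R).
Proof.
move=> du tphi; have := negligible_cvg (test_negligible (mass_zrefl m1) (mass_zrefl m2) tphi) (proj2 du).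
apply: cvg_trans; apply: near_eq_cvg; near=> e.
have e01 : 0 < e < 1 by apply/andP; split; near: e; [exact: nbhs_right_gt|exact: nbhs_right_lt].
rewrite (pairing_transpose du tphi e01); congr normc.
have sphi : smooth setT phi by case: tphi.
have sL : smooth setT (kernel_fun (Kt e) phi).
  have [rr ri] := dist_rnet t1 t2 (test_distribution tphi).
  split; [exact: (rnet_smooth rr e01)|exact: (rnet_smooth ri e01)].
have := proj1 du (-1) phi (kernel_fun (Kt e) phi) sphi sL.
rewrite mulN1r addrC => <-; congr u.
by apply/funext => x; rewrite mulN1r addrC.
Unshelve. all: by end_near. Qed.

Lemma negligible_zero (W : set V) : open W -> negligible W (fun _ _ => 0 : C).
Proof.
move=> oW; have Z : rnet (fun (_ : R) (_ : V) => 0 : R) by exact: (rschwartz_bsmooth (rschwartz0 R n)).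
have := @cnet_negligible R n W _ _ oW Z Z; rewrite (_ : cnet _ _ = fun _ _ => 0 : C)//; apply.
by move=> A s M _ _; exists 0 => // e x _ _; rewrite ipartial0 normr0 mul0r.
Qed.

Lemma dnet_self u (W : set V) : open W -> compact_distribution u -> gclass W (dnet r1 r2 u) (dnet r1 r2 u).
Proof.
move=> oW du; split; first by apply: moderate_sub; exact: dnet_moderate.
rewrite (_ : (fun e x => _) = fun _ _ => 0 : C); first exact: negligible_zero.
by apply/funext => e; apply/funext => x; rewrite subrr.
Qed.

Lemma dist_zero_of_limits (z : C) (a b c : R -> R) :
  a e @[e --> 0^'+] --> (0 : R) -> b e @[e --> 0^'+] --> (0 : R) -> c e @[e --> 0^'+] --> (0 : R) ->
  (\forall e \near 0^'+, normc z <= a e + b e + c e) -> z = 0.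
Proof.
move=> ca cb cc H; have cv : (a e + b e + c e) @[e --> 0^'+] --> (0 : R).
  rewrite -[0 in X in _ --> X](addr0 0) -[X in (X + 0)](addr0 0).
  by apply: cvgD => //; exact: cvgD.
have z0 : normc z <= 0.
  apply/ler_addgt0Pr => d d0; rewrite add0r.
  near (0 : R)^'+ => e.
  have h1 : normc z <= a e + b e + c e by near: e.
  have h2 : `|0 - (a e + b e + c e)| <= d by near: e; move/cvgrPdist_le: cv => /(_ d d0).
  by rewrite (le_trans h1)// (le_trans _ h2)// sub0r normrN ler_norm.
apply/eqP; have : normc z = 0 by apply/eqP; rewrite eq_le z0 normc_ge0.
by move=> /Normc.eq0_normc ->.
Unshelve. all: by end_near. Qed.

(** The pairings of the two nets with a test function have the same limit,
    since a continuous seminorm of a negligible net tends to 0. *)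
Lemma dnet_injective u v : compact_distribution u -> compact_distribution v ->
  gclass setT (dnet r1 r2 u) = gclass setT (dnet r1 r2 v) -> distribution_eq u v.
Proof.
move=> du dv E; apply: dist_eq_test => // phi tphi.
have [_ neg] : gclass setT (dnet r1 r2 v) (dnet r1 r2 u) by rewrite -E; exact: dnet_self openT du.
have sub : closure [set x | phi x != 0] `<=` setT by [].
have cp := test_seminorm openT tphi sub.
have L := negligible_cvg neg cp.
apply/eqP; rewrite -subr_eq0; apply/eqP.
apply: (dist_zero_of_limits (pairing_limit du tphi) L (pairing_limit dv tphi)).
near=> e.
have e01 : 0 < e < 1 by apply/andP; split; near: e; [exact: nbhs_right_gt|exact: nbhs_right_lt].
have su := smooth_net_at (proj1 (dnet_moderate s1 s2 du)) e01.
have sv := smooth_net_at (proj1 (dnet_moderate s1 s2 dv)) e01.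
(* u phi - v phi is split along the two pairings *)
have -> : cintegral (fun x => (dnet r1 r2 u e x - dnet r1 r2 v e x) * phi x) =
   -1 * cintegral (fun x => dnet r1 r2 v e x * phi x) + cintegral (fun x => dnet r1 r2 u e x * phi x).
  rewrite -(cintegral_lin openT tphi sub _ sv su); congr cintegral; apply/funext => x.
  by rewrite mulN1r addrC.
rewrite -[cintegral (fun x => kernel_distribution (K e) u x * phi x)]/(cintegral (fun x => dnet r1 r2 u e x * phi x)).
rewrite -[cintegral (fun x => kernel_distribution (K e) v x * phi x)]/(cintegral (fun x => dnet r1 r2 v e x * phi x)).
set a := cintegral (fun x => dnet r1 r2 u e x * phi x); set b := cintegral (fun x => dnet r1 r2 v e x * phi x).
rewrite (_ : u phi - v phi = - (a - u phi) + (-1 * b + a) + (b - v phi)); last by ring.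
by rewrite (le_trans (normcD _ _))// lerD2r (le_trans (normcD _ _))// normcN.
Unshelve. all: by end_near. Qed.

(** The two unions of open sets in the definitions of the supports coincide.
    One inclusion is [dnet_negligible], as a net that is negligible on W has
    the zero class there. For the other, the pairing with a test function
    supported in W tends both to u f and to 0. *)
Lemma dnet_support u : compact_distribution u ->
  distribution_support u = gsupport (gclass setT (dnet r1 r2 u)).
Proof.
move=> du; rewrite /distribution_support /gsupport; congr (~` _).
apply/seteqP; split => x0 [U /= [oU hU] Ux0].
  have [W [oW Wx0 neg]] := dnet_negligible s1 s2 du oU Ux0 hU.
  exists W => //=; split => //; apply/seteqP; split => g.
    move=> [f [mf nf] [mg ng]]; split => //.
    have nf' := negligible_sub W nf.
    have := negligible_lin 1 oW ng (negligible_lin 1 oW nf' neg).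
    by congr negligible; apply/funext => e; apply/funext => x; ring.
  move=> [mg ng]; exists (dnet r1 r2 u); first exact: dnet_self openT du.
  split => //; have := negligible_lin (-1) oW neg ng.
  by congr negligible; apply/funext => e; apply/funext => x; ring.
exists U => //=; split => // f tf fU.
have [_ neg] : gclass U (fun _ _ => 0 : C) (dnet r1 r2 u).
  rewrite -hU; exists (dnet r1 r2 u); first exact: dnet_self openT du.
  exact: dnet_self.
have L := negligible_cvg neg (test_seminorm oU tf fU).
have Z : (fun _ : R => 0 : R) e @[e --> (0 : R)^'+] --> (0 : R) by exact: cvg_cst.
apply: (dist_zero_of_limits (pairing_limit du tf) L Z).
apply: nearW => e; rewrite addr0.
have -> : cintegral (fun x => (dnet r1 r2 u e x - 0) * f x) = cintegral (fun x => kernel_distribution (K e) u x * f x).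
  by congr cintegral; apply/funext => x; rewrite subr0.
set a := cintegral _; rewrite (_ : u f = - (a - u f) + a); last by ring.
by rewrite (le_trans (normcD _ _))// normcN opprD opprK addrCA subrr addr0.
Qed.

End limits.

End convergence.

Theorem proposition3p15 (R : realType) (n : nat)
    (rho : 'rV[R]_(n + n + 1) -> R[i])
    (hrho : schwartz rho)
    (hrho1 : cintegral rho = 1)
    (hmoments : forall a : mindex (n + n + 1), a != [ffun=> 0%N] ->
       cintegral (fun x => (mpow x a)%:C * rho x) = 0) :
  rapidly_converging_approximate_unit
    (fun e => integrated_rep (rescale rho e)).
Proof.
have [s1 s2] := schwartz_rschwartz hrho.
have m1 : mass 1 (re_ rho).
  apply: mass_moments => //; first exact: (congr1 (@complex.Re R) hrho1).
  move=> a /hmoments/(congr1 (@complex.Re R))/= E; rewrite -[RHS]E.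
  by apply: eq_Rintegral => t _; rewrite ReM /= mul0r subr0.
have m2 : mass 0 (im_ rho).
  apply: mass_moments => //; first exact: (congr1 (@complex.Im R) hrho1).
  move=> a /hmoments/(congr1 (@complex.Im R))/= E; rewrite -[RHS]E.
  by apply: eq_Rintegral => t _; rewrite ImM /= mul0r addr0.
exists (opK (re_ rho) (im_ rho)); split.
- move=> e e01; split; first exact: opK_schwartz.
  move=> f /wadm_L2 hf; apply: aeW => t; have [w1 w2] := hf (rvec t).
  have e0 : e != 0 by rewrite gt_eqF//; case/andP: e01.
  have E1 : re_ (rescale rho e) = rescaleR (re_ rho) e.
    by apply/funext => x; rewrite /re_ /rescale ReM /= mul0r subr0.
  have E2 : im_ (rescale rho e) = rescaleR (im_ rho) e.
    by apply/funext => x; rewrite /im_ /rescale ImM /= mul0r addr0.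
  rewrite kernel_fun_combine// integrated_rep_combine ?E1 ?E2//; exact: rschwartz_rescale.
- split.
    move=> u du; split; first exact: dnet_moderate.
    by move=> phi tphi; exact: pairing_limit.
  by move=> u v du dv; exact: dnet_injective.
- by move=> f; exact: test_negligible.
- by move=> u; exact: dnet_support.
Qed.
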